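(* Assume that $d\ge 3$. Then, conditional on the event $G_n$, the joint distribution of the occupation statistics $\{M_n(j)/n\}_{j\ge1}$ converges as $n\to\infty$. In particular, for certain constants $\kappa_j$ ($j\ge 1$) such that $\sum_{j=1}^{\infty}j\,\kappa_j=1$, $$\mathcal{L}\left(\left.\frac{Z_n}{n},\left\{\frac{M_n(j)}{n}\right\}_{j\ge 1},\frac{\Omega_n}{n}\,\right|\,G_n\right)\Longrightarrow\mathcal{L}\left(\Big(1,\{\kappa_j\}_{j\ge 1},\sum_{j}\kappa_j\Big)\cdot Y\right),$$ where $Y$ is an exponentially distributed random variable with mean $2/\sigma^2$.
   Context: Branching random walk: a nearest neighbor branching random walk on $\mathbb{Z}^d$ with offspring distribution $\mathcal{Q}=\{Q_l\}_{l\ge 0}$ evolves as follows: at each time $n=0,1,2,\dots$ every particle independently produces a random number of offspring with law $\mathcal{Q}$ (which replace it), and each offspring independently moves to a site chosen uniformly at random from the $2d+1$ sites at distance $\le 1$ from the location of its parent. Standing assumptions: $\mathcal{Q}$ has mean $1$ (criticality) and finite, positive variance $\sigma^2$; the process is started by a single particle at the origin at time $0$. Notation: $Z_n$ is the number of particles in generation $n$; $G_n=\{Z_n\geq 1\}$ is the event that the process survives to generation $n$; $M_n(j)$ is the number of multiplicity-$j$ sites in generation $n$, i.e. sites occupied by exactly $j$ particles of generation $n$; $\Omega_n$ is the number of occupied sites in generation $n$. $\mathcal{L}(\cdot\mid G_n)$ denotes conditional law given $G_n$ and $\Longrightarrow$ denotes weak convergence (joint convergence in distribution of the sequence-valued random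 vector, i.e. in the product topology).
   Formalization: The limit Y is taken exponential with rate 2/σ², i.e. mean σ²/2, instead of mean 2/σ²: by Yaglom's theorem the stated mean is wrong unless σ²=2 (e.g. offspring 0 or 2 with probability 1/2 each has σ²=1 and E[Z_n/n | G_n]→1/2). *)

(* Defs.v *)
(* MathComp / MathComp-Analysis *)
From HB Require Import structures.
From mathcomp Require Export all_boot all_order all_algebra.
From mathcomp Require Export all_classical all_reals all_analysis.
Export Order.TTheory GRing.Theory Num.Theory.
Export numFieldNormedType.Exports.

Set Implicit Arguments.
Unset Strict Implicit.
Unset Printing Implicit Defensive.

Local Open Scope classical_set_scope.
Local Open Scope ring_scope.

(* For [F i] the sigma-algebra generated by a random variable [X i], this is
   the mutual independence of the family [X]. *)
Definition mutually_independent (d : measure_display) (T : measurableType d)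
    (R : realType) (P : probability T R) (I : eqType) (F : I -> set (set T)) :
    Prop :=
  forall (J : seq I) (E : I -> set T),
    uniq J -> (forall i, i \in J -> F i (E i)) ->
    P (\bigcap_(i in [set i | i \in J]) E i) = (\prod_(i <- J) P (E i))%E.

Section Genealogy.
Context (T : Type) (dim : nat).
Variables (offspring : seq nat -> T -> nat) (step : seq nat -> T -> 'rV[int]_dim).

(* A (potential) individual is named by the ranks of its ancestors among their
   siblings, youngest first: the ancestor of the population is [::] and the
   children of u are k :: u. *)
Fixpoint generation (n : nat) (w : T) : seq (seq nat) :=
  if n is m.+1
  then [seq k :: u | u <- generation m w, k <- iota 0 (offspring u w)]
  else [:: [::]].

(* [step (k :: u)] is the displacement of k :: u from its parent u; [step [::]]
   is never used, the ancestor sitting at the origin. *)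
Fixpoint position (u : seq nat) (w : T) : 'rV[int]_dim :=
  if u is k :: v then position v w + step u w else 0.

Definition positions (n : nat) (w : T) : seq 'rV[int]_dim :=
  [seq position u w | u <- generation n w].

Definition population (n : nat) (w : T) : nat := size (generation n w).

Definition survival (n : nat) : set T := [set w | (1 <= population n w)%N].

Definition multiplicity_sites (n j : nat) (w : T) : nat :=
  count (fun x => count_mem x (positions n w) == j) (undup (positions n w)).

Definition occupied_sites (n : nat) (w : T) : nat :=
  size (undup (positions n w)).

End Genealogy.

(* Offspring numbers and displacements are attached to all potential
   individuals; only those of actual individuals (and, for displacements,
   non-root ones) influence the process.  Every subset of nat and of Z^dim is
   measurable. *)
Record branching_random_walk (R : realType) (dim : nat) (Q : probability nat R)
    (d : measure_display) (T : measurableType d) (P : probability T R)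
    (offspring : seq nat -> {RV P >-> nat})
    (step : seq nat -> T -> 'rV[int]_dim) : Prop := {
  offspring_law : forall (u : seq nat) (A : set nat),
    distribution P (offspring u) A = Q A ;
  step_measurable : forall (u : seq nat) (B : set 'rV[int]_dim),
    measurable (step u @^-1` B) ;
  (* the sites at distance at most 1 from the origin are the origin and its 2 dim
     neighbours *)
  step_law : forall (u : seq nat) (e : 'rV[int]_dim),
    \sum_(i < dim) `|e ord0 i| <= 1 ->
    P (step u @^-1` [set e]) = ((2 * dim + 1)%:R^-1 : R)%:E ;
  offspring_step_independent :
    mutually_independent P
      (fun s : seq nat + seq nat =>
         match s with
         | inl u => preimage_set_system setT (offspring u) setT
         | inr u => preimage_set_system setT (step u) setT
         end)
}.

(* Weak convergence, tested on bounded continuous functions: the left-hand side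
   is E[f(X_n) | G_n].  The spaces carrying X and Xlim may differ, since only
   the laws matter. *)
Definition cvg_in_law_given (R : realType) (E : topologicalType)
    (d : measure_display) (T : measurableType d) (P : probability T R)
    (G : nat -> set T) (X : nat -> T -> E)
    (d' : measure_display) (T' : measurableType d') (P' : probability T' R)
    (Xlim : T' -> E) : Prop :=
  forall f : E -> R, continuous f -> (exists M : R, forall x, `|f x| <= M) ->
    (fun n => (\int[P]_(w in G n) f (X n w)) / fine (P (G n))) @ \oo -->
    \int[P']_w f (Xlim w).

(* [exponential_prob] takes the rate, so the mean of Y is rate^-1. *)
Definition exponentially_distributed (R : realType)
    (d : measure_display) (T : measurableType d) (P : probability T R)
    (Y : {RV P >-> R}) (rate : R) : Prop :=
  forall A : set R, measurable A -> distribution P Y A = exponential_prob rate A.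

(* Main.v *)
Require Import Defs.
From mathcomp Require Import measurable_realfun lra ring zify.

(* Group the particles of generation n + m by their ancestor in generation n.
   A site statistic Phi (number of sites of multiplicity j, or of occupied
   sites) differs from the sum of its values on the blocks by at most the number
   of pairs of particles of different blocks sharing a site.  For d >= 3 the mean
   number of colliding pairs stays bounded in n (the difference of two walks is
   transient, as the superharmonic function (500 + |x|^2)^(-1/4) shows), and it is
   nondecreasing, so the mean of Phi is Cauchy with some limit c, and the error
   made by cutting into blocks of age m is small for m large, uniformly in n.  The
   blocks are independent copies of the cloud of age m, so the sum over blocks
   minus its mean per particle has bounded variance; as it vanishes off the
   survival event, of probability O(1/n), E |Phi - c Z_n| tends to 0.  On the event
   of survival everything is thus a multiple of Z_n/n, whose conditional law is
   exponential in the limit (Yaglom) by iteration of the generating function. *)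

Set Implicit Arguments.
Unset Strict Implicit.
Unset Printing Implicit Defensive.

(** * Site statistics and collisions of finite configurations *)

(** The scale decides everything: the statistics are divided by n and conditioned on an event of
    probability of order 1/n, so an unconditional first-moment error that is merely o(1) is divided
    by n P(G_n), which stays away from 0, and remains negligible. Only two moments of [Q] are
    available, so collisions enter through their mean alone and second moments are computed for sums
    over blocks. The constants kappa_j must be chosen before the probability space, which is why
    laws are written as explicit functionals of [Q]. Configurations are finite sequences of integer
    vectors and thus form a countable type: measurability and integration reduce to fibres and
    series, even for a continuous test function on the infinite product. The identity sum_j j
    kappa_j = 1 says that no mass escapes to high multiplicities: particles on sites of multiplicity
    at least J number at most (collisions)/J. The exponential limit is tested on polynomials in
    exp(-z), whose conditional means are Laplace transforms at integers. *)

Section Sites.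
Local Open Scope nat_scope.
Context (X : eqType).
Implicit Types (B C s : seq X) (p : pred nat) (W : seq (seq X)).

(** One predicate on multiplicities covers both statistics: [pred1 j] gives the sites of
    multiplicity [j], [ltn 0] the occupied sites. When [p 0] fails, the count may be taken over any
    finite set of sites containing [B]. *)
Definition sites p B : nat := count (fun x => p (count_mem x B)) (undup B).

(** Ordered pairs, diagonal included: [coll B B] is the sum of the squared multiplicities of [B]. *)
Definition coll B C : nat := \sum_(x <- B) \sum_(y <- C) (x == y).

Lemma sum_count_mem B s (g : X -> nat) : uniq s -> {subset B <= s} ->
  \sum_(x <- B) g x = \sum_(x <- s) count_mem x B * g x.
Proof.
move=> us; elim: B => [|y B ih] Bs.
  by rewrite big_nil big1.
rewrite big_cons ih; last by move=> x xB; apply: Bs; rewrite inE xB orbT.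
under [RHS]eq_bigr do rewrite /= mulnDl.
rewrite big_split /=; congr (_ + _).
have ys : y \in s by apply: Bs; rewrite mem_head.
rewrite (bigD1_seq y)//= eqxx mul1n big1 ?addn0// => x xy.
by rewrite eq_sym (negbTE xy).
Qed.

Lemma coll_count B C s : uniq s -> {subset B <= s} ->
  coll B C = \sum_(x <- s) count_mem x B * count_mem x C.
Proof.
move=> us Bs; rewrite /coll (sum_count_mem _ us Bs); apply: eq_bigr => x _.
congr (_ * _); rewrite -sum1_count [RHS]big_mkcond /=; apply: eq_bigr => y _.
by rewrite /= eq_sym; case: eqP.
Qed.

Lemma size_count B s : uniq s -> {subset B <= s} ->
  size B = \sum_(x <- s) count_mem x B.
Proof.
move=> us Bs; rewrite -sum1_size (sum_count_mem _ us Bs).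
by apply: eq_bigr => x _; rewrite muln1.
Qed.

Lemma sum_subset B s (g : X -> nat) : uniq s -> {subset B <= s} ->
  (forall x, x \notin B -> g x = 0) -> \sum_(x <- undup B) g x = \sum_(x <- s) g x.
Proof.
move=> us Bs g0.
rewrite (@sum_count_mem (undup B) s g us); last by move=> x; rewrite mem_undup => /Bs.
apply: eq_bigr => x _; rewrite count_uniq_mem ?undup_uniq// mem_undup.
by case: (boolP (x \in B)) => [_|/g0 ->]; rewrite ?mul1n ?muln0.
Qed.

Lemma sites_count p B s : ~~ p 0 -> uniq s -> {subset B <= s} ->
  sites p B = \sum_(x <- s) p (count_mem x B).
Proof.
move=> p0 us Bs; rewrite /sites -sum1_count big_mkcond /=.
rewrite -(sum_subset us Bs); first by apply: eq_bigr => x _; case: (p _).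
by move=> x /count_memPn ->; rewrite (negbTE p0).
Qed.

Lemma sites_le_size p B : ~~ p 0 -> sites p B <= size B.
Proof.
by move=> p0; rewrite (leq_trans (count_size _ _))// size_undup.
Qed.

(** Site by site: the two counts can differ only where [B] and [C] are both present, by at most 2,
    and there the product of the multiplicities is at least 1. *)
Lemma sites_cat p B C : ~~ p 0 ->
  sites p (B ++ C) <= sites p B + sites p C + 2 * coll B C /\
  sites p B + sites p C <= sites p (B ++ C) + 2 * coll B C.
Proof.
move=> p0; pose s := undup (B ++ C).
have us : uniq s by exact: undup_uniq.
have sB : {subset B <= s} by move=> x xB; rewrite mem_undup mem_cat xB.
have sC : {subset C <= s} by move=> x xC; rewrite mem_undup mem_cat xC orbT.
have sBC : {subset B ++ C <= s} by move=> x; rewrite mem_undup.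
rewrite (sites_count p0 us sB) (sites_count p0 us sC) (sites_count p0 us sBC).
rewrite (coll_count _ us sB) big_distrr -!big_split /=.
split; apply: leq_sum => x _; rewrite count_cat;
  move: (count_mem x B) (count_mem x C) => [|b] [|c]; rewrite ?addn0 ?add0n ?(negbTE p0)//;
  case: (p b.+1) => //; case: (p c.+1) => //; case: (p _) => /=; nia.
Qed.

Lemma coll_cat B C B' C' :
  coll (B ++ C) (B' ++ C') = coll B B' + coll B C' + coll C B' + coll C C'.
Proof.
rewrite /coll big_cat /=.
under eq_bigr do rewrite big_cat /=.
rewrite big_split /= -!addnA; congr (_ + (_ + _)).
under eq_bigr do rewrite big_cat /=.
by rewrite big_split.
Qed.

Lemma collC B C : coll B C = coll C B.
Proof.
rewrite /coll exchange_big; apply: eq_bigr => x _; apply: eq_bigr => y _.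
by rewrite eq_sym.
Qed.

(** The error is the number of ordered colliding pairs from different blocks, that is all pairs
    minus those inside a block; it is written additively because subtraction on [nat] truncates. *)
Lemma sites_flatten p W : ~~ p 0 ->
  sites p (flatten W) + \sum_(B <- W) coll B B <=
    \sum_(B <- W) sites p B + coll (flatten W) (flatten W) /\
  \sum_(B <- W) sites p B + \sum_(B <- W) coll B B <=
    sites p (flatten W) + coll (flatten W) (flatten W).
Proof.
move=> p0; elim: W => [|B W [ih1 ih2]]; first by rewrite /= !big_nil.
rewrite /= !big_cons coll_cat (collC (flatten W) B).
have [h1 h2] := sites_cat B (flatten W) p0.
by split; lia.
Qed.

(** Markov's inequality for multiplicities: a site of multiplicity k >= J, missing from the
    truncated sum, satisfies J k <= k^2, its share of [coll B B]. *)
Lemma size_sites J B :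
  \sum_(1 <= j < J) j * sites (pred1 j) B <= size B /\
  J * size B <= J * (\sum_(1 <= j < J) j * sites (pred1 j) B) + coll B B.
Proof.
pose s := undup B.
have us : uniq s by exact: undup_uniq.
have sB : {subset B <= s} by move=> x; rewrite mem_undup.
have -> : \sum_(1 <= j < J) j * sites (pred1 j) B =
    \sum_(x <- s) \sum_(1 <= j < J) j * (count_mem x B == j).
  rewrite exchange_big /=; apply: eq_big_nat => j /andP[j0 _].
  have pj : ~~ pred1 j 0 by rewrite /= eq_sym -lt0n.
  by rewrite (sites_count pj us sB) big_distrr.
have key k : \sum_(1 <= j < J) j * (k == j) = if (k < J) then k else 0.
  have [kJ|Jk] := ltnP k J.
    case: k kJ => [|k] kJ; first by rewrite big_nat big1// => j /andP[]; case: j => // j _ _; rewrite muln0.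
    rewrite (bigD1_seq k.+1) ?mem_index_iota ?iota_uniq//= eqxx muln1 big1 ?addn0// => j.
    by rewrite eq_sym => /negbTE ->; rewrite muln0.
  rewrite big_nat big1// => j /andP[_ jJ]; rewrite (_ : k == j = false) ?muln0//.
  by apply/eqP; lia.
under eq_bigr do rewrite key.
rewrite (size_count us sB) (coll_count _ us sB); split.
  by apply: leq_sum => x _; case: ifP.
rewrite !big_distrr -big_split /=; apply: leq_sum => x _; case: ifP => h; nia.
Qed.

(** As for the size, a site of multiplicity k >= J with k > 0 now being charged J <= k^2. *)
Lemma occupied_sites_split J B :
  \sum_(1 <= j < J) sites (pred1 j) B <= sites (ltn 0) B /\
  J * sites (ltn 0) B <= J * (\sum_(1 <= j < J) sites (pred1 j) B) + coll B B.
Proof.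
pose s := undup B.
have us : uniq s by exact: undup_uniq.
have sB : {subset B <= s} by move=> x; rewrite mem_undup.
have -> : \sum_(1 <= j < J) sites (pred1 j) B =
    \sum_(x <- s) \sum_(1 <= j < J) (count_mem x B == j).
  rewrite exchange_big /=; apply: eq_big_nat => j /andP[j0 _].
  have pj : ~~ pred1 j 0 by rewrite /= eq_sym -lt0n.
  by rewrite (sites_count pj us sB).
have key k : \sum_(1 <= j < J) (k == j) = (0 < k < J) :> nat.
  have [kJ|Jk] := ltnP k J; last first.
    rewrite andbF big_nat big1// => j /andP[_ jJ].
    by rewrite (_ : k == j = false)//; apply/eqP; lia.
  case: k kJ => [|k] kJ; first by rewrite big_nat big1// => j /andP[]; case: j.
  rewrite (bigD1_seq k.+1) ?mem_index_iota ?iota_uniq//= eqxx big1 ?addn0// => j.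
  by rewrite eq_sym => /negbTE ->.
under eq_bigr do rewrite key.
rewrite (@sites_count (ltn 0) B s isT us sB) (coll_count _ us sB); split.
  by apply: leq_sum => x _ /=; case: (0 < _) => //=; case: (_ < _).
rewrite !big_distrr -big_split /=; apply: leq_sum => x _.
by have [] := ltnP 0 (count_mem x B); have [] := ltnP (count_mem x B) J => /=; nia.
Qed.

End Sites.

Lemma coll_map (X Y : eqType) (f : X -> Y) (B C : seq X) : injective f ->
  coll [seq f x | x <- B] [seq f x | x <- C] = coll B C.
Proof.
move=> fi; rewrite /coll big_map; apply: eq_bigr => x _; rewrite big_map.
by apply: eq_bigr => y _; rewrite inj_eq.
Qed.

Lemma sites_map (X Y : eqType) (f : X -> Y) p (B : seq X) : injective f ->
  sites p [seq f x | x <- B] = sites p B.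
Proof.
move=> fi; rewrite /sites undup_map_inj// count_map; apply: eq_count => x /=.
by congr p; rewrite count_map; apply: eq_count => y /=; rewrite inj_eq.
Qed.

Local Open Scope classical_set_scope.
Local Open Scope ring_scope.

(** * Independence over disjoint sets of individuals *)

Section Grouping.
Context (d : measure_display) (T : measurableType d) (R : realType)
  (P : probability T R) (I : eqType) (F : I -> set (set T)).
Hypothesis F_setT : forall i, F i setT.
Hypothesis F_setI : forall i, setI_closed (F i).
Hypothesis F_measurable : forall i, F i `<=` measurable.
Hypothesis F_indep : mutually_independent P F.

Definition cylinder (J : set I) (A : set T) : Prop :=
  exists s : seq I, exists E : I -> set T,
    [/\ uniq s, forall i, i \in s -> J i, forall i, F i (E i) &
        A = \bigcap_(i in [set i | i \in s]) E i].

Definition sigma_on (J : set I) : set (set T) := <<s cylinder J >>.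

Lemma cylinder_setI J : setI_closed (cylinder J).
Proof.
move=> _ _ [s [E [us sJ FE ->]]] [t [E' [ut tJ FE' ->]]].
exists (undup (s ++ t)), (fun i => (if i \in s then E i else setT) `&`
                                   (if i \in t then E' i else setT)); split.
- exact: undup_uniq.
- by move=> i; rewrite mem_undup mem_cat => /orP[/sJ|/tJ].
- by move=> i; apply: F_setI; case: ifP.
- apply/seteqP; split => w.
    move=> [h1 h2] i /=; rewrite mem_undup mem_cat => _; split.
      by case: ifPn => // /h1.
    by case: ifPn => // /h2.
  move=> h; split => i /= hi.
    by have := h i; rewrite /= mem_undup mem_cat hi /= => /(_ isT)[].
  by have := h i; rewrite /= mem_undup mem_cat hi orbT /= => /(_ isT)[].
Qed.

Lemma cylinder_indep (J K : set I) A B : J `&` K = set0 ->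
  cylinder J A -> cylinder K B -> P (A `&` B) = (P A * P B)%E.
Proof.
move=> JK [s [E [us sJ FE ->]]] [t [E' [ut tK FE' ->]]].
have st i : i \in t -> i \notin s.
  move=> it; apply/negP => is_; have : (J `&` K) i by split; [exact: sJ|exact: tK].
  by rewrite JK.
pose G i := if i \in s then E i else E' i.
have FG i : F i (G i) by rewrite /G; case: ifP.
have -> : \bigcap_(i in [set i | i \in s]) E i `&`
    \bigcap_(i in [set i | i \in t]) E' i = \bigcap_(i in [set i | i \in s ++ t]) G i.
  apply/seteqP; split => w.
    move=> [h1 h2] i /=; rewrite mem_cat /G; case: ifPn => [/h1//|is_ /= it].
    exact: h2.
  move=> h; split => i /= hi.
    by have := h i; rewrite /= mem_cat hi /G hi; exact.
  by have := h i; rewrite /= mem_cat hi orbT /G (negbTE (st _ hi)); exact.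
rewrite !F_indep//.
  rewrite big_cat/=; congr (_ * _)%E; apply: eq_big_seq => i hi; rewrite /G ?hi//.
  by rewrite (negbTE (st _ hi)).
rewrite cat_uniq us ut andbT /=; apply/hasPn => i /= it; exact: st.
Qed.

Lemma cylinder_measurable J A : cylinder J A -> measurable A.
Proof.
move=> [s [E [_ _ FE ->]]]; apply: fin_bigcap_measurable.
  exact: finite_seq.
by move=> i _; apply: F_measurable; exact: FE.
Qed.

Lemma sigma_on_measurable J A : sigma_on J A -> measurable A.
Proof.
apply: smallest_sub; first exact: sigma_algebra_measurable.
by move=> B; exact: cylinder_measurable.
Qed.

(** The events independent of a fixed [B] form a Dynkin class, which is the input of the pi-lambda
    theorem together with the pi-system of cylinders. *)
Lemma indep_lambda (B : set T) : measurable B ->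
  lambda_system setT [set A | measurable A /\ P (A `&` B) = (P A * P B)%E].
Proof.
move=> mB; split => //=.
- by split; [exact: measurableT|rewrite setTI probability_setT mul1e].
- move=> X Y YX /= [mX hX] [mY hY]; split; first exact: measurableD.
  have fP C : measurable C -> (P C < +oo)%E.
    by move=> mC; rewrite (le_lt_trans (probability_le1 _ _))// ltry.
  have -> : (X `\` Y) `&` B = (X `&` B) `\` (Y `&` B).
    by apply/seteqP; split => w /=; tauto.
  have YXB : Y `&` B `<=` X `&` B by exact: setSI.
  transitivity (P (X `&` B) - P (Y `&` B))%E.
    rewrite measureD ?fP//; [|exact: measurableI..].
    by rewrite (setIidr YXB).
  rewrite measureD ?fP// (setIidr YX) hX hY.
  by rewrite muleBl// ?fin_num_measure// fin_num_adde_defr// fin_num_measure.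
- move=> G ndG /= hG; split.
    by apply: bigcup_measurable => i _; have [] := hG i.
  have mG i : measurable (G i) by have [] := hG i.
  rewrite setI_bigcupl.
  have c1 : (fun n => P (G n `&` B)) @ \oo --> P (\bigcup_n (G n `&` B)).
    apply: nondecreasing_cvg_mu.
    - by move=> i; exact: measurableI.
    - by apply: bigcup_measurable => i _; exact: measurableI.
    - by move=> i j ij; apply/subsetPset; apply: setSI; apply/subsetPset/ndG.
  have c2 : (fun n => P (G n) * P B)%E @ \oo --> (P (\bigcup_n G n) * P B)%E.
    apply: cvgeZr; first exact: fin_num_measure.
    by apply: nondecreasing_cvg_mu => //; exact: bigcup_measurable.
  apply: (cvg_unique _ c1) => //.
  rewrite (_ : (fun n => P (G n `&` B)) = (fun n => P (G n) * P B)%E)//.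
  by apply/funext => n; have [] := hG n.
Qed.

(** The pi-lambda theorem is applied twice, one event at a time: against a fixed cylinder of [K] to
    reach all of [sigma_on J], then against the fixed [A] to reach all of [sigma_on K]. *)
Lemma sigma_on_indep (J K : set I) A B : J `&` K = set0 ->
  sigma_on J A -> sigma_on K B -> P (A `&` B) = (P A * P B)%E.
Proof.
move=> JK sA sB.
have h1 C : cylinder K C -> P (A `&` C) = (P A * P C)%E.
  move=> cC; have mC := cylinder_measurable cC.
  suff : [set A | measurable A /\ P (A `&` C) = (P A * P C)%E] A by case.
  apply: (lambda_system_subset (@cylinder_setI J) (indep_lambda mC) _ _ sA) => //.
  move=> X cX; split; first exact: cylinder_measurable cX.
  exact: cylinder_indep JK cX cC.
have mA := sigma_on_measurable sA.
suff : [set B | measurable B /\ P (B `&` A) = (P B * P A)%E] B.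
  by case; rewrite setIC muleC.
apply: (lambda_system_subset (@cylinder_setI K) (indep_lambda mA) _ _ sB) => //.
move=> X cX; split; first exact: cylinder_measurable cX.
by rewrite setIC muleC h1.
Qed.

Lemma sub_sigma_on (J K : set I) : J `<=` K -> sigma_on J `<=` sigma_on K.
Proof.
move=> JK; apply: smallest_sub; first exact: smallest_sigma_algebra.
move=> A [s [E [us sJ FE ->]]]; apply: sub_sigma_algebra.
by exists s, E; split => // i /sJ /JK.
Qed.

Lemma sigma_on_gen (J : set I) i A : J i -> F i A -> sigma_on J A.
Proof.
move=> Ji FA; apply: sub_sigma_algebra.
exists [:: i], (fun j => if j == i then A else setT); split => //.
- by move=> j; rewrite inE => /eqP ->.
- by move=> j; case: eqP => [->|].
- apply/seteqP; split => w /=.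
    by move=> wA j /=; rewrite mem_seq1 => /eqP ->; rewrite eqxx.
  by move=> /(_ i) /=; rewrite mem_seq1 eqxx; exact.
Qed.

End Grouping.

(** * Random variables with countably many values *)

Section Adapted.
Context (d : measure_display) (T : measurableType d) (R : realType)
  (P : probability T R) (I : eqType) (F : I -> set (set T)).
Hypothesis F_setT : forall i, F i setT.
Hypothesis F_setI : forall i, setI_closed (F i).
Hypothesis F_measurable : forall i, F i `<=` measurable.
Hypothesis F_indep : mutually_independent P F.

(** Measurability is asked of fibres only; for a countable codomain this yields every preimage, so
    no sigma-algebra on configurations has to be chosen. *)
Definition adapted (A : Type) (J : set I) (X : T -> A) : Prop :=
  forall a, sigma_on F J (X @^-1` [set a]).

Lemma sigma_on_bigcup (A : countType) (J : set I) (G : A -> set T) :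
  (forall a, sigma_on F J (G a)) -> sigma_on F J (\bigcup_a G a).
Proof.
move=> sG.
have [s0 _ sU] := @smallest_sigma_algebra T setT (cylinder F J).
rewrite (_ : \bigcup_a G a = \bigcup_n (oapp G set0 (unpickle n))).
  by apply: sU => n; case: unpickle.
apply/seteqP; split => w [x _ hx].
  by exists (pickle x) => //=; rewrite pickleK.
by move: hx; case E : (unpickle x) => [a|]//= hx; exists a.
Qed.

Lemma sigma_on_setI (J : set I) A B :
  sigma_on F J A -> sigma_on F J B -> sigma_on F J (A `&` B).
Proof.
move=> sA sB.
exact: (@measurableI _ (g_sigma_algebraType (cylinder F J))).
Qed.

Lemma sigma_on0 (J : set I) : sigma_on F J set0.
Proof. by have [] := @smallest_sigma_algebra T setT (cylinder F J). Qed.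

Lemma sigma_onT (J : set I) : sigma_on F J setT.
Proof.
apply: sub_sigma_algebra; exists [::], (fun=> setT); split => //.
by apply/seteqP; split => w.
Qed.

Lemma adapted_set (A : countType) J (X : T -> A) (S : set A) :
  adapted J X -> sigma_on F J (X @^-1` S).
Proof.
move=> aX.
rewrite (_ : X @^-1` S = \bigcup_a (if a \in S then X @^-1` [set a] else set0)).
  by apply: sigma_on_bigcup => a; case: ifP => // _; exact: sigma_on0.
apply/seteqP; split => w /=.
  by move=> SX; exists (X w) => //=; rewrite mem_set.
by move=> [a _]; case: ifPn => //; rewrite inE => Sa /= ->.
Qed.

Lemma adapted_cst (A : countType) J (a : A) : adapted J (fun=> a).
Proof.
move=> b; have [<-|ab] := pselect (a = b).
  by rewrite (_ : _ @^-1` _ = setT); [exact: sigma_onT|apply/seteqP; split].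
by rewrite (_ : _ @^-1` _ = set0); [exact: sigma_on0|apply/seteqP; split].
Qed.

(** A random index may select the variable; this is what a random number of children requires. *)
Lemma adapted_bind (A B : countType) J (X : T -> A) (Y : A -> T -> B) :
  adapted J X -> (forall a, adapted J (Y a)) -> adapted J (fun w => Y (X w) w).
Proof.
move=> aX aY b.
rewrite (_ : _ @^-1` _ = \bigcup_a (X @^-1` [set a] `&` Y a @^-1` [set b])).
  apply: sigma_on_bigcup => a; apply: sigma_on_setI; [exact: aX|exact: aY].
apply/seteqP; split => w /=; first by move=> <-; exists (X w).
by move=> [a _ /= [->]].
Qed.

Lemma adapted_comp (A B : countType) J (X : T -> A) (f : A -> B) :
  adapted J X -> adapted J (fun w => f (X w)).
Proof. by move=> aX b; exact: (adapted_set (f @^-1` [set b]) aX). Qed.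

Lemma adapted_comp2 (A B C : countType) J (X : T -> A) (Y : T -> B)
  (f : A -> B -> C) :
  adapted J X -> adapted J Y -> adapted J (fun w => f (X w) (Y w)).
Proof.
move=> aX aY; apply: (@adapted_bind A C J X (fun a w => f a (Y w)) aX) => a.
exact: adapted_comp.
Qed.

Lemma adapted_flatten (A : countType) J (S : eqType) (X : S -> T -> seq A) (s : seq S) :
  (forall k, k \in s -> adapted J (X k)) ->
  adapted J (fun w => flatten [seq X k w | k <- s]).
Proof.
elim: s => [|k s ih] aX /=; first exact: adapted_cst.
apply: adapted_comp2; first by apply: aX; rewrite mem_head.
by apply: ih => i it; apply: aX; rewrite inE it orbT.
Qed.

Lemma sub_adapted (A : Type) J K (X : T -> A) :
  J `<=` K -> adapted J X -> adapted K X.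
Proof. by move=> JK aX a; apply: (sub_sigma_on JK); exact: aX. Qed.

Lemma adapted_measurable_set (A : countType) J (X : T -> A) (S : set A) :
  adapted J X -> measurable (X @^-1` S).
Proof. by move=> aX; apply: (sigma_on_measurable F_measurable); exact: adapted_set aX. Qed.

Lemma adapted_emeasurable (A : countType) J (X : T -> A) (h : A -> \bar R) (D : set T) :
  adapted J X -> measurable D -> measurable_fun D ((fun w => h (X w)) : T -> \bar R).
Proof.
move=> aX mD _ B _; apply: measurableI => //.
exact: (adapted_measurable_set (h @^-1` B) aX).
Qed.

(** The integral as a series over the codes of the values. A code [n] that is no [pickle a] has an
    empty fibre, so the value given to [h] there does not count. *)
Lemma integral_adapted (A : countType) J (X : T -> A) (h : A -> \bar R) (D : set T) :
  adapted J X -> measurable D -> (forall a, 0 <= h a)%E ->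
  (\int[P]_(w in D) h (X w) =
   \sum_(n <oo) oapp h 0 (unpickle n) * P (D `&` X @^-1` [set a | pickle a = n]))%E.
Proof.
move=> aX mD h0.
pose E n := D `&` X @^-1` [set a | pickle a = n].
have mE n : measurable (E n).
  by apply: measurableI => //; exact: adapted_measurable_set aX.
have DE : D = \bigcup_n E n.
  apply/seteqP; split => w; first by move=> Dw; exists (pickle (X w)).
  by move=> [n _ []].
have tE : trivIset setT E.
  by apply/trivIsetP => i j _ _ /eqP ij; apply/seteqP; split => w //= [[_ wi] [_ wj]]; apply: ij; rewrite -wi -wj.
rewrite [in LHS]DE ge0_integral_bigcup//; last first.
  by apply: (adapted_emeasurable h aX); exact: bigcup_measurable.
apply: eq_eseriesr => n _.
rewrite -integral_cst//; last exact: mE.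
apply: eq_integral => w; rewrite inE => -[_ /= <-].
by rewrite pickleK.
Qed.

Lemma integral_indep_set (A : countType) J K (X : T -> A) (h : A -> \bar R) (D : set T) :
  J `&` K = set0 -> sigma_on F J D -> adapted K X -> (forall a, 0 <= h a)%E ->
  (\int[P]_(w in D) h (X w) = P D * \int[P]_w h (X w))%E.
Proof.
move=> JK sD aX h0.
have mD : measurable D by apply: (sigma_on_measurable F_measurable); exact: sD.
rewrite !(integral_adapted aX)// -(fineK (fin_num_measure P D mD)) -nneseriesZl//; last first.
  by move=> n _; rewrite mule_ge0//; case: unpickle => /=.
apply: eq_eseriesr => n _; rewrite fineK ?fin_num_measure//.
rewrite (sigma_on_indep F_setT F_setI F_measurable F_indep JK)//; last first.
  exact: adapted_set.
by rewrite setTI muleCA.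
Qed.

(** Fubini for independent discrete variables: on each fibre of [X] the first argument is frozen,
    and the event is independent of [Y]. *)
Lemma integral_indep (A B : countType) J K (X : T -> A) (Y : T -> B)
    (h : A -> B -> \bar R) :
  J `&` K = set0 -> adapted J X -> adapted K Y -> (forall a b, 0 <= h a b)%E ->
  (\int[P]_w h (X w) (Y w) = \int[P]_w \int[P]_w' h (X w) (Y w'))%E.
Proof.
move=> JK aX aY h0.
pose H a := (\int[P]_w' h a (Y w'))%E.
have H0 a : (0 <= H a)%E by apply: integral_ge0.
rewrite -/(fun w => H (X w)) [RHS](integral_adapted (h := H) aX)//.
pose E n := X @^-1` [set a | pickle a = n].
have sE n : sigma_on F J (E n) by exact: adapted_set.
have mE n : measurable (E n) by exact: (sigma_on_measurable F_measurable (sE n)).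
have DE : [set: T] = \bigcup_n E n.
  by apply/seteqP; split => w // _; exists (pickle (X w)).
have tE : trivIset setT E.
  by apply/trivIsetP => i j _ _ /eqP ij; apply/seteqP; split => w //= [wi wj]; apply: ij; rewrite -wi -wj.
rewrite [in LHS]DE ge0_integral_bigcup//; last first.
  have aXY : adapted setT (fun w => (X w, Y w)).
    by apply: (@adapted_comp2 _ _ _ _ _ _ pair); apply: sub_adapted; [|exact: aX| |exact: aY].
  apply: (adapted_emeasurable (fun ab => h ab.1 ab.2) aXY).
  exact: bigcup_measurable.
apply: eq_eseriesr => n _; rewrite setTI.
case En : (unpickle n) => [a|] /=; last first.
  rewrite mul0e (_ : E n = set0) ?integral_set0//.
  by apply/seteqP; split => w //= Ew; move: En; rewrite -Ew pickleK.
rewrite muleC -(integral_indep_set JK (sE n) aY (h0 a)).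
apply: eq_integral => w; rewrite inE => /= Ew.
by move: En; rewrite -Ew pickleK => -[->].
Qed.

End Adapted.

(** * The cloud of descendants and its first-generation decomposition *)

Section Grow.
Context (T : Type) (dim : nat).
Variables (offspring : seq nat -> T -> nat) (step : seq nat -> T -> 'rV[int]_dim).
Implicit Types (base : seq nat -> T -> seq (seq 'rV[int]_dim)) (v : seq nat).

Definition shift (e : 'rV[int]_dim) (s : seq (seq 'rV[int]_dim)) :=
  [seq [seq e + x | x <- B] | B <- s].

(** The recursion splits off the first generation, where the branching property applies, whereas
    [generation] adds the last one. Positions are relative to [v], and [base] tells which blocks
    hang at each descendant of generation [n], so the same recursion serves single particles and
    whole clouds. *)
Fixpoint grow n base v w : seq (seq 'rV[int]_dim) :=
  if n is m.+1
  then flatten [seq shift (step (k :: v) w) (grow m base (k :: v) w)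
               | k <- iota 0 (offspring v w)]
  else base v w.

Definition single v (w : T) : seq (seq 'rV[int]_dim) := [:: [:: 0]].

Definition cloud n v w : seq 'rV[int]_dim := flatten (grow n single v w).

Definition blocks n m := grow n (fun v w => [:: cloud m v w]).

Definition child n base k v w := shift (step (k :: v) w) (grow n base (k :: v) w).

(** The range of ranks starts at a general [i] so that the children can be removed one by one. *)
Definition children n base v i l w :=
  flatten [seq child n base k v w | k <- iota i l].

Lemma growS n base v w :
  grow n.+1 base v w = children n base v 0 (offspring v w) w.
Proof. by []. Qed.

Lemma flatten_shift e s : flatten (shift e s) = [seq e + x | x <- flatten s].
Proof. by elim: s => //= B s ih; rewrite map_cat -ih. Qed.

Lemma flatten_flatten (A : Type) (s : seq (seq (seq A))) :
  flatten (flatten s) = flatten [seq flatten x | x <- s].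
Proof. by elim: s => //= x s <-; rewrite flatten_cat. Qed.

Lemma grow_add n m base v w :
  grow (n + m) base v w = grow n (grow m base) v w.
Proof.
elim: n v => //= n ih v; congr flatten; apply: eq_map => k; by rewrite ih.
Qed.

Lemma flatten_grow n base base' v w :
  (forall u, flatten (base u w) = flatten (base' u w)) ->
  flatten (grow n base v w) = flatten (grow n base' v w).
Proof.
move=> h; elim: n v => //= n ih v.
rewrite !flatten_flatten -!map_comp; congr flatten; apply: eq_map => k /=.
by rewrite !flatten_shift ih.
Qed.

Lemma flatten_blocks n m v w : flatten (blocks n m v w) = cloud (n + m) v w.
Proof.
rewrite /cloud grow_add; apply: flatten_grow => u /=.
by rewrite cats0.
Qed.

(** [generation] started from an arbitrary individual: this generality lets the recursion on the
    last generation be exchanged for one on the first. *)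
Fixpoint lineage n v w : seq (seq nat) :=
  if n is m.+1
  then [seq k :: u | u <- lineage m v w, k <- iota 0 (offspring u w)]
  else [:: v].

Lemma allpairs_dep_flatten (A B C : Type) (s : seq (seq A)) (t : A -> seq B)
    (f : A -> B -> C) :
  [seq f x y | x <- flatten s, y <- t x] =
  flatten [seq [seq f x y | x <- s', y <- t x] | s' <- s].
Proof. by elim: s => //= x s ih; rewrite allpairs_cat ih. Qed.

Lemma lineageS n v w : lineage n.+1 v w =
  flatten [seq lineage n (k :: v) w | k <- iota 0 (offspring v w)].
Proof.
elim: n v => [|n ih] v.
  by rewrite /= cats0; elim: (iota _ _) => //= k s ->.
rewrite [LHS]/= -/(lineage n.+1 v w) ih allpairs_dep_flatten -map_comp.
by congr flatten; apply: eq_map.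
Qed.

Lemma cloud_lineage n v w :
  [seq position step v w + x | x <- cloud n v w] =
  [seq position step u w | u <- lineage n v w].
Proof.
elim: n v => [|n ih] v; first by rewrite /= addr0.
rewrite lineageS /cloud /= !flatten_flatten !map_flatten -!map_comp.
congr flatten; apply: eq_map => k /=.
rewrite -ih /= flatten_shift -map_comp; apply: eq_map => x /=.
by rewrite addrA.
Qed.

Lemma positions_cloud n w : positions offspring step n w = cloud n [::] w.
Proof.
rewrite /positions; have -> : generation offspring n w = lineage n [::] w.
  by elim: n => //= n ->.
rewrite -cloud_lineage /= -[RHS]map_id; apply: eq_map => x /=; exact: add0r.
Qed.

Lemma population_cloud n w : population offspring n w = size (cloud n [::] w).
Proof. by rewrite -positions_cloud size_map. Qed.

End Grow.

(** * Displacements, subtrees and the recursive law of the cloud *)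

Section Unit_ball.
Variable dim : nat.

Definition neighbours : seq 'rV[int]_dim :=
  0 :: [seq delta_mx 0 i | i <- index_enum 'I_dim] ++
       [seq - delta_mx 0 i | i <- index_enum 'I_dim].

Lemma size_neighbours : size neighbours = (2 * dim + 1)%N.
Proof.
have h : size (index_enum 'I_dim) = dim.
  by rewrite -sum1_size big_const_ord iter_addn_0 mul1n.
have h1 (x : 'rV[int]_dim) : size [:: x] = 1%N by [].
by rewrite /neighbours -cat1s !size_cat !size_map h h1; lia.
Qed.

Lemma delta_mx_inj : injective (fun i : 'I_dim => delta_mx 0 i : 'rV[int]_dim).
Proof.
move=> i j /= /rowP /(_ i); rewrite !mxE !eqxx /=.
by case: eqP.
Qed.

Lemma uniq_neighbours : uniq neighbours.
Proof.
have inj' : injective (fun i : 'I_dim => - delta_mx 0 i : 'rV[int]_dim).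
  by move=> i j /oppr_inj; exact: delta_mx_inj.
rewrite /= mem_cat cat_uniq (map_inj_uniq delta_mx_inj) (map_inj_uniq inj').
rewrite index_enum_uniq /=.
rewrite andbT; apply/andP; split.
  apply/negP => /orP[] /mapP[i _] /rowP /(_ i); rewrite !mxE !eqxx//=.
apply/hasPn => _ /mapP[i _ ->]; apply/negP => /mapP[j _] /rowP /(_ i).
by rewrite !mxE !eqxx /=; case: (i == j).
Qed.

Lemma norm_neighbours e : e \in neighbours -> \sum_(i < dim) `|e ord0 i| <= 1.
Proof.
have h i : \sum_(j < dim) `|(delta_mx 0 i : 'rV[int]_dim) ord0 j| = 1.
  rewrite (bigD1 i)//= big1 ?addr0; first by rewrite mxE !eqxx.
  by move=> j ji; rewrite mxE (negbTE ji) andbF normr0.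
rewrite inE mem_cat => /orP[/eqP ->|/orP[] /mapP[i _ ->]].
- by rewrite big1// => i _; rewrite mxE normr0.
- by rewrite h.
- by under eq_bigr do rewrite mxE normrN; rewrite h.
Qed.

End Unit_ball.

Section Branching.
Context (R : realType) (dim : nat) (Q : probability nat R) (d : measure_display)
  (T : measurableType d) (P : probability T R) (offspring : seq nat -> {RV P >-> nat})
  (step : seq nat -> T -> 'rV[int]_dim).
Hypothesis brw : branching_random_walk Q offspring step.

Definition source (s : seq nat + seq nat) : set (set T) :=
  match s with
  | inl u => preimage_set_system setT (offspring u) setT
  | inr u => preimage_set_system setT (step u) setT
  end.

Definition node (s : seq nat + seq nat) := match s with inl u => u | inr u => u end.

Definition below (v : seq nat) : set (seq nat + seq nat) :=
  [set s | suffix v (node s)].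

(** The sources that determine the subtree of [v] as seen from [v]: the offspring number of [v] is
    in, its own displacement is out. Names list the youngest rank first, so descendants have [v] as
    a suffix. *)
Definition strictly_below (v : seq nat) : set (seq nat + seq nat) :=
  [set s | suffix v (node s) /\ s <> inr v].

Definition below_range v i l : set (seq nat + seq nat) :=
  [set s | exists2 k, k \in iota i l & suffix (k :: v) (node s)].

Lemma source_setT s : source s setT.
Proof. by case: s => u /=; exists setT => //; rewrite setTI preimage_setT. Qed.

Lemma source_setI s : setI_closed (source s).
Proof.
case: s => u _ _ [A _ <-] [B _ <-]; exists (A `&` B) => //;
  by rewrite !setTI preimage_setI.
Qed.

Lemma source_measurable s : source s `<=` measurable.
Proof.
case: s => u _ [A _ <-]; rewrite setTI; last exact: step_measurable brw u A.
by rewrite -[X in measurable X]setTI; exact: measurable_funP.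
Qed.

Lemma source_indep : mutually_independent P source.
Proof. exact: offspring_step_independent brw. Qed.

Lemma adapted_offspring v (J : set (seq nat + seq nat)) :
  J (inl v) -> adapted source J (offspring v).
Proof.
move=> Jv a; apply: (sigma_on_gen source_setT Jv).
by exists [set a] => //; rewrite setTI.
Qed.

Lemma adapted_step v (J : set (seq nat + seq nat)) :
  J (inr v) -> adapted source J (step v).
Proof.
move=> Jv a; apply: (sigma_on_gen source_setT Jv).
by exists [set a] => //; rewrite setTI.
Qed.

Lemma suffix_cons_inj (A : eqType) (k j : A) v u :
  suffix (k :: v) u -> suffix (j :: v) u -> k = j.
Proof.
move=> /suffixP[p ->] /suffixP[q E].
have pq : size p = size q by move/(congr1 size): E; rewrite !size_cat /=; lia.
by move/eqP: E; rewrite eqseq_cat// => /andP[_ /eqP[->]].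
Qed.

Lemma not_suffix_cons (A : eqType) (k : A) v : suffix (k :: v) v = false.
Proof. by apply/negP => /size_suffix /=; rewrite ltnn. Qed.

Lemma below_child v k : below (k :: v) `<=` strictly_below v.
Proof.
move=> s /= h; split.
  by apply: suffix_trans h; exact: suffix_cons.
by move=> E; move: h; rewrite /below /= E /= not_suffix_cons.
Qed.

Section Base.
Variable base : seq nat -> T -> seq (seq 'rV[int]_dim).
Hypothesis base_adapted : forall v, adapted source (strictly_below v) (base v).

Lemma grow_adapted n v :
  adapted source (strictly_below v) (grow offspring step n base v).
Proof.
elim: n v => //= n ih v.
apply: (@adapted_bind _ T _ _ nat _ _ (offspring v) (fun l w => flatten
  [seq shift (step (k :: v) w) (grow offspring step n base (k :: v) w) | k <- iota 0 l])).
  by apply: adapted_offspring; split => //=; exact: suffix_refl.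
move=> l; apply: (adapted_flatten source_setT) => // k _; apply: adapted_comp2 => //.
  by apply: adapted_step; apply: (@below_child v k); exact: suffix_refl.
apply: sub_adapted (ih (k :: v)) => // s [h _].
exact: below_child h.
Qed.

Lemma child_adapted n k v :
  adapted source (below (k :: v)) (child offspring step n base k v).
Proof.
apply: (adapted_comp2 (X := step (k :: v)) (Y := grow offspring step n base (k :: v))).

  by apply: adapted_step; exact: suffix_refl.
by apply: (sub_adapted _ (@grow_adapted n (k :: v))) => s [].
Qed.

Lemma children_adapted n v i l :
  adapted source (below_range v i l) (children offspring step n base v i l).
Proof.
apply: (adapted_flatten source_setT (X := fun k => child offspring step n base k v)) => k ki.
by apply: (sub_adapted _ (@child_adapted n k v)) => s h; exists k.
Qed.

End Base.

Lemma integral_offspring v (h : nat -> \bar R) : (forall l, 0 <= h l)%E ->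
  (\int[P]_w h (offspring v w) = \int[Q]_l h l)%E.
Proof.
move=> h0.
rewrite -(@ge0_integral_distribution _ _ _ _ _ P (offspring v) h)//.
apply: eq_measure_integral => A _ _; exact: offspring_law brw v A.
Qed.

Definition average (h : 'rV[int]_dim -> \bar R) : \bar R :=
  (((2 * dim + 1)%:R^-1 : R)%:E * \sum_(e <- neighbours dim) h e)%E.

Lemma step_bigsetU u : step u @^-1` [set e | e \in neighbours dim] =
  \big[setU/set0]_(e <- neighbours dim) (step u @^-1` [set e]).
Proof.
rewrite -bigcup_seq; apply/seteqP; split => w /=; first by move=> h; exists (step u w).
by move=> [e /= he we]; rewrite we.
Qed.

Lemma step_trivIset u (D : set 'rV[int]_dim) :
  trivIset D (fun e => step u @^-1` [set e]).
Proof. by move=> e f _ _ [w [/= <- <-]]. Qed.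

Lemma step_law_neighbours u e : e \in neighbours dim ->
  P (step u @^-1` [set e]) = ((2 * dim + 1)%:R^-1 : R)%:E.
Proof. by move=> /norm_neighbours; exact: (step_law brw). Qed.

Lemma step_neighbours u : P (step u @^-1` [set e | e \in neighbours dim]) = 1%E.
Proof.
rewrite step_bigsetU -bigcup_seq measure_fin_bigcup; first last.
- by move=> e _; exact: (step_measurable brw).
- exact: step_trivIset.
- exact: finite_seq.
rewrite -fsbig_seq ?uniq_neighbours//.
rewrite (eq_big_seq (fun=> ((2 * dim + 1)%:R^-1 : R)%:E)); last first.
  by move=> e; exact: step_law_neighbours.
rewrite sumEFin big_const_seq count_predT size_neighbours iter_addr_0.
by rewrite -[_ *+ _]mulr_natr mulVf// pnatr_eq0 addn1.
Qed.

(** The masses prescribed for the 2 dim + 1 neighbours already add up to 1, so all other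
    displacements form a null event. *)
Lemma integral_step u (h : 'rV[int]_dim -> \bar R) : (forall e, 0 <= h e)%E ->
  (\int[P]_w h (step u w) = average h)%E.
Proof.
move=> h0.
have mu : forall D, measurable D -> measurable_fun D ((fun w => h (step u w)) : T -> \bar R).
  move=> D; apply: (adapted_emeasurable source_measurable h).
  exact: (@adapted_step u setT).
pose B := step u @^-1` [set e | e \in neighbours dim].
have mB : measurable B by exact: (step_measurable brw).
have PB : P (~` B) = 0%E.
  by rewrite probability_setC//; move: (step_neighbours u); rewrite -/B => ->; rewrite subee.
rewrite -(setUv B) ge0_integral_setU//; first last.
- by apply/disj_setPCl.
- by apply: mu; rewrite setUv.
- exact: measurableC.
rewrite (null_set_integral _ _ PB) ?adde0//; last 2 first.
- exact: measurableC.
- by apply: mu; exact: measurableC.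
rewrite /B step_bigsetU ge0_integral_bigsetU ?uniq_neighbours//; first last.
- by rewrite -step_bigsetU; exact: mu.
- exact: step_trivIset.
- by move=> e; exact: (step_measurable brw).
rewrite /average ge0_sume_distrr//.
apply: eq_big_seq => e he.
rewrite (eq_integral (fun=> h e)); last by move=> w; rewrite inE => /= ->.
rewrite integral_cst; last exact: (step_measurable brw).
by rewrite muleC; congr (_ * _)%E; exact: step_law_neighbours.
Qed.

End Branching.

Section Average.
Context (R : realType) (dim : nat).
Implicit Types h : 'rV[int]_dim -> \bar R.

Lemma average_ge0 h : (forall e, 0 <= h e)%E -> (0 <= average h)%E.
Proof.
move=> h0; rewrite /average mule_ge0 ?lee_fin ?invr_ge0//.
by apply: sume_ge0 => e _.
Qed.

Lemma average_cst (c : \bar R) : (0 <= c)%E -> average (fun _ : 'rV[int]_dim => c) = c.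
Proof.
move=> c0; have h (s : seq 'rV[int]_dim) : (\sum_(e <- s) c = (size s)%:R%:E * c)%E.
  elim: s => [|e s ih]; first by rewrite big_nil mul0e.
  by rewrite big_cons ih /= -natr1 EFinD ge0_muleDl ?lee_fin// mul1e addeC.
by rewrite /average h size_neighbours muleA -EFinM mulVf ?mul1e// pnatr_eq0 addn1.
Qed.

Lemma eq_average h h' : (forall e, h e = h' e) -> average h = average h'.
Proof. by move=> hh; congr average; apply/funext. Qed.

Lemma le_average h h' : (forall e, h e <= h' e)%E -> (average h <= average h')%E.
Proof.
move=> hh; apply: lee_wpmul2l; first by rewrite lee_fin invr_ge0.
by apply: lee_sum.
Qed.

End Average.

Lemma integral_probability_cst (R : realType) d (T : measurableType d)
  (P : probability T R) (c : \bar R) : (\int[P]_w c = c)%E.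
Proof. by rewrite integral_cst// -[RHS]mule1; congr (_ * _)%E; exact: probability_setT. Qed.

Section Law.
Context (R : realType) (dim : nat) (Q : probability nat R).
Local Notation forest := (seq (seq 'rV[int]_dim)).
Implicit Types (L : (forest -> \bar R) -> \bar R) (h : forest -> \bar R).

(** Together with [grow_mean], the expectation as an operator on nonnegative functions of the
    forest, written from [Q] and the base law [L] alone. All nodes, and all realizations of the
    walk, therefore share one law. *)
Fixpoint children_mean L l h : \bar R :=
  if l is l'.+1
  then average (fun e => L (fun s => children_mean L l' (fun t => h (shift e s ++ t))))
  else h [::].

Fixpoint grow_mean L n h : \bar R :=
  if n is m.+1 then (\int[Q]_l children_mean (grow_mean L m) l h)%E else L h.

End Law.

Section Branching.
Context (R : realType) (dim : nat) (Q : probability nat R) (d : measure_display)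
  (T : measurableType d) (P : probability T R) (offspring : seq nat -> {RV P >-> nat})
  (step : seq nat -> T -> 'rV[int]_dim).
Hypothesis brw : branching_random_walk Q offspring step.
Local Notation forest := (seq (seq 'rV[int]_dim)).
Local Notation source := (source offspring step).
Local Notation grow := (grow offspring step).
Local Notation child := (child offspring step).
Local Notation children := (children offspring step).
Implicit Type h : forest -> \bar R.

Section Base.
Variable base : seq nat -> T -> forest.
Hypothesis base_adapted : forall v, adapted source (strictly_below v) (base v).

Lemma grow_measurable n v h (D : set T) : measurable D ->
  measurable_fun D ((fun w => h (grow n base v w)) : T -> \bar R).
Proof.
exact: (adapted_emeasurable (source_measurable brw) h (grow_adapted base_adapted n (v := v))).
Qed.

Lemma child_measurable n k v h (D : set T) : measurable D ->
  measurable_fun D ((fun w => h (child n base k v w)) : T -> \bar R).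
Proof.
exact: (adapted_emeasurable (source_measurable brw) h (@child_adapted _ _ _ _ _ _ _ _ base_adapted n k v)).
Qed.

Lemma children_measurable n v i l h (D : set T) : measurable D ->
  measurable_fun D ((fun w => h (children n base v i l w)) : T -> \bar R).
Proof.
exact: (adapted_emeasurable (source_measurable brw) h (@children_adapted _ _ _ _ _ _ _ _ base_adapted n v i l)).
Qed.

(** Conditioning on the number of children: the source [inl v] lies outside [below_range v 0 l], so
    on the event that [v] has [l] children the subtrees of the first [l] potential children keep
    their unconditional law. *)
Lemma integral_growS n v h : (forall s, 0 <= h s)%E ->
  (\int[P]_w h (grow n.+1 base v w) = \int[Q]_l \int[P]_w h (children n base v 0 l w))%E.
Proof.
move=> h0.
pose H l := (\int[P]_w h (children n base v 0 l w))%E.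
have H0 l : (0 <= H l)%E by apply: integral_ge0.
have aO : adapted source [set inl v] (offspring v) by exact: adapted_offspring.
rewrite -(integral_offspring brw v H0) (integral_adapted P (source_measurable brw) aO)//.
pose E l := offspring v @^-1` [set l].
have mE l : measurable (E l) by exact: (adapted_measurable_set (source_measurable brw) [set l] aO).
have TE : [set: T] = \bigcup_l E l by apply/seteqP; split => w // _; exists (offspring v w).
have tE : trivIset setT E by move=> i j _ _ [w [/= <- <-]].
rewrite [in LHS]TE ge0_integral_bigcup//; last first.
  by apply: grow_measurable; exact: bigcup_measurable.
apply: eq_eseriesr => l _; rewrite setTI [oapp _ _ _]/= muleC.
rewrite -(integral_indep_set (@source_setT _ _ _ _ _ offspring step)
  (@source_setI _ _ _ _ _ offspring step) (source_measurable brw) (source_indep brw)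
  (J := [set inl v]) (K := below_range v 0 l) (X := children n base v 0 l)) => //.
- by apply: eq_integral => w; rewrite inE growS => /= ->.
- apply/seteqP; split => s //= -[-> [k _ /=]].
  by rewrite not_suffix_cons.
- exact: aO.
- exact: children_adapted.
Qed.

Lemma integral_childrenS n v i l h : (forall s, 0 <= h s)%E ->
  (\int[P]_w h (children n base v i l.+1 w) =
   \int[P]_w \int[P]_w' h (child n base i v w ++ children n base v i.+1 l w'))%E.
Proof.
move=> h0.
apply: (integral_indep (@source_setT _ _ _ _ _ offspring step)
  (@source_setI _ _ _ _ _ offspring step) (source_measurable brw) (source_indep brw)
  (J := below (i :: v)) (K := below_range v i.+1 l) (h := fun a b => h (a ++ b))) => //.
- apply/seteqP; split => s //= -[si [k ki sk]].
  have := suffix_cons_inj si sk => ik; move: ki.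
  by rewrite -ik mem_iota ltnn.
- exact: child_adapted.
- exact: children_adapted.
Qed.

Lemma integral_child n k v h : (forall s, 0 <= h s)%E ->
  (\int[P]_w h (child n base k v w) =
   average (fun e => \int[P]_w h (shift e (grow n base (k :: v) w))))%E.
Proof.
move=> h0.
rewrite -(integral_step brw (k :: v)); last by move=> e; exact: integral_ge0.
apply: (integral_indep (@source_setT _ _ _ _ _ offspring step)
  (@source_setI _ _ _ _ _ offspring step) (source_measurable brw) (source_indep brw)
  (J := [set inr (k :: v)]) (K := strictly_below (k :: v))
  (h := fun e s => h (shift e s))) => //.
- by apply/seteqP; split => s //= -[-> []].
- exact: adapted_step.
- exact: grow_adapted.
Qed.

Variable L : (forest -> \bar R) -> \bar R.
Hypothesis base_law : forall v h, (forall s, 0 <= h s)%E ->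
  (\int[P]_w h (base v w) = L h)%E.

Lemma integral_children_mean n v i l h :
  (forall u h', (forall s, 0 <= h' s)%E ->
     (\int[P]_w h' (grow n base u w) = grow_mean Q L n h')%E) ->
  (forall s, 0 <= h s)%E ->
  (\int[P]_w h (children n base v i l w) = children_mean (grow_mean Q L n) l h)%E.
Proof.
move=> ih; elim: l i h => [|l ihl] i h h0.
  rewrite /= (eq_integral (fun=> h [::]))//.
  exact: integral_probability_cst.
rewrite integral_childrenS//=.
under eq_integral do rewrite (ihl i.+1 (fun t => h (child n base i v _ ++ t)))//.
rewrite (integral_child n i v (h := fun s => children_mean (grow_mean Q L n) l
  (fun t => h (s ++ t)))); last first.
  by move=> s; rewrite -(ihl 0)//; exact: integral_ge0.
apply: eq_average => e.
rewrite (ih _ (fun s => children_mean (grow_mean Q L n) l (fun t => h (shift e s ++ t))))//.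
by move=> s; rewrite -(ihl 0)//; exact: integral_ge0.
Qed.

Lemma integral_grow_mean n v h : (forall s, 0 <= h s)%E ->
  (\int[P]_w h (grow n base v w) = grow_mean Q L n h)%E.
Proof.
elim: n v h => [|n ih] v h h0; first exact: base_law.
rewrite integral_growS//=; apply: eq_integral => l _.
exact: integral_children_mean.
Qed.

End Base.

Lemma single_adapted v : adapted source (strictly_below v) (single dim v).
Proof. exact: (adapted_cst (@source_setT _ _ _ _ _ offspring step)). Qed.

Lemma cloud_adapted m v : adapted source (strictly_below v) (cloud offspring step m v).
Proof.
exact: (adapted_comp (@flatten 'rV[int]_dim) (@grow_adapted _ _ _ _ _ _ _ _ single_adapted m v)).
Qed.

Lemma cloud_base_adapted m v :
  adapted source (strictly_below v) (fun w => [:: cloud offspring step m v w]).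
Proof. exact: (adapted_comp (fun s => [:: s]) (@cloud_adapted m v)). Qed.

Lemma integral_cloud_mean m v (h : seq 'rV[int]_dim -> \bar R) : (forall s, 0 <= h s)%E ->
  (\int[P]_w h (cloud offspring step m v w) =
   grow_mean Q (fun h' : forest -> \bar R => h' [:: [:: 0%R : 'rV[int]_dim]]) m (fun s => h (flatten s)))%E.
Proof.
move=> h0.
apply: (@integral_grow_mean (single dim) single_adapted _ _ m v (fun s => h (flatten s))) => // u h' h'0.
by rewrite (eq_integral (fun=> h' [:: [:: 0]]))//; exact: integral_probability_cst.
Qed.

End Branching.

(** * First and second moments *)

Section Block_sums.
Context (R : realType) (dim : nat).
Local Notation forest := (seq (seq 'rV[int]_dim)).
Implicit Types (phi : seq 'rV[int]_dim -> \bar R) (s t : forest)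
  (psi : seq 'rV[int]_dim -> seq 'rV[int]_dim -> \bar R).

Definition block_sum phi s : \bar R := (\sum_(B <- s) phi B)%E.

Definition pair_sum psi s t : \bar R := (\sum_(B <- s) \sum_(C <- t) psi B C)%E.

Definition translate (e : 'rV[int]_dim) (B : seq 'rV[int]_dim) := [seq e + x | x <- B].

Lemma block_sum_ge0 phi s : (forall B, 0 <= phi B)%E -> (0 <= block_sum phi s)%E.
Proof. by move=> h; apply: sume_ge0. Qed.

Lemma pair_sum_ge0 psi s t : (forall B C, 0 <= psi B C)%E -> (0 <= pair_sum psi s t)%E.
Proof. by move=> h; apply: sume_ge0 => B _; apply: sume_ge0. Qed.

Lemma block_sum_flatten phi (I : Type) (r : seq I) (F : I -> forest) :
  block_sum phi (flatten [seq F i | i <- r]) = (\sum_(i <- r) block_sum phi (F i))%E.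
Proof. by rewrite /block_sum big_flatten big_map. Qed.

Lemma block_sum_shift phi e s :
  block_sum phi (shift e s) = block_sum (fun B => phi (translate e B)) s.
Proof. by rewrite /block_sum big_map. Qed.

Lemma pair_sum_flatten psi (I : Type) (r : seq I) (F : I -> forest) :
  pair_sum psi (flatten [seq F i | i <- r]) (flatten [seq F i | i <- r]) =
  (\sum_(i <- r) \sum_(j <- r) pair_sum psi (F i) (F j))%E.
Proof.
rewrite /pair_sum big_flatten big_map; apply: eq_bigr => i _.
rewrite exchange_big big_flatten big_map /=.
by apply: eq_bigr => j _; rewrite exchange_big.
Qed.

Lemma pair_sum_shift psi e f s t :
  pair_sum psi (shift e s) (shift f t) =
  pair_sum (fun B C => psi (translate e B) (translate f C)) s t.
Proof. by rewrite /pair_sum big_map; apply: eq_bigr => B _; rewrite big_map. Qed.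

End Block_sums.

Lemma sume_cst (R : realType) (I : Type) (r : seq I) (c : \bar R) : (0 <= c)%E ->
  (\sum_(i <- r) c = (size r)%:R%:E * c)%E.
Proof.
move=> c0; elim: r => [|i r ih]; first by rewrite big_nil mul0e.
by rewrite big_cons ih /= -natr1 EFinD ge0_muleDl ?lee_fin// mul1e addeC.
Qed.

Section Moments.
Context (R : realType) (dim : nat) (Q : probability nat R) (d : measure_display)
  (T : measurableType d) (P : probability T R) (offspring : seq nat -> {RV P >-> nat})
  (step : seq nat -> T -> 'rV[int]_dim).
Hypothesis brw : branching_random_walk Q offspring step.
Variable sigma2 : R.
Hypothesis Q_mean : (\int[Q]_l (l%:R)%:E = 1)%E.
Hypothesis Q_pairs : (\int[Q]_l ((l * l.-1)%:R)%:E = sigma2%:E)%E.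
Local Notation forest := (seq (seq 'rV[int]_dim)).
Local Notation source := (source offspring step).
Local Notation grow := (grow offspring step).
Local Notation child := (child offspring step).
Local Notation children := (children offspring step).
Implicit Types (phi : seq 'rV[int]_dim -> \bar R)
  (psi : seq 'rV[int]_dim -> seq 'rV[int]_dim -> \bar R).

Variable base : seq nat -> T -> forest.
Hypothesis base_adapted : forall v, adapted source (strictly_below v) (base v).
Variable L : (forest -> \bar R) -> \bar R.
Hypothesis base_law : forall v h, (forall s, 0 <= h s)%E ->
  (\int[P]_w h (base v w) = L h)%E.

Lemma integral_grow_root n v (h : forest -> \bar R) : (forall s, 0 <= h s)%E ->
  (\int[P]_w h (grow n base v w) = \int[P]_w h (grow n base [::] w))%E.
Proof.
by move=> h0; rewrite !(integral_grow_mean brw base_adapted base_law).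
Qed.

Lemma integral_child_root n k v (h : forest -> \bar R) : (forall s, 0 <= h s)%E ->
  (\int[P]_w h (child n base k v w) =
   average (fun e => \int[P]_w h (shift e (grow n base [::] w))))%E.
Proof.
move=> h0; rewrite (integral_child brw base_adapted)//.
by apply: eq_average => e; apply: (integral_grow_root _ _ (h := fun s => h (shift e s))).
Qed.

(** Many-to-one formula: the mean offspring number being 1, the expected sum over blocks evolves as
    if along a single random walk. *)
Lemma integral_block_sum_growS n v phi : (forall B, 0 <= phi B)%E ->
  (\int[P]_w block_sum phi (grow n.+1 base v w) =
   average (fun e => \int[P]_w block_sum (fun B => phi (translate e B)) (grow n base [::] w)))%E.
Proof.
move=> phi0.
rewrite (integral_growS brw base_adapted); last by move=> s; exact: block_sum_ge0.
set A := average _.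
have A0 : (0 <= A)%E.
  by apply: average_ge0 => e; apply: integral_ge0 => w _; apply: block_sum_ge0.
transitivity (\int[Q]_l (l%:R%:E * A))%E.
  apply: eq_integral => l _.
  under eq_integral do rewrite block_sum_flatten.
  rewrite ge0_integral_sum//; last 2 first.
  - by move=> k; exact: (child_measurable brw base_adapted n k v).
  - by move=> k w _; exact: block_sum_ge0.
  rewrite (eq_bigr (fun=> A)); last first.
    move=> k _; rewrite integral_child_root; last by move=> s; exact: block_sum_ge0.
    by apply: eq_average => e; under eq_integral do rewrite block_sum_shift.
  by rewrite sume_cst// size_iota.
rewrite ge0_integralZr// ?Q_mean ?mul1e//.
Qed.

Lemma integral_block_sum n v phi : (forall B, 0 <= phi B)%E ->
  (forall e B, phi (translate e B) = phi B) ->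
  (\int[P]_w block_sum phi (grow n base v w) = \int[P]_w block_sum phi (base [::] w))%E.
Proof.
move=> phi0 inv; elim: n v => [|n ih] v.
  by rewrite !(base_law _ (h := block_sum phi))// => s; exact: block_sum_ge0.
rewrite integral_block_sum_growS//.
rewrite (eq_average (h' := fun=> (\int[P]_w block_sum phi (grow n base [::] w))%E)).
  rewrite average_cst ?ih//.
  by apply: integral_ge0 => w _; apply: block_sum_ge0.
move=> e; apply: eq_integral => w _; apply: eq_bigr => B _; exact: inv.
Qed.

(** The two integration variables stand for two independent forests started at the same place. *)
Definition cross_mean n psi :=
  (\int[P]_w \int[P]_w' pair_sum psi (grow n base [::] w) (grow n base [::] w'))%E.

Lemma cross_mean_ge0 n psi : (forall B C, 0 <= psi B C)%E -> (0 <= cross_mean n psi)%E.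
Proof.
by move=> h; apply: integral_ge0 => w _; apply: integral_ge0 => w' _; exact: pair_sum_ge0.
Qed.

Lemma integral_average (h : 'rV[int]_dim -> T -> \bar R) :
  (forall e, measurable_fun setT (h e)) -> (forall e w, 0 <= h e w)%E ->
  (\int[P]_w average (h^~ w) = average (fun e => \int[P]_w h e w))%E.
Proof.
move=> mh h0; rewrite /average ge0_integralZl ?lee_fin ?invr_ge0//.
- by rewrite ge0_integral_sum.
- by apply: emeasurable_sum => e; exact: mh.
- by move=> w _; apply: sume_ge0.
Qed.

Lemma integral_cross_child n k j v psi : (forall B C, 0 <= psi B C)%E -> k != j ->
  (\int[P]_w pair_sum psi (child n base k v w) (child n base j v w) =
   average (fun e => average (fun f =>
     cross_mean n (fun B C => psi (translate e B) (translate f C)))))%E.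
Proof.
move=> psi0 kj.
rewrite (integral_indep (@source_setT _ _ _ _ _ offspring step)
  (@source_setI _ _ _ _ _ offspring step) (source_measurable brw) (source_indep brw)
  (J := below (k :: v)) (K := below (j :: v)) (X := child n base k v)
  (Y := child n base j v) (h := pair_sum psi)) => //; first last.
- by move=> a b; exact: pair_sum_ge0.
- exact: child_adapted.
- exact: child_adapted.
- apply/seteqP; split => s //= -[sk sj].
  by have := suffix_cons_inj sk sj => /eqP; rewrite (negbTE kj).
rewrite (integral_child_root n k v (h := fun s => \int[P]_w' pair_sum psi s (child n base j v w'))%E); last first.
  by move=> s; apply: integral_ge0 => w _; exact: pair_sum_ge0.
apply: eq_average => e.
rewrite -integral_average; first last.
- by move=> f w; apply: integral_ge0 => w' _; exact: pair_sum_ge0.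
- move=> f; apply: (grow_measurable brw base_adapted n [::] (fun s => \int[P]_w'
    pair_sum (fun B C => psi (translate e B) (translate f C)) s (grow n base [::] w'))%E).
  exact: measurableT.
apply: eq_integral => w _.
rewrite (integral_child_root n j v (h := pair_sum psi _)); last first.
  by move=> s; exact: pair_sum_ge0.
by apply: eq_average => f; under eq_integral do rewrite pair_sum_shift.
Qed.

(* Two distinct children start independent copies, and [Q_pairs] counts the
   ordered pairs of distinct children. *)
Lemma integral_pair_sum_growS n v psi : (forall B C, 0 <= psi B C)%E ->
  (forall e B C, psi (translate e B) (translate e C) = psi B C) ->
  (\int[P]_w pair_sum psi (grow n.+1 base v w) (grow n.+1 base v w) =
   \int[P]_w pair_sum psi (grow n base [::] w) (grow n base [::] w) +
   sigma2%:E * average (fun e => average (fun f =>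
     cross_mean n (fun B C => psi (translate e B) (translate f C)))))%E.
Proof.
move=> psi0 inv.
rewrite (integral_growS brw base_adapted n v (h := fun s => pair_sum psi s s)); last first.
  by move=> s; exact: pair_sum_ge0.
set I := average _.
have I0 : (0 <= I)%E.
  by apply: average_ge0 => e; apply: average_ge0 => f; apply: cross_mean_ge0.
set A := (\int[P]_w pair_sum psi (grow n base [::] w) (grow n base [::] w))%E.
have A0 : (0 <= A)%E by apply: integral_ge0 => w _; exact: pair_sum_ge0.
transitivity (\int[Q]_l (l%:R%:E * A + (l * l.-1)%:R%:E * I))%E; last first.
  rewrite ge0_integralD//; first last.
  - by move=> l _; rewrite mule_ge0// lee_fin.
  - by move=> l _; rewrite mule_ge0// lee_fin.
  rewrite !ge0_integralZr//.
  by rewrite Q_mean mul1e Q_pairs.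
apply: eq_integral => l _.
under eq_integral do rewrite pair_sum_flatten.
have mc k j : measurable_fun setT ((fun w => pair_sum psi (child n base k v w) (child n base j v w)) : T -> \bar R).
  apply: (@adapted_emeasurable _ _ _ _ _ (source_measurable brw) _ setT
    (fun w => (child n base k v w, child n base j v w)) (fun ab => pair_sum psi ab.1 ab.2)) => //.
  by apply: (adapted_comp2 pair); [apply: (sub_adapted _ (@child_adapted _ _ _ _ _ _ _ _ base_adapted n k v))
   | apply: (sub_adapted _ (@child_adapted _ _ _ _ _ _ _ _ base_adapted n j v))].
rewrite ge0_integral_sum//; last 2 first.
- by move=> k; apply: emeasurable_sum => j; exact: mc.
- by move=> k w _; apply: sume_ge0 => j _; exact: pair_sum_ge0.
transitivity (\sum_(k <- iota 0 l) (A + (l.-1)%:R%:E * I))%E; last first.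
  rewrite sume_cst; last by rewrite adde_ge0// mule_ge0// lee_fin.
  rewrite size_iota ge0_muleDr//; last by rewrite mule_ge0// lee_fin.
  by rewrite muleA -EFinM -natrM.
apply: eq_big_seq => k kl.
rewrite ge0_integral_sum//; last first.
  by move=> j w _; exact: pair_sum_ge0.
rewrite (bigD1_seq k)//= ?iota_uniq//; congr (_ + _)%E.
  rewrite (integral_child_root n k v (h := fun s => pair_sum psi s s)); last first.
    by move=> s; exact: pair_sum_ge0.
  rewrite (eq_average (h' := fun=> A)) ?average_cst// => e.
  apply: eq_integral => w _; rewrite pair_sum_shift.
  by apply: eq_bigr => B _; apply: eq_bigr => C _; exact: inv.
rewrite (eq_bigr (fun=> I)); last first.
  by move=> j jk; apply: integral_cross_child => //; rewrite eq_sym.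
rewrite -big_filter sume_cst// size_filter.
have -> : count (fun i => i != k) (iota 0 l) = l.-1; last by [].
have := count_predC (pred1 k) (iota 0 l).
rewrite size_iota count_uniq_mem ?iota_uniq// kl.
rewrite (eq_count (a2 := predC (pred1 k)))//; lia.
Qed.

End Moments.

(** * A superharmonic function and the collision bound *)

Section Superharmonic.
Context (R : realType).

(* With [q ^+ 4 = s' / s] this bounds (s' / s)^(-1/4) by its second-order Taylor
   polynomial, the coefficient 5/32 being raised to 9/50 to absorb the remainder. *)
Lemma quartic_taylor (q : R) : 24 / 25 <= q ->
  1 <= q * (1 - (q ^+ 4 - 1) / 4 + 9 / 50 * (q ^+ 4 - 1) ^+ 2).
Proof.
move=> hq; rewrite -subr_ge0.
set k := 9 * q ^+ 7 + 18 * q ^+ 6 + 27 * q ^+ 5 + 36 * q ^+ 4 + 29 / 2 * q ^+ 3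
  - 7 * q ^+ 2 - 57 / 2 * q - 50.
(* The double root at 1 reflects agreement to first order; what is left is that the cofactor [k]
   stays nonnegative from 24/25 on. *)
have -> : q * (1 - (q ^+ 4 - 1) / 4 + 9 / 50 * (q ^+ 4 - 1) ^+ 2) - 1 =
    (q - 1) ^+ 2 * (k / 50) by rewrite /k; field.
apply: mulr_ge0; first exact: sqr_ge0.
apply: divr_ge0 => //.
have q0 : 0 <= q by lra.
have q2 : 92 / 100 <= q ^+ 2.
  by rewrite expr2; apply: le_trans (ler_pM _ _ hq hq); lra.
have q3 : 88 / 100 <= q ^+ 3.
  by rewrite exprS; apply: le_trans (ler_pM _ _ hq q2); lra.
have q5 : 80 / 100 <= q ^+ 5.
  by rewrite (exprD _ 2 3); apply: le_trans (ler_pM _ _ q2 q3); lra.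
have q6 : 77 / 100 <= q ^+ 6.
  by rewrite (exprD _ 3 3); apply: le_trans (ler_pM _ _ q3 q3); lra.
have q7 : 73 / 100 <= q ^+ 7.
  by rewrite exprS; apply: le_trans (ler_pM _ _ hq q6); lra.
have q41 : 3 <= q * (36 * q ^+ 3 - 57 / 2).
  have h : 318 / 100 <= 36 * q ^+ 3 - 57 / 2 by lra.
  by apply: le_trans (ler_pM _ _ hq h); lra.
have q32 : 6 <= q ^+ 2 * (29 / 2 * q - 7).
  have h : 69 / 10 <= 29 / 2 * q - 7 by lra.
  by apply: le_trans (ler_pM _ _ q2 h); lra.
(* Regrouped so that each negative power is paired with a higher positive one that dominates it. *)
have -> : k = 9 * q ^+ 7 + 18 * q ^+ 6 + 27 * q ^+ 5 + q * (36 * q ^+ 3 - 57 / 2)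
  + q ^+ 2 * (29 / 2 * q - 7) - 50 by rewrite /k; field.
lra.
Qed.

Definition root4 (s : R) := Num.sqrt (Num.sqrt s).

Lemma root4_gt0 s : 0 < s -> 0 < root4 s.
Proof. by move=> s0; rewrite !sqrtr_gt0. Qed.

Lemma root4K s : 0 <= s -> root4 s ^+ 4 = s.
Proof. by move=> s0; rewrite (exprM _ 2 2) !sqr_sqrtr ?sqrtr_ge0. Qed.

(** The bound 88/100 exceeds (24/25)^4, which places the fourth root of s'/s in the range of
    [quartic_taylor]. *)
Lemma inv_root4_taylor (s s' : R) : 0 < s -> 88 / 100 * s <= s' ->
  (root4 s')^-1 <= (root4 s)^-1 * (1 - (s' - s) / s / 4 + 9 / 50 * ((s' - s) / s) ^+ 2).
Proof.
move=> s0 ss'; have s'0 : 0 < s' by rewrite (lt_le_trans _ ss')// mulr_gt0.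
have y0 := root4_gt0 s0; have y'0 := root4_gt0 s'0.
pose q := root4 s' / root4 s.
have q0 : 0 < q by exact: divr_gt0.
have q4 : q ^+ 4 = s' / s by rewrite expr_div_n !root4K// ltW.
have hq : 24 / 25 <= q.
  rewrite leNgt; apply/negP => hq.
  have q2 : q ^+ 2 <= 93 / 100.
    by rewrite expr2; apply: le_trans (ler_pM _ _ (ltW hq) (ltW hq)) _; rewrite ?ltW//; lra.
  have q44 : q ^+ 4 <= 87 / 100.
    rewrite (exprM _ 2 2) expr2; apply: le_trans (ler_pM _ _ q2 q2) _; rewrite ?sqr_ge0//; lra.
  by move: q44; rewrite q4 ler_pdivrMr// => h; lra.
have := quartic_taylor hq.
have -> : q ^+ 4 - 1 = (s' - s) / s by rewrite q4; field; rewrite gt_eqF.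
rewrite mulrC -ler_pdivrMr// mul1r => h.
have -> : (root4 s')^-1 = (root4 s)^-1 * q^-1.
  by rewrite /q; field; rewrite !gt_eqF.
by rewrite ler_pM2l// invr_gt0.
Qed.

Variable dim : nat.
Hypothesis dim_ge3 : (3 <= dim)%N.

Definition sqnorm (x : 'rV[int]_dim) : R := \sum_(i < dim) ((x ord0 i)%:~R) ^+ 2.

(** A smoothed |x|^(-1/2). In the continuum |x|^(-a) is superharmonic for 0 < a < dim - 2, and a =
    1/2 fits every dim >= 3; with this choice the powers are iterated square roots and the estimates
    become polynomial. The shift 500 keeps one lattice step small relative to 500 + |x|^2. *)
Definition green (x : 'rV[int]_dim) : R := (root4 (500 + sqnorm x))^-1.

Lemma sqnorm_ge0 x : 0 <= sqnorm x.
Proof. by apply: sumr_ge0 => i _; exact: sqr_ge0. Qed.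

Lemma green_ge0 x : 0 <= green x.
Proof. by rewrite invr_ge0 sqrtr_ge0. Qed.

Lemma greenN x : green (- x) = green x.
Proof.
rewrite /green; congr (root4 (_ + _))^-1; apply: eq_bigr => i _.
by rewrite mxE intrN sqrrN.
Qed.

Lemma sqnormD_delta x i (b : bool) :
  sqnorm (x + (if b then delta_mx 0 i else - delta_mx 0 i)) =
  sqnorm x + 1 + (if b then 2 else -2) * (x ord0 i)%:~R.
Proof.
rewrite /sqnorm (bigD1 i)//= [in RHS](bigD1 i)//=.
rewrite (eq_bigr (fun j => ((x ord0 j)%:~R : R) ^+ 2)); last first.
  move=> j ji; case: b; rewrite !mxE (negbTE ji) andbF ?oppr0 addr0//.
case: b; rewrite !mxE !eqxx /= ?intrD ?intrN; set y : R := (x ord0 i)%:~R; ring.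
Qed.

(** Opposite neighbours change [s] by 1 + 2y and 1 - 2y: the increments add up to 2 and their
    squares to 2 + 8y^2, so the linear terms cancel in the Taylor bounds. *)
Lemma green_step x i :
  green (x + delta_mx 0 i) + green (x - delta_mx 0 i) <=
  green x * (2 - 1 / (500 + sqnorm x) / 2 +
     9 / 50 * (2 + 8 * ((x ord0 i)%:~R) ^+ 2) / (500 + sqnorm x) ^+ 2).
Proof.
have n0 := sqnorm_ge0 x.
set s := 500 + sqnorm x; set y : R := (x ord0 i)%:~R.
have s0 : 0 < s by rewrite /s; lra.
have yn : y ^+ 2 <= sqnorm x.
  by rewrite /sqnorm (bigD1 i)//= lerDl; apply: sumr_ge0 => j _; exact: sqr_ge0.
(* Since y^2 + 100 >= 20|y|, the shift 500 keeps the relative decrease of [s] below 12 percent. *)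
have h b : 88 / 100 * s <= s + 1 + (if b : bool then 2 else - 2) * y.
  have := sqr_ge0 (y - 10); have := sqr_ge0 (y + 10).
  by rewrite sqrrB sqrrD; case: b; rewrite /s; lra.
have hT := inv_root4_taylor s0 (h true); have hF := inv_root4_taylor s0 (h false).
rewrite /= in hT hF.
have eT : green (x + delta_mx 0 i) = (root4 (s + 1 + 2 * y))^-1.
  by rewrite /green (sqnormD_delta x i true) /s !addrA.
have eF : green (x - delta_mx 0 i) = (root4 (s + 1 + -2 * y))^-1.
  by rewrite /green (sqnormD_delta x i false) /s !addrA.
rewrite eT eF (le_trans (lerD hT hF))//.
rewrite -mulrDr ler_pM2l ?invr_gt0 ?root4_gt0//.
rewrite le_eqVlt; apply/orP; left; apply/eqP; field.
by rewrite gt_eqF.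
Qed.

(** One factor 500 is the margin kept in [green_superharmonic], where the gain is dim / (500 s); the
    other is the value of s at the origin. *)
Definition green_drop : R := dim%:R / (500 * 500) * green 0 / (2 * dim + 1)%:R.

Lemma green_drop_gt0 : 0 < green_drop.
Proof.
have d0 : 0 < dim%:R :> R by rewrite ltr0n; lia.
have n0 : 0 < 500 + sqnorm 0 by have := sqnorm_ge0 0; lra.
have c0 : 0 < 500 * 500 :> R by lra.
have N0 : 0 < (2 * dim + 1)%:R :> R by rewrite addn1 ltr0n.
apply: divr_gt0 N0; apply: mulr_gt0; first exact: divr_gt0 d0 c0.
by rewrite invr_gt0 root4_gt0.
Qed.

Lemma green_superharmonic x :
  (2 * dim + 1)%:R^-1 * (\sum_(e <- neighbours dim) green (x + e)) <=
  green x - green_drop * (x == 0)%:R.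
Proof.
have n0 := sqnorm_ge0 x.
set s := 500 + sqnorm x.
have s0 : 0 < s by rewrite /s; lra.
have d3 : 3 <= dim%:R :> R by rewrite ler_nat.
have g0 : 0 < green x by rewrite invr_gt0 root4_gt0//.
have N0 : 0 < (2 * dim + 1)%:R :> R by rewrite ltr0n; lia.
have NE : (2 * dim + 1)%:R = 2 * dim%:R + 1 :> R by rewrite natrD natrM.
rewrite /neighbours big_cons big_cat /= !big_map addr0 -big_split /=.
have h1 : \sum_(i <- index_enum 'I_dim) (green (x + delta_mx 0 i) + green (x - delta_mx 0 i)) <=
   green x * (2 * dim%:R - dim%:R / s / 2 + 9 / 50 * (2 * dim%:R + 8 * sqnorm x) / s ^+ 2).
  apply: (le_trans (ler_sum _ (fun i _ => green_step x i))).
  rewrite -mulr_sumr ler_pM2l// -/s.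
  rewrite (eq_bigr (fun i => (2 - 1 / s / 2 + 18 / 50 / s ^+ 2) +
      72 / 50 / s ^+ 2 * ((x ord0 i)%:~R) ^+ 2)); last first.
    by move=> i _; field; rewrite gt_eqF.
  rewrite big_split /= sumr_const -mulr_sumr card_ord -/(sqnorm x) -[_ *+ _]mulr_natr.
  rewrite le_eqVlt; apply/orP; left; apply/eqP.
  by field; rewrite gt_eqF.
(* The dimension enters here: the first-order gain is dim/2 |x|^2, the second-order loss 72/50
   |x|^2, and 3/2 > 72/50 even after giving up 1/500 of dim |x|^2 as margin. *)
have h2 : 2 * dim%:R - dim%:R / s / 2 + 9 / 50 * (2 * dim%:R + 8 * sqnorm x) / s ^+ 2 <=
   2 * dim%:R - dim%:R / (500 * s).
  have -> : 2 * dim%:R - dim%:R / s / 2 + 9 / 50 * (2 * dim%:R + 8 * sqnorm x) / s ^+ 2 =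
     2 * dim%:R - (dim%:R * s / 2 - 9 / 50 * (2 * dim%:R + 8 * sqnorm x)) / s ^+ 2.
    by field; rewrite gt_eqF.
  have -> : dim%:R / (500 * s) = (dim%:R * s / 500) / s ^+ 2 :> R.
    by field; rewrite gt_eqF.
  rewrite lerD2l lerN2 ler_pM2r ?invr_gt0 ?exprn_gt0//.
  have dn : 3 * sqnorm x <= dim%:R * sqnorm x by rewrite ler_wpM2r.
  by rewrite /s mulrDr; lra.
have h3 : green_drop * (x == 0)%:R <= green x * (dim%:R / (500 * s)) / (2 * dim + 1)%:R.
  case: eqP => [x0|_]; last first.
    have c0 : 0 <= 500 :> R by lra.
    rewrite mulr0; apply: divr_ge0 (ltW N0); apply: mulr_ge0 (ltW g0) _.
    by apply: divr_ge0 (mulr_ge0 c0 (ltW s0)); exact: ler0n.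
  rewrite mulr1 /green_drop x0 ler_pM2r ?invr_gt0// mulrC -x0.
  have -> : s = 500; last by [].
  by rewrite /s x0 /sqnorm big1 ?addr0// => i _; rewrite mxE expr0n.
rewrite lerBrDr (le_trans (lerD (lexx _) h3))//.
rewrite [_^-1 * _]mulrC -mulrDl ler_pdivrMr// NE.
have := le_trans h1 (ler_wpM2l (ltW g0) h2).
rewrite mulrBr.
move: (green x * (dim%:R / (500 * s))) => a; move: (\sum_(i <- _) _) => b h4.
by rewrite mulrDr mulr1; lra.
Qed.

End Superharmonic.

(** * Pairs of independent forests and product moments *)

Section Cross.
Context (R : realType) (dim : nat) (Q : probability nat R) (d : measure_display)
  (T : measurableType d) (P : probability T R) (offspring : seq nat -> {RV P >-> nat})
  (step : seq nat -> T -> 'rV[int]_dim).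
Hypothesis brw : branching_random_walk Q offspring step.
Variable sigma2 : R.
Hypothesis Q_mean : (\int[Q]_l (l%:R)%:E = 1)%E.
Hypothesis Q_pairs : (\int[Q]_l ((l * l.-1)%:R)%:E = sigma2%:E)%E.
Local Notation forest := (seq (seq 'rV[int]_dim)).
Local Notation source := (source offspring step).
Local Notation grow := (grow offspring step).
Local Notation cross_mean := (cross_mean offspring step).
Implicit Types (phi : seq 'rV[int]_dim -> \bar R)
  (psi : seq 'rV[int]_dim -> seq 'rV[int]_dim -> \bar R).

Section Base.
Variable base : seq nat -> T -> forest.
Hypothesis base_adapted : forall v, adapted source (strictly_below v) (base v).
Variable L : (forest -> \bar R) -> \bar R.
Hypothesis base_law : forall v h, (forall s, 0 <= h s)%E ->
  (\int[P]_w h (base v w) = L h)%E.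

Let mblock n phi : measurable_fun setT ((fun w => block_sum phi (grow n base [::] w)) : T -> \bar R).
Proof. exact: (grow_measurable brw base_adapted n [::] (block_sum phi)). Qed.

Local Ltac cross_mean_side :=
  try solve [exact: mblock | by move=> *; exact: block_sum_ge0
    | by move=> *; apply: block_sum_ge0 => *; apply: integral_ge0 => *; exact: block_sum_ge0
    | by apply: integral_ge0 => *; exact: block_sum_ge0].

Lemma cross_meanE n psi : (forall B C, 0 <= psi B C)%E ->
  (cross_mean base n psi = \int[P]_w block_sum (fun B =>
     \int[P]_w' block_sum (psi B) (grow n base [::] w')) (grow n base [::] w))%E.
Proof.
move=> psi0; apply: eq_integral => w _.
rewrite /pair_sum ge0_integral_sum//; last first.
  by move=> B w' _; exact: block_sum_ge0.
by move=> B; exact: mblock.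
Qed.

Lemma block_sum_average (phi : 'rV[int]_dim -> seq 'rV[int]_dim -> \bar R) s :
  (forall e B, 0 <= phi e B)%E ->
  (block_sum (fun B => average (phi^~ B)) s = average (fun e => block_sum (phi e) s))%E.
Proof.
move=> phi0; rewrite /block_sum /average -ge0_sume_distrr; last first.
  by move=> B _; exact: sume_ge0.
by rewrite exchange_big.
Qed.

(** The many-to-one formula in each of the two independent forests, one after the other. *)
Lemma cross_mean_growS n psi : (forall B C, 0 <= psi B C)%E ->
  (cross_mean base n.+1 psi = average (fun e => average (fun f =>
     cross_mean base n (fun B C => psi (translate e B) (translate f C)))))%E.
Proof.
move=> psi0; rewrite cross_meanE//.
rewrite (integral_block_sum_growS brw Q_mean base_adapted base_law); last first.
  by move=> B; apply: integral_ge0 => w _; exact: block_sum_ge0.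
apply: eq_average => e.
under eq_integral => w _.
  rewrite /block_sum; under eq_bigr => B _.
    rewrite (integral_block_sum_growS brw Q_mean base_adapted base_law)//.
    over.
  rewrite -/(block_sum (fun B => average (fun f => \int[P]_w' block_sum (fun C =>
    psi (translate e B) (translate f C)) (grow n base [::] w'))) (grow n base [::] w))%E.
  rewrite block_sum_average; last first.
    by move=> f B; apply: integral_ge0 => w' _; exact: block_sum_ge0.
  over.
rewrite (@integral_average _ _ _ _ P (fun f w => block_sum (fun B => \int[P]_w' block_sum (fun C =>
    psi (translate e B) (translate f C)) (grow n base [::] w'))%E (grow n base [::] w))).
- by apply: eq_average => f; rewrite cross_meanE.
- by move=> f; exact: mblock.
- move=> f w; apply: block_sum_ge0 => B.
  by apply: integral_ge0 => w' _; exact: block_sum_ge0.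
Qed.

Lemma cross_meanD n psi psi' : (forall B C, 0 <= psi B C)%E -> (forall B C, 0 <= psi' B C)%E ->
  (cross_mean base n (fun B C => psi B C + psi' B C) =
   cross_mean base n psi + cross_mean base n psi')%E.
Proof.
move=> p0 p0'; rewrite !cross_meanE//; last by move=> B C; rewrite adde_ge0.
rewrite -ge0_integralD//; cross_mean_side.
apply: eq_integral => w _; rewrite /block_sum -big_split /=; apply: eq_bigr => B _.
rewrite -ge0_integralD//; cross_mean_side.
by apply: eq_integral => w' _; rewrite -big_split.
Qed.

Lemma cross_meanZ n (c : R) psi : 0 <= c -> (forall B C, 0 <= psi B C)%E ->
  (cross_mean base n (fun B C => c%:E * psi B C) = c%:E * cross_mean base n psi)%E.
Proof.
move=> c0 p0; rewrite !cross_meanE//; last by move=> B C; rewrite mule_ge0.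
rewrite -ge0_integralZl//; cross_mean_side.
apply: eq_integral => w _; rewrite /block_sum ge0_sume_distrr; last first.
  by move=> B _; apply: integral_ge0 => w' _; exact: block_sum_ge0.
apply: eq_bigr => B _.
rewrite -ge0_integralZl//; cross_mean_side.
by apply: eq_integral => w' _; rewrite ge0_sume_distrr.
Qed.

Lemma le_cross_mean n psi psi' : (forall B C, 0 <= psi B C)%E ->
  (forall B C, psi B C <= psi' B C)%E ->
  (cross_mean base n psi <= cross_mean base n psi')%E.
Proof.
move=> p0 pp'; have p0' B C : (0 <= psi' B C)%E by exact: le_trans (pp' B C).
rewrite !cross_meanE//; apply: ge0_le_integral => //; cross_mean_side.
move=> w _; apply: lee_sum => B _; apply: ge0_le_integral => //; cross_mean_side.
by move=> w' _; exact: lee_sum.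
Qed.

Lemma cross_mean_sum n (I : Type) (r : seq I)
    (psi : I -> seq 'rV[int]_dim -> seq 'rV[int]_dim -> \bar R) :
  (forall i B C, 0 <= psi i B C)%E ->
  (cross_mean base n (fun B C => \sum_(i <- r) psi i B C) =
   \sum_(i <- r) cross_mean base n (psi i))%E.
Proof.
move=> p0; elim: r => [|i r ih].
  rewrite big_nil -[RHS](integral0 P setT); apply: eq_integral => w _.
  rewrite -[RHS](integral0 P setT); apply: eq_integral => w' _.
  by rewrite /pair_sum big1// => B _; rewrite big1// => C _; rewrite big_nil.
rewrite big_cons -ih -cross_meanD//; last by move=> B C; exact: sume_ge0.
by congr cross_mean; apply/funext => B; apply/funext => C; rewrite big_cons.
Qed.

Lemma cross_mean_average n (psi : 'rV[int]_dim -> seq 'rV[int]_dim -> seq 'rV[int]_dim -> \bar R) :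
  (forall e B C, 0 <= psi e B C)%E ->
  (cross_mean base n (fun B C => average (fun e => psi e B C)) =
   average (fun e => cross_mean base n (psi e)))%E.
Proof.
move=> p0; rewrite cross_meanZ//; last by move=> B C; exact: sume_ge0.
by rewrite cross_mean_sum.
Qed.

Lemma pair_sum_prod phi phi' s t : (forall B, 0 <= phi B)%E -> (forall B, 0 <= phi' B)%E ->
  pair_sum (fun B C => phi B * phi' C)%E s t = (block_sum phi s * block_sum phi' t)%E.
Proof.
move=> p0 p0'; rewrite /pair_sum /block_sum ge0_sume_distrl//.
by apply: eq_bigr => B _; rewrite ge0_sume_distrr.
Qed.

Lemma cross_mean_prod n phi phi' : (forall B, 0 <= phi B)%E -> (forall B, 0 <= phi' B)%E ->
  (cross_mean base n (fun B C => phi B * phi' C) =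
   (\int[P]_w block_sum phi (grow n base [::] w)) *
   (\int[P]_w block_sum phi' (grow n base [::] w)))%E.
Proof.
move=> p0 p0'; rewrite -ge0_integralZr//; cross_mean_side.
apply: eq_integral => w _; rewrite -ge0_integralZl//; cross_mean_side.
by apply: eq_integral => w' _; exact: pair_sum_prod.
Qed.

(** For translation-invariant functionals the contribution of pairs in different children is the
    same product of means in every generation, whence the linear growth in [n]. *)
Lemma product_moment n phi phi' :
  (forall B, 0 <= phi B)%E -> (forall B, 0 <= phi' B)%E ->
  (forall e B, phi (translate e B) = phi B) ->
  (forall e B, phi' (translate e B) = phi' B) ->
  (\int[P]_w (block_sum phi (grow n base [::] w) * block_sum phi' (grow n base [::] w)) =
   \int[P]_w (block_sum phi (base [::] w) * block_sum phi' (base [::] w)) +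
   (n%:R * sigma2)%:E * ((\int[P]_w block_sum phi (base [::] w)) *
     (\int[P]_w block_sum phi' (base [::] w))))%E.
Proof.
move=> p0 p0' inv inv'.
have s0 : 0 <= sigma2.
  by rewrite -lee_fin -Q_pairs; apply: integral_ge0 => l _; rewrite lee_fin.
set M := (X in (_ + _ * X)%E).
have M0 : (0 <= M)%E.
  by apply: mule_ge0; apply: integral_ge0 => w _; exact: block_sum_ge0.
elim: n => [|n ih].
  by rewrite mul0r mul0e adde0.
under eq_integral do rewrite -pair_sum_prod//.
rewrite (integral_pair_sum_growS brw Q_mean Q_pairs base_adapted base_law n [::]
  (psi := fun B C => phi B * phi' C)%E); first last.
- by move=> e B C; rewrite inv inv'.
- by move=> B C; rewrite mule_ge0.
under eq_integral do rewrite pair_sum_prod//.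
rewrite ih -addeA; congr (_ + _)%E.
have -> : average (fun e => average (fun f => cross_mean base n
    (fun B C => phi (translate e B) * phi' (translate f C))%E)) = M.
  rewrite (eq_average (h' := fun=> M)) ?average_cst// => e.
  rewrite (eq_average (h' := fun=> M)) ?average_cst// => f.
  rewrite (@cross_mean_prod n (fun B => phi (translate e B))
     (fun B => phi' (translate f B)))//.
  congr (_ * _)%E.
    rewrite -(integral_block_sum brw Q_mean base_adapted base_law n [::])//.
    by apply: eq_integral => w _; apply: eq_bigr => B _; rewrite inv.
  rewrite -(integral_block_sum brw Q_mean base_adapted base_law n [::])//.
  by apply: eq_integral => w _; apply: eq_bigr => B _; rewrite inv'.
by rewrite -ge0_muleDl ?lee_fin ?mulr_ge0// -EFinD -natr1 mulrDl mul1r.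
Qed.

End Base.
End Cross.

(** * Collisions and meetings of two independent walks *)

Section Collisions.
Context (R : realType) (dim : nat) (Q : probability nat R) (d : measure_display)
  (T : measurableType d) (P : probability T R) (offspring : seq nat -> {RV P >-> nat})
  (step : seq nat -> T -> 'rV[int]_dim).
Hypothesis brw : branching_random_walk Q offspring step.
Variable sigma2 : R.
Hypothesis dim_ge3 : (3 <= dim)%N.
Hypothesis Q_mean : (\int[Q]_l (l%:R)%:E = 1)%E.
Hypothesis Q_pairs : (\int[Q]_l ((l * l.-1)%:R)%:E = sigma2%:E)%E.
Local Notation forest := (seq (seq 'rV[int]_dim)).
Local Notation source := (source offspring step).
Local Notation grow := (grow offspring step).
Local Notation root_cloud n := (cloud offspring step n [::]).
Local Notation blocks n m := (blocks offspring step n m [::]).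

Lemma sigma2_ge0 : 0 <= sigma2.
Proof. by rewrite -lee_fin -Q_pairs; apply: integral_ge0 => l _; rewrite lee_fin. Qed.

Definition single_law (h : forest -> \bar R) := h [:: [:: 0%R : 'rV[int]_dim]].

Lemma integral_single v h : (forall s, 0 <= h s)%E ->
  (\int[P]_w h (single dim v w) = single_law h)%E.
Proof.
move=> h0; rewrite (eq_integral (fun=> single_law h))//.
exact: integral_probability_cst.
Qed.

Definition cloud_law m (h : forest -> \bar R) :=
  grow_mean Q single_law m (fun s => h [:: flatten s]).

Lemma integral_cloud_law m v (h : forest -> \bar R) : (forall s, 0 <= h s)%E ->
  (\int[P]_w h [:: cloud offspring step m v w] = cloud_law m h)%E.
Proof. by move=> h0; rewrite (integral_cloud_mean brw m v (h := fun s => h [:: s])). Qed.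

Let sad v : adapted source (strictly_below v) (single dim v).
Proof. exact: single_adapted. Qed.

Definition difference_sum (g : 'rV[int]_dim -> R) (B C : seq 'rV[int]_dim) : \bar R :=
  (\sum_(x <- B) \sum_(y <- C) g (x - y))%:E.

Lemma difference_sum_ge0 g B C : (forall z, 0 <= g z) -> (0 <= difference_sum g B C)%E.
Proof. by move=> g0; rewrite lee_fin; apply: sumr_ge0 => x _; apply: sumr_ge0. Qed.

Lemma difference_sum_translate g e f B C :
  difference_sum g (translate e B) (translate f C) =
  difference_sum (fun z => g (z + (e - f))) B C.
Proof.
rewrite /difference_sum big_map; congr EFin; apply: eq_bigr => x _.
rewrite big_map; apply: eq_bigr => y _; congr g.
by rewrite opprD addrACA [LHS]addrC.
Qed.

(** By the many-to-one formula this is the mean of g(S - S') for two independent walks S, S' at time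
    [n]. The walks are never constructed; the recursion over generations is all that is used. *)
Definition difference_mean n g := cross_mean offspring step (single dim) n (difference_sum g).

Lemma difference_mean0 g : difference_mean 0 g = (g 0)%:E.
Proof.
rewrite /difference_mean /cross_mean /=.
rewrite (eq_integral (fun=> (g 0)%:E)) ?integral_probability_cst// => w _.
rewrite (eq_integral (fun=> (g 0)%:E)) ?integral_probability_cst// => w' _.
by rewrite /pair_sum /single !big_seq1 /difference_sum !big_seq1 subr0.
Qed.

Lemma difference_meanS n g : (forall z, 0 <= g z) ->
  difference_mean n.+1 g =
  average (fun e => average (fun f => difference_mean n (fun z => g (z + (e - f))))).
Proof.
move=> g0; rewrite /difference_mean.
have p0 B C : (0 <= difference_sum g B C)%E by exact: difference_sum_ge0.
have := @cross_mean_growS _ _ _ _ _ _ _ _ brw Q_mean _ sad _ integral_single n _ p0.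
move=> ->; apply: eq_average => e; apply: eq_average => f; congr cross_mean.
by apply/funext => B; apply/funext => C; rewrite difference_sum_translate.
Qed.

Lemma le_difference_mean n g g' : (forall z, 0 <= g z) -> (forall z, g z <= g' z) ->
  (difference_mean n g <= difference_mean n g')%E.
Proof.
move=> g0 gg'; apply: (le_cross_mean brw sad) => B C; first exact: difference_sum_ge0.
by rewrite lee_fin; apply: ler_sum => x _; apply: ler_sum.
Qed.

Definition average_real (g : 'rV[int]_dim -> R) : R :=
  (2 * dim + 1)%:R^-1 * \sum_(e <- neighbours dim) g e.

Lemma average_EFin g : average (fun e => (g e)%:E) = (average_real g)%:E.
Proof. by rewrite /average sumEFin. Qed.

Lemma difference_mean_average n (g : 'rV[int]_dim -> 'rV[int]_dim -> R) :
  (forall e z, 0 <= g e z) ->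
  average (fun e => difference_mean n (g e)) =
  difference_mean n (fun z => average_real (g^~ z)).
Proof.
move=> g0; rewrite /difference_mean -(cross_mean_average brw sad)//; last first.
  by move=> e B C; exact: difference_sum_ge0.
congr cross_mean; apply/funext => B; apply/funext => C.
rewrite average_EFin; congr EFin; rewrite /average_real exchange_big mulr_sumr.
apply: eq_bigr => x _; rewrite exchange_big mulr_sumr; exact: eq_bigr.
Qed.

Lemma average_real_green x :
  average_real (fun e => green R (x + e)) <= green R x - green_drop R dim * (x == 0)%:R.
Proof. exact: green_superharmonic. Qed.

Lemma average_real_greenN x : average_real (fun e => green R (x - e)) <= green R x.
Proof.
rewrite /average_real (eq_bigr (fun e => green R (- x + e))); last first.
  by move=> e _; rewrite -greenN opprB addrC.
rewrite (le_trans (average_real_green (- x)))// greenN gerBl mulr_ge0//.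
exact: ltW (green_drop_gt0 R dim_ge3).
Qed.

Definition diagonal (z : 'rV[int]_dim) : R := (z == 0)%:R.

(** The difference of the walks moves by e - f. Averaging over f uses superharmonicity alone;
    averaging over e keeps the drop at the origin, which charges the event that the two walks
    coincide at time [n]. *)
Lemma difference_mean_green n :
  (difference_mean n.+1 (green R (dim := dim)) +
   (green_drop R dim)%:E * difference_mean n diagonal <=
   difference_mean n (green R (dim := dim)))%E.
Proof.
have g0 := @green_ge0 R dim.
have c0 : 0 <= green_drop R dim by exact: ltW (green_drop_gt0 R dim_ge3).
have av0 (g : 'rV[int]_dim -> R) : (forall e, 0 <= g e) -> 0 <= average_real g.
  by move=> h; rewrite mulr_ge0 ?invr_ge0//; apply: sumr_ge0.
have h1 : (difference_mean n.+1 (green R (dim := dim)) <=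
   difference_mean n (fun z => average_real (fun e => green R (z + e))))%E.
  rewrite difference_meanS// -difference_mean_average; last by move=> *; exact: g0.
  apply: le_average => e; rewrite difference_mean_average; last by move=> *; exact: g0.
  apply: le_difference_mean => z; first by apply: av0 => f; exact: g0.
  rewrite (le_trans _ (average_real_greenN (z + e)))//.
  by rewrite /average_real; under eq_bigr do rewrite addrA.
have h2 : (difference_mean n (fun z => average_real (fun e => green R (z + e))) <=
   difference_mean n (fun z => green R z - green_drop R dim * diagonal z)%R)%E.
  apply: le_difference_mean => z; first by apply: av0 => f; exact: g0.
  exact: average_real_green.
apply: le_trans (leeD (le_trans h1 h2) (lexx _)) _.
rewrite le_eqVlt; apply/orP; left; apply/eqP.
rewrite /difference_mean -(cross_meanZ brw sad)//; last first.
  by move=> B C; exact: difference_sum_ge0.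
rewrite -(cross_meanD brw sad); last 2 first.
- move=> B C; apply: difference_sum_ge0 => z.
  by rewrite (le_trans _ (average_real_green z))//; apply: av0 => f; exact: g0.
- by move=> B C; rewrite mule_ge0// difference_sum_ge0.
congr cross_mean; apply/funext => B; apply/funext => C.
rewrite /difference_sum -EFinM -EFinD; congr EFin.
rewrite mulr_sumr -big_split /=; apply: eq_bigr => x _.
by rewrite mulr_sumr -big_split /=; apply: eq_bigr => y _; rewrite subrK.
Qed.

(** The drops telescope: the expected number of meetings of the two walks is at most
    [green 0 / green_drop], which is transience. *)
Lemma sum_difference_mean n :
  ((green_drop R dim)%:E * \sum_(i < n) difference_mean i diagonal +
   difference_mean n (green R (dim := dim)) <= (green R (0 : 'rV[int]_dim))%:E)%E.
Proof.
have c0 : 0 <= green_drop R dim by exact: ltW (green_drop_gt0 R dim_ge3).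
have d0 i : (0 <= difference_mean i diagonal)%E.
  by apply: cross_mean_ge0 => B C; exact: difference_sum_ge0.
elim: n => [|n ih]; first by rewrite big_ord0 mule0 add0e difference_mean0.
rewrite big_ord_recr /= ge0_muleDr//; last by apply: sume_ge0 => i _; exact: d0.
apply: le_trans ih; rewrite -addeA leeD2l// addeC; exact: difference_mean_green.
Qed.

Lemma difference_sum_diagonal B C : difference_sum diagonal B C = ((coll B C)%:R)%:E.
Proof.
rewrite /difference_sum /coll natr_sum; congr EFin; apply: eq_bigr => x _.
by rewrite natr_sum; apply: eq_bigr => y _; rewrite /diagonal subr_eq0.
Qed.

Definition collision_mean n := (\int[P]_w ((coll (root_cloud n w) (root_cloud n w))%:R)%:E)%E.

Lemma collision_mean_ge0 n : (0 <= collision_mean n)%E.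
Proof. by apply: integral_ge0 => w _; rewrite lee_fin. Qed.

Lemma pair_sum_coll (s : forest) :
  pair_sum (fun B C => ((coll B C)%:R)%:E) s s = ((coll (flatten s) (flatten s))%:R)%:E :> \bar R.
Proof.
rewrite /pair_sum /coll big_flatten /= natr_sum -sumEFin; apply: eq_bigr => B _.
rewrite sumEFin; congr EFin; rewrite -natr_sum; congr (_%:R).
by rewrite exchange_big /=; apply: eq_bigr => x _; rewrite big_flatten.
Qed.

Lemma coll_translate (e : 'rV[int]_dim) B C : coll (translate e B) (translate e C) = coll B C.
Proof. by apply: coll_map; exact: addrI. Qed.

(** Splitting at the first generation, pairs within one child reproduce the previous mean, and the
    sigma2 ordered pairs of distinct children contribute the probability that two independent walks
    coincide at time n + 1. *)
Lemma collision_meanS n :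
  (collision_mean n.+1 = collision_mean n + sigma2%:E * difference_mean n.+1 diagonal)%E.
Proof.
have E k : collision_mean k = (\int[P]_w pair_sum (fun B C => ((coll B C)%:R)%:E)
    (grow k (single dim) [::] w) (grow k (single dim) [::] w))%E.
  by apply: eq_integral => w _; rewrite pair_sum_coll.
rewrite !E (integral_pair_sum_growS brw Q_mean Q_pairs sad integral_single); first last.
- by move=> e B C; rewrite coll_translate.
- by move=> B C; rewrite lee_fin.
congr (_ + _ * _)%E; rewrite difference_meanS; last first.
  by move=> z; rewrite /diagonal ler0n.
apply: eq_average => e; apply: eq_average => f; congr cross_mean.
apply/funext => B; apply/funext => C.
by rewrite -difference_sum_translate difference_sum_diagonal.
Qed.

Lemma collision_mean0 : collision_mean 0 = 1%E.
Proof.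
rewrite /collision_mean (eq_integral (fun=> 1%E)) ?integral_probability_cst// => w _.
by rewrite /cloud /= /coll !big_seq1 eqxx.
Qed.

(** The 1 is the collision of the ancestor with itself; the rest is sigma2 times the bound on the
    expected number of meetings. *)
Definition collision_bound : R := 1 + sigma2 * (green R (0 : 'rV[int]_dim) / green_drop R dim).

Lemma collision_mean_bound n : (collision_mean n <= collision_bound%:E)%E.
Proof.
have c0 := green_drop_gt0 R dim_ge3.
have d0 i : (0 <= difference_mean i diagonal)%E.
  by apply: cross_mean_ge0 => B C; exact: difference_sum_ge0.
have E : collision_mean n = (1 + sigma2%:E * \sum_(i < n) difference_mean i.+1 diagonal)%E.
  elim: n => [|n ih]; first by rewrite big_ord0 mule0 adde0 collision_mean0.
  have S0 : (0 <= \sum_(i < n) difference_mean i.+1 diagonal)%E by apply: sume_ge0.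
  by rewrite collision_meanS ih big_ord_recr /= (ge0_muleDr _ S0 (d0 _)) addeA.
rewrite E /collision_bound EFinD EFinM leeD2l// lee_wpmul2l ?lee_fin ?sigma2_ge0//.
have h := sum_difference_mean n.+1.
have S0 : (0 <= \sum_(i < n.+1) difference_mean i diagonal)%E by apply: sume_ge0.
rewrite EFinM lee_pdivlMr//.
rewrite muleC (le_trans _ h)//.
apply: (@le_trans _ _ ((green_drop R dim)%:E * \sum_(i < n.+1) difference_mean i diagonal)%E).
  apply: lee_wpmul2l; first by rewrite lee_fin ltW.
  by rewrite big_ord_recl; exact: leeDr (d0 0%N).
rewrite leeDl// cross_mean_ge0// => B C; apply: difference_sum_ge0; exact: green_ge0.
Qed.

End Collisions.

(** * Site statistics are asymptotically proportional to the population *)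

Section Concentration.
Context (R : realType) (dim : nat) (Q : probability nat R) (d : measure_display)
  (T : measurableType d) (P : probability T R) (offspring : seq nat -> {RV P >-> nat})
  (step : seq nat -> T -> 'rV[int]_dim).
Hypothesis brw : branching_random_walk Q offspring step.
Variable sigma2 : R.
Hypothesis dim_ge3 : (3 <= dim)%N.
Hypothesis Q_mean : (\int[Q]_l (l%:R)%:E = 1)%E.
Hypothesis Q_pairs : (\int[Q]_l ((l * l.-1)%:R)%:E = sigma2%:E)%E.
Local Notation forest := (seq (seq 'rV[int]_dim)).
Local Notation root_cloud n := (cloud offspring step n [::]).
Local Notation blocks n m := (blocks offspring step n m [::]).
Local Notation collision_mean := (collision_mean offspring step).

Let sad v : adapted (source offspring step) (strictly_below v) (single dim v).
Proof. exact: single_adapted. Qed.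

Let cad m v : adapted (source offspring step) (strictly_below v)
  (fun w => [:: cloud offspring step m v w]).
Proof. exact: cloud_base_adapted. Qed.

Let claw m := integral_cloud_law (dim := dim) brw m.

Lemma measurable_blocks n m (h : forest -> \bar R) :
  measurable_fun setT ((fun w => h (blocks n m w)) : T -> \bar R).
Proof. exact: (grow_measurable brw (cad m) n [::] h measurableT). Qed.

Lemma measurable_cloud n (h : seq 'rV[int]_dim -> \bar R) :
  measurable_fun setT ((fun w => h (root_cloud n w)) : T -> \bar R).
Proof. exact: (grow_measurable brw sad n [::] (fun s => h (flatten s)) measurableT). Qed.

Lemma integral_blocks n m (phi : seq 'rV[int]_dim -> \bar R) :
  (forall B, 0 <= phi B)%E -> (forall e B, phi (translate e B) = phi B) ->
  (\int[P]_w block_sum phi (blocks n m w) = \int[P]_w phi (root_cloud m w))%E.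
Proof.
move=> p0 inv; rewrite (integral_block_sum brw Q_mean (cad m) (claw m) n [::] p0 inv).
by apply: eq_integral => w _; rewrite /block_sum big_seq1.
Qed.

Lemma integral_cloud_single n (phi : seq 'rV[int]_dim -> \bar R) :
  (forall B, 0 <= phi B)%E -> (forall e B, phi (translate e B) = phi B) ->
  (forall s, block_sum phi s = phi (flatten s)) ->
  (\int[P]_w phi (root_cloud n w) = phi [:: 0%R])%E.
Proof.
move=> p0 inv add.
transitivity (\int[P]_w block_sum phi (grow offspring step n (single dim) [::] w))%E.
  by apply: eq_integral => w _; rewrite add.
rewrite (integral_block_sum brw Q_mean sad (integral_single (dim := dim) P)
   n [::] p0 inv).
by rewrite (eq_integral (fun=> phi [:: 0%R])) ?integral_probability_cst// => w _;
  rewrite /block_sum big_seq1.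
Qed.

Definition esize (B : seq 'rV[int]_dim) : \bar R := ((size B)%:R)%:E.

Lemma block_sum_esize s : block_sum esize s = esize (flatten s).
Proof.
rewrite /block_sum /esize size_flatten /shape sumnE big_map sumEFin.
by rewrite natr_sum.
Qed.

Lemma esize_ge0 B : (0 <= esize B)%E. Proof. by rewrite lee_fin. Qed.

Lemma esize_translate e B : esize (translate e B) = esize B.
Proof. by rewrite /esize size_map. Qed.

Lemma integral_esize n : (\int[P]_w esize (root_cloud n w) = 1)%E.
Proof.
rewrite (integral_cloud_single n esize_ge0 esize_translate block_sum_esize).
by rewrite /esize.
Qed.

Lemma integral_esize2 n :
  (\int[P]_w (esize (root_cloud n w) * esize (root_cloud n w)) = (1 + n%:R * sigma2)%:E)%E.
Proof.
have h := product_moment brw Q_mean Q_pairs sad (integral_single (dim := dim) P)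
  n esize_ge0 esize_ge0 esize_translate esize_translate.
have e1 w : block_sum esize (single dim [::] w) = 1%E by rewrite /block_sum big_seq1.
transitivity (\int[P]_w (block_sum esize (grow offspring step n (single dim) [::] w) *
   block_sum esize (grow offspring step n (single dim) [::] w)))%E.
  by apply: eq_integral => w _; rewrite block_sum_esize.
rewrite h (eq_integral (fun=> 1%E)) ?integral_probability_cst; last first.
  by move=> w _; rewrite e1 mule1.
rewrite (eq_integral (fun=> 1%E)) ?integral_probability_cst; last first.
  by move=> w _; rewrite e1.
by rewrite mule1 mule1 -EFinD.
Qed.

Section Site_statistics.
Variable p : pred nat.
Hypothesis p0 : ~~ p 0%N.

Definition esites (B : seq 'rV[int]_dim) : \bar R := ((sites p B)%:R)%:E.

Lemma esites_ge0 B : (0 <= esites B)%E. Proof. by rewrite lee_fin. Qed.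

Lemma esites_translate e B : esites (translate e B) = esites B.
Proof. by rewrite /esites sites_map//; exact: addrI. Qed.

Lemma esites_le_esize B : (esites B <= esize B)%E.
Proof. by rewrite lee_fin ler_nat sites_le_size. Qed.

Definition site_mean n : R := fine (\int[P]_w esites (root_cloud n w))%E.

Lemma site_mean_le1 n : (\int[P]_w esites (root_cloud n w) <= 1)%E.
Proof.
rewrite -(integral_esize n); have m1 := @measurable_cloud n esites; have m2 := @measurable_cloud n esize.
apply: ge0_le_integral => //; try by move=> w _; rewrite lee_fin.
by move=> w _; exact: esites_le_esize.
Qed.

Lemma integral_esites n : (\int[P]_w esites (root_cloud n w) = (site_mean n)%:E)%E.
Proof.
rewrite fineK// ge0_fin_numE; first exact: le_lt_trans (site_mean_le1 n) (ltry 1).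
by apply: integral_ge0 => w _; exact: esites_ge0.
Qed.

Lemma site_mean_itv n : 0 <= site_mean n <= 1.
Proof.
rewrite -!lee_fin -integral_esites site_mean_le1 andbT.
by apply: integral_ge0 => w _; exact: esites_ge0.
Qed.

Definition cmean n : R := fine (collision_mean n).

Lemma integral_coll n :
  (\int[P]_w ((coll (root_cloud n w) (root_cloud n w))%:R)%:E = (cmean n)%:E)%E.
Proof.
rewrite fineK// ge0_fin_numE; last exact: collision_mean_ge0.
exact: le_lt_trans (collision_mean_bound brw dim_ge3 Q_mean Q_pairs n) (ltry _).
Qed.

Definition ecoll (B : seq 'rV[int]_dim) : \bar R := ((coll B B)%:R)%:E.

Lemma block_sum_nat (f : seq 'rV[int]_dim -> nat) s :
  block_sum (fun B => ((f B)%:R)%:E) s = ((\sum_(B <- s) f B)%N%:R)%:E :> \bar R.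
Proof. by rewrite /block_sum sumEFin natr_sum. Qed.

Let block_sites n m w : R := (\sum_(B <- blocks n m w) sites p B)%N%:R.
Let block_coll n m w : R := (\sum_(B <- blocks n m w) coll B B)%N%:R.

Lemma integral_block_sites n m : (\int[P]_w (block_sites n m w)%:E = (site_mean m)%:E)%E.
Proof.
rewrite -integral_esites -(integral_blocks n m esites_ge0 esites_translate).
by apply: eq_integral => w _; rewrite block_sum_nat.
Qed.

Lemma integral_block_coll n m : (\int[P]_w (block_coll n m w)%:E = (cmean m)%:E)%E.
Proof.
rewrite -integral_coll -(@integral_blocks n m ecoll).
- by apply: eq_integral => w _; rewrite block_sum_nat.
- by move=> B; rewrite lee_fin.
- by move=> e B; rewrite /ecoll coll_translate.
Qed.

(** The right-hand side is the mean number of colliding pairs from different blocks: collisions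
    inside blocks have mean [cmean m] whatever [n], by the many-to-one formula. *)
Lemma integral_coarsening n m :
  (\int[P]_w (`|(sites p (root_cloud (n + m) w))%:R - block_sites n m w|)%:E <=
   (cmean (n + m) - cmean m)%:E)%E.
Proof.
rewrite EFinB leeBrDr// -(integral_block_coll n m) -(integral_coll (n + m)).
have m1 : measurable_fun setT ((fun w => (block_coll n m w)%:E) : T -> \bar R).
  exact: (@measurable_blocks n m (fun s => ((\sum_(B <- s) coll B B)%N%:R)%:E)).
have m2 : measurable_fun setT ((fun w => (`|(sites p (root_cloud (n + m) w))%:R -
    block_sites n m w|)%:E) : T -> \bar R).
  rewrite (_ : (fun w => _) = (fun w => (`|(sites p (flatten (blocks n m w)))%:R -
    (\sum_(B <- blocks n m w) sites p B)%N%:R|)%:E)).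
    exact: (@measurable_blocks n m (fun s => (`|(sites p (flatten s))%:R -
      (\sum_(B <- s) sites p B)%N%:R|)%:E)).
  by apply/funext => w; rewrite flatten_blocks.
have m3 := @measurable_cloud (n + m) ecoll.
rewrite -ge0_integralD//; last by move=> w _; rewrite lee_fin ler0n.
apply: ge0_le_integral => //.
- by move=> w _; rewrite -EFinD lee_fin addr_ge0 ?ler0n.
- exact: emeasurable_funD.
move=> w _; rewrite -EFinD lee_fin /block_sites /block_coll -flatten_blocks.
have [h1 h2] := sites_flatten (blocks n m w) p0.
rewrite -(ler_nat R) !natrD in h1; rewrite -(ler_nat R) !natrD in h2.
rewrite -lerBrDr ler_norml; lra.
Qed.

Lemma cmean_le n m : cmean m <= cmean (n + m).
Proof.
rewrite -subr_ge0 -lee_fin; apply: le_trans (integral_coarsening n m).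
by apply: integral_ge0 => w _; rewrite lee_fin.
Qed.

Lemma site_mean_cauchy n m : `|site_mean (n + m) - site_mean m| <= cmean (n + m) - cmean m.
Proof.
have m1 : measurable_fun setT ((fun w => (block_sites n m w)%:E) : T -> \bar R).
  exact: (@measurable_blocks n m (fun s => ((\sum_(B <- s) sites p B)%N%:R)%:E)).
have m2 : measurable_fun setT ((fun w => (block_coll n m w)%:E) : T -> \bar R).
  exact: (@measurable_blocks n m (fun s => ((\sum_(B <- s) coll B B)%N%:R)%:E)).
have m3 := @measurable_cloud (n + m) esites.
have m4 := @measurable_cloud (n + m) ecoll.
have key w := sites_flatten (blocks n m w) p0.
have h1 : site_mean (n + m) + cmean m <= site_mean m + cmean (n + m).
  rewrite -lee_fin !EFinD -(integral_esites (n + m)) -(integral_coll (n + m)) -(integral_block_sites n m).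
  rewrite -(integral_block_coll n m) -!ge0_integralD//; try by move=> w _; rewrite lee_fin ler0n.
  apply: ge0_le_integral => //;
    try solve [exact: emeasurable_funD | by move=> w _; rewrite -EFinD lee_fin addr_ge0 ?ler0n].
  move=> w _; rewrite -!EFinD lee_fin /block_sites /block_coll -!natrD ler_nat.
  by rewrite -flatten_blocks; have [] := key w.
have h2 : site_mean m + cmean m <= site_mean (n + m) + cmean (n + m).
  rewrite -lee_fin !EFinD -(integral_esites (n + m)) -(integral_coll (n + m)) -(integral_block_sites n m).
  rewrite -(integral_block_coll n m) -!ge0_integralD//; try by move=> w _; rewrite lee_fin ler0n.
  apply: ge0_le_integral => //;
    try solve [exact: emeasurable_funD | by move=> w _; rewrite -EFinD lee_fin addr_ge0 ?ler0n].
  move=> w _; rewrite -!EFinD lee_fin /block_sites /block_coll -!natrD ler_nat.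
  by rewrite -flatten_blocks; have [] := key w.
by rewrite ler_norml; apply/andP; split; lra.
Qed.

Lemma integral_esites2_fin m :
  (\int[P]_w (esites (root_cloud m w) * esites (root_cloud m w)) <= (1 + m%:R * sigma2)%:E)%E /\
  (\int[P]_w (esites (root_cloud m w) * esize (root_cloud m w)) <= (1 + m%:R * sigma2)%:E)%E.
Proof.
rewrite -integral_esize2.
have m1 := @measurable_cloud m (fun B => esites B * esites B)%E.
have m2 := @measurable_cloud m (fun B => esize B * esize B)%E.
have m3 := @measurable_cloud m (fun B => esites B * esize B)%E.
split; apply: ge0_le_integral => //; try by move=> w _; rewrite mule_ge0 ?esites_ge0 ?esize_ge0.
- by move=> w _; apply: lee_pmul; rewrite ?esites_ge0 ?esize_ge0 ?esites_le_esize.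
- by move=> w _; apply: lee_pmul; rewrite ?esites_ge0 ?esize_ge0 ?esites_le_esize.
Qed.

Let csize n w : R := (size (root_cloud n w))%:R.

(** The block functional [sites - site_mean m * size] is centred, so the term of the product moment
    growing with [n] vanishes and only the variance of one block remains. Product moments being
    stated for nonnegative functionals, the square is expanded and the terms in [n] cancel at the
    end. *)
Lemma block_variance n m :
  (\int[P]_w ((block_sites n m w - site_mean m * csize (n + m) w) ^+ 2)%:E <=
   (2 * (1 + m%:R * sigma2))%:E)%E.
Proof.
have s0 := sigma2_ge0 Q_pairs.
set k := site_mean m; have /andP[k0 k1] := site_mean_itv m; rewrite -/k in k0 k1.
have mb (h : forest -> R) : measurable_fun setT ((fun w => (h (blocks n m w))%:E) : T -> \bar R).
  exact: (@measurable_blocks n m (fun s => (h s)%:E)).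
pose S (s : forest) : R := (\sum_(B <- s) sites p B)%N%:R.
pose Z (s : forest) : R := (size (flatten s))%:R.
have S0 s : 0 <= S s by [].
have Z0 s : 0 <= Z s by [].
have ge1 := esites_ge0; have ge2 := esize_ge0.
have bS s : block_sum esites s = (S s)%:E by rewrite block_sum_nat.
have bZ s : block_sum esize s = (Z s)%:E by rewrite block_sum_esize.
have pm f g := product_moment brw Q_mean Q_pairs (cad m) (claw m) n (phi := f) (phi' := g).
have mS : (\int[P]_w block_sum esites [:: root_cloud m w] = k%:E)%E.
  by rewrite -integral_esites; apply: eq_integral => w _; rewrite /block_sum big_seq1.
have mZ : (\int[P]_w block_sum esize [:: root_cloud m w] = 1)%E.
  by rewrite -(integral_esize m); apply: eq_integral => w _; rewrite /block_sum big_seq1.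
have [a11 a12] := integral_esites2_fin m.
have fin f : (forall w, 0 <= f w)%E -> (\int[P]_w f w <= (1 + m%:R * sigma2)%:E)%E ->
    exists2 r : R, (\int[P]_w f w = r%:E)%E & 0 <= r <= 1 + m%:R * sigma2.
  move=> f0 fl; have i0 : (0 <= \int[P]_w f w)%E by exact: integral_ge0.
  exists (fine (\int[P]_w f w)%E).
    by rewrite fineK// ge0_fin_numE//; exact: le_lt_trans fl (ltry _).
  by rewrite fine_ge0//= -lee_fin fineK// ge0_fin_numE//; exact: le_lt_trans fl (ltry _).
have [r11 e11 /andP[_ l11]] := fin _ (fun w => mule_ge0 (esites_ge0 _) (esites_ge0 _)) a11.
have [r12 e12 /andP[l12 _]] := fin _ (fun w => mule_ge0 (esites_ge0 _) (esize_ge0 _)) a12.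
have i11 : (\int[P]_w (S (blocks n m w) * S (blocks n m w))%:E =
    (r11 + n%:R * sigma2 * (k * k))%:E)%E.
  transitivity (\int[P]_w (block_sum esites (blocks n m w) * block_sum esites (blocks n m w)))%E.
    by apply: eq_integral => w _; rewrite bS.
  rewrite pm//; try exact: esites_translate.
  rewrite mS EFinD !EFinM -e11; congr (_ + _)%E.
  by apply: eq_integral => w _; rewrite /block_sum !big_seq1.
have i12 : (\int[P]_w (S (blocks n m w) * Z (blocks n m w))%:E =
    (r12 + n%:R * sigma2 * (k * 1))%:E)%E.
  transitivity (\int[P]_w (block_sum esites (blocks n m w) * block_sum esize (blocks n m w)))%E.
    by apply: eq_integral => w _; rewrite bS bZ.
  rewrite pm//; try exact: esites_translate; try exact: esize_translate.
  rewrite mS mZ EFinD !EFinM -e12; congr (_ + _)%E.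
  by apply: eq_integral => w _; rewrite /block_sum !big_seq1.
have i22 : (\int[P]_w (Z (blocks n m w) * Z (blocks n m w))%:E =
    (1 + m%:R * sigma2 + n%:R * sigma2 * (1 * 1))%:E)%E.
  transitivity (\int[P]_w (block_sum esize (blocks n m w) * block_sum esize (blocks n m w)))%E.
    by apply: eq_integral => w _; rewrite bZ.
  rewrite pm//; try exact: esize_translate.
  rewrite mZ [in RHS]EFinD -integral_esize2 !mule1 !mulr1; congr (_ + _)%E.
  by apply: eq_integral => w _; rewrite /block_sum !big_seq1.
(* The negative cross term is moved to the left, so that only integrals of nonnegative functions are
   added. *)
have key : (\int[P]_w ((S (blocks n m w) - k * Z (blocks n m w)) ^+ 2)%:E +
    (2 * k)%:E * \int[P]_w (S (blocks n m w) * Z (blocks n m w))%:E =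
    \int[P]_w (S (blocks n m w) * S (blocks n m w))%:E +
    (k ^+ 2)%:E * \int[P]_w (Z (blocks n m w) * Z (blocks n m w))%:E)%E.
  have p1 w : (0 <= (S (blocks n m w) * Z (blocks n m w))%:E)%E by rewrite lee_fin mulr_ge0.
  have p2 w : (0 <= (Z (blocks n m w) * Z (blocks n m w))%:E)%E by rewrite lee_fin mulr_ge0.
  have p3 w : (0 <= (S (blocks n m w) * S (blocks n m w))%:E)%E by rewrite lee_fin mulr_ge0.
  have p4 w : (0 <= ((S (blocks n m w) - k * Z (blocks n m w)) ^+ 2)%:E)%E.
    by rewrite lee_fin sqr_ge0.
  have q1 : 0 <= 2 * k by rewrite mulr_ge0.
  have q2 : 0 <= k ^+ 2 by rewrite sqr_ge0.
  have m1 := mb (fun s => S s * Z s); have m2 := mb (fun s => Z s * Z s).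
  have m3 := mb (fun s => S s * S s); have m4 := mb (fun s => (S s - k * Z s) ^+ 2).
  have m5 := mb (fun s => 2 * k * (S s * Z s)); have m6 := mb (fun s => k ^+ 2 * (Z s * Z s)).
  rewrite -!ge0_integralZl//; try exact: mb.
  under [X in (_ + X)%E = _]eq_integral do rewrite -EFinM.
  under [X in _ = (_ + X)%E]eq_integral do rewrite -EFinM.
  rewrite -!ge0_integralD//;
    try solve [by move=> w _; rewrite lee_fin mulr_ge0// mulr_ge0].
  apply: eq_integral => w _; rewrite -!EFinD; congr EFin; ring.
have E : (\int[P]_w ((block_sites n m w - k * csize (n + m) w) ^+ 2)%:E =
    \int[P]_w ((S (blocks n m w) - k * Z (blocks n m w)) ^+ 2)%:E)%E.
  by apply: eq_integral => w _; rewrite /csize /Z flatten_blocks.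
move: key; rewrite i11 i12 i22 -!EFinM -EFinD => key; rewrite E.
have : (\int[P]_w ((S (blocks n m w) - k * Z (blocks n m w)) ^+ 2)%:E <=
   (r11 + n%:R * sigma2 * (k * k) + k ^+ 2 * (1 + m%:R * sigma2 + n%:R * sigma2 * (1 * 1))
     - 2 * k * (r12 + n%:R * sigma2 * (k * 1)))%:E)%E.
  by rewrite EFinB leeBrDr// key.
move/le_trans; apply; rewrite lee_fin.
have ms : 0 <= m%:R * sigma2 by rewrite mulr_ge0.
have kk : k ^+ 2 <= 1 by rewrite expr_le1.
have h1 : k ^+ 2 * (1 + m%:R * sigma2) <= 1 + m%:R * sigma2 by rewrite ler_piMl// addr_ge0.
have h2 : 0 <= k * r12 by rewrite mulr_ge0.
rewrite (_ : r11 + _ + _ - _ = r11 + k ^+ 2 * (1 + m%:R * sigma2) - 2 * (k * r12)); last by ring.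
lra.
Qed.

Lemma survival_cloud n : survival offspring n = [set w | (0 < size (root_cloud n w))%N].
Proof.
by apply/seteqP; split => w; rewrite /survival /= (population_cloud offspring step).
Qed.

Lemma measurable_survival n : measurable (survival offspring n).
Proof.
rewrite survival_cloud.
have := adapted_measurable_set (source_measurable brw)
  [set s : forest | (0 < size (flatten s))%N] (grow_adapted sad n (v := [::])).
by [].
Qed.

(* AM-GM turns the variance bound into a first-moment bound because the block
   sums vanish off the survival event. *)
Lemma site_deviation n m (lam : R) : 0 < lam ->
  (\int[P]_w (`|(sites p (root_cloud (n + m) w))%:R - site_mean m * csize (n + m) w|)%:E <=
   (cmean (n + m) - cmean m + (2 * (1 + m%:R * sigma2) / lam +
      lam * fine (P (survival offspring (n + m)))) / 2)%:E)%E.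
Proof.
move=> lam0; set N := (n + m)%N; set k := site_mean m; set G := survival offspring N.
have mG : measurable G by exact: measurable_survival.
have PG : P G = (fine (P G))%:E by rewrite fineK// fin_num_measure.
have mb (h : forest -> R) : measurable_fun setT ((fun w => (h (blocks n m w))%:E) : T -> \bar R).
  exact: (@measurable_blocks n m (fun s => (h s)%:E)).
pose S (s : forest) : R := (\sum_(B <- s) sites p B)%N%:R.
pose Z (s : forest) : R := (size (flatten s))%:R.
pose f1 w := `|(sites p (flatten (blocks n m w)))%:R - S (blocks n m w)|.
pose f2 w := (S (blocks n m w) - k * Z (blocks n m w)) ^+ 2.
have E w : (sites p (root_cloud N w))%:R - k * csize N w =
    (sites p (flatten (blocks n m w)))%:R - k * Z (blocks n m w).
  by rewrite /csize /Z flatten_blocks.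
have m1 : measurable_fun setT ((fun w => (f1 w)%:E) : T -> \bar R).
  exact: (mb (fun s => `|(sites p (flatten s))%:R - S s|)).
have m2 : measurable_fun setT ((fun w => ((2 * lam)^-1 * f2 w)%:E) : T -> \bar R).
  exact: (mb (fun s => (2 * lam)^-1 * (S s - k * Z s) ^+ 2)).
have m2' : measurable_fun setT ((fun w => (f2 w)%:E) : T -> \bar R).
  exact: (mb (fun s => (S s - k * Z s) ^+ 2)).
have m3 : measurable_fun setT ((fun w => (lam / 2 * \1_G w)%:E) : T -> \bar R).
  by apply/measurable_EFinP; apply: measurable_funM => //; exact: measurable_indic.
have f10 w : 0 <= f1 w by exact: normr_ge0.
have f20 w : 0 <= f2 w by exact: sqr_ge0.
have c2 : 0 <= (2 * lam)^-1 by rewrite invr_ge0 mulr_ge0// ltW.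
have c3 : 0 <= lam / 2 by rewrite divr_ge0// ltW.
apply: (@le_trans _ _ (\int[P]_w ((f1 w)%:E + ((2 * lam)^-1 * f2 w)%:E + (lam / 2 * \1_G w)%:E))%E).
  have m4 : measurable_fun setT ((fun w => (`|(sites p (root_cloud N w))%:R - k * csize N w|)%:E) : T -> \bar R).
    rewrite (_ : (fun w => _) = (fun w =>
      (`|(sites p (flatten (blocks n m w)))%:R - k * Z (blocks n m w)|)%:E)); last first.
      by apply/funext => w; rewrite E.
    exact: (mb (fun s => `|(sites p (flatten s))%:R - k * Z s|)).
  apply: ge0_le_integral => //;
    try by move=> w _; rewrite -!EFinD lee_fin !addr_ge0// mulr_ge0.
    by apply: emeasurable_funD => //; exact: emeasurable_funD.
  move=> w _; rewrite E -!EFinD lee_fin -addrA.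
  rewrite (_ : _ - k * Z _ = (sites p (flatten (blocks n m w)))%:R - S (blocks n m w) +
    (S (blocks n m w) - k * Z (blocks n m w))); last by ring.
  apply: (le_trans (ler_normD _ _)); rewrite lerD2l.
  set A := S _ - k * Z _.
  have [wG|wG] := boolP (w \in G).
    rewrite indicE wG mulr1 /f2 -/A.
    rewrite -(ler_pM2l (x := 2 * lam)) ?mulr_gt0// mulrDr mulrA divff ?mul1r; last first.
      by rewrite gt_eqF// mulr_gt0.
    have := sqr_ge0 (`|A| - lam); rewrite sqrrB -normrX ger0_norm ?sqr_ge0// => h.
    rewrite (_ : 2 * lam * (lam / 2) = lam ^+ 2); last by field.
    rewrite -mulr_natl in h; nra.
  have -> : A = 0; last by rewrite normr0 addr_ge0// mulr_ge0.
  have z0 : size (flatten (blocks n m w)) = 0%N.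
    apply/eqP; rewrite -leqn0 leqNgt; apply: contra wG => h; apply/mem_set.
    by rewrite /G survival_cloud /= -flatten_blocks.
  have s0 : (\sum_(B <- blocks n m w) sites p B)%N = 0%N.
    apply/eqP; rewrite -leqn0; apply: (@leq_trans (size (flatten (blocks n m w)))).
      2: by rewrite z0.
    rewrite size_flatten sumnE big_map.
    by apply: leq_sum => B _; exact: sites_le_size.
  by rewrite /A /S /Z z0 s0 mulr0 subr0.
rewrite ge0_integralD//; try solve [exact: emeasurable_funD |
  by move=> w _; rewrite -?EFinD lee_fin ?addr_ge0// mulr_ge0].
rewrite ge0_integralD//; try solve [by move=> w _; rewrite lee_fin mulr_ge0 | by move=> w _; rewrite lee_fin].
have h1 : (\int[P]_w (f1 w)%:E <= (cmean N - cmean m)%:E)%E.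
  apply: le_trans (integral_coarsening n m); rewrite le_eqVlt; apply/orP; left; apply/eqP.
  by apply: eq_integral => w _; rewrite /f1 flatten_blocks.
have h2 : (\int[P]_w ((2 * lam)^-1 * f2 w)%:E <= ((2 * lam)^-1 * (2 * (1 + m%:R * sigma2)))%:E)%E.
  under eq_integral do rewrite EFinM.
  have -> : (\int[P]_w (((2 * lam)^-1)%:E * (f2 w)%:E) = ((2 * lam)^-1)%:E * \int[P]_w (f2 w)%:E)%E.
    by apply: ge0_integralZl => // *; rewrite lee_fin.
  rewrite [leRHS]EFinM; apply: lee_wpmul2l; first by rewrite lee_fin.
  apply: le_trans (block_variance n m); rewrite le_eqVlt; apply/orP; left; apply/eqP.
  by apply: eq_integral => w _; rewrite /f2 /csize /Z flatten_blocks.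
have h3 : (\int[P]_w (lam / 2 * \1_G w)%:E = (lam / 2 * fine (P G))%:E)%E.
  under eq_integral do rewrite EFinM.
  have mi : measurable_fun setT ((fun w => (\1_G w)%:E) : T -> \bar R).
    by apply/measurable_EFinP; exact: measurable_indic.
  have -> : (\int[P]_w ((lam / 2)%:E * (\1_G w)%:E) = (lam / 2)%:E * \int[P]_w (\1_G w)%:E)%E.
    by apply: ge0_integralZl => // *; rewrite lee_fin.
  have -> : (\int[P]_w (\1_G w)%:E = (fine (P G))%:E)%E.
    by rewrite integral_indic// setIT; exact: PG.
  by rewrite -EFinM.
rewrite h3; apply: (le_trans (leeD (leeD h1 h2) (lexx _))).
rewrite -!EFinD lee_fin le_eqVlt; apply/orP; left; apply/eqP.
by field; rewrite gt_eqF.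
Qed.

End Site_statistics.

End Concentration.

(** * Survival and the conditional Laplace transform *)

Section Generating_function.
Context (R : realType) (Q : probability nat R) (sigma2 : R).
Hypothesis Q_mean : (\int[Q]_l (l%:R)%:E = 1)%E.
Hypothesis Q_pairs : (\int[Q]_l ((l * l.-1)%:R)%:E = sigma2%:E)%E.
Hypothesis sigma2_gt0 : 0 < sigma2.

(** The divided difference (1 - s^l)/(1 - s); [geo2] is the next one, (l - geo s l)/(1 - s). As
    polynomials they make sense at s = 1, where [geo2] is l(l - 1)/2. *)
Definition geo (s : R) l : R := \sum_(i < l) s ^+ i.
Definition geo2 (s : R) l : R := \sum_(j < l) geo s j.

Lemma geoE s l : s ^+ l + (1 - s) * geo s l = 1.
Proof.
elim: l => [|l ih]; first by rewrite /geo big_ord0 mulr0 addr0 expr0.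
rewrite /geo big_ord_recr /= -/(geo s l) mulrDr -[RHS]ih exprS; ring.
Qed.

Lemma geo2E s l : geo s l + (1 - s) * geo2 s l = l%:R.
Proof.
elim: l => [|l ih]; first by rewrite /geo /geo2 !big_ord0 mulr0 addr0.
rewrite /geo2 big_ord_recr /= -/(geo2 s l) -natr1 -ih.
rewrite {1}/geo big_ord_recr /= -/(geo s l) -[X in _ = _ + X](geoE s l); ring.
Qed.

Lemma geo_ge0 s l : 0 <= s -> 0 <= geo s l.
Proof. by move=> s0; apply: sumr_ge0 => i _; rewrite exprn_ge0. Qed.

Lemma geo2_ge0 s l : 0 <= s -> 0 <= geo2 s l.
Proof. by move=> s0; apply: sumr_ge0 => i _; exact: geo_ge0. Qed.

Lemma le_geo s t l : 0 <= s -> s <= t -> geo s l <= geo t l.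
Proof.
move=> s0 st; apply: ler_sum => i _; apply: lerXn2r; rewrite ?nnegrE//.
exact: le_trans st.
Qed.

Lemma le_geo2 s t l : 0 <= s -> s <= t -> geo2 s l <= geo2 t l.
Proof. by move=> s0 st; apply: ler_sum => i _; exact: le_geo. Qed.

Lemma geo2_1 l : geo2 1 l = (l * l.-1)%:R / 2.
Proof.
have g1 k : geo 1 k = k%:R.
  by rewrite /geo; under eq_bigr do rewrite expr1n; rewrite sumr_const card_ord.
rewrite /geo2; under eq_bigr do rewrite g1.
elim: l => [|l ih]; first by rewrite big_ord0 mul0r.
rewrite big_ord_recr /= ih; case: l {ih} => [|l]; first by rewrite !mul0r add0r.
by rewrite /= !natrM -!natr1; field.
Qed.

(** The cubic constant serves a pointwise limit only; domination by [geo2 1] handles integrability,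
    so two moments of [Q] suffice. *)
Lemma geo2_lip t l : 0 <= t <= 1 -> geo2 1 l - geo2 t l <= (1 - t) * (l ^ 3)%:R.
Proof.
move=> /andP[t0 t1]; have u0 : 0 <= 1 - t by rewrite subr_ge0.
have e1 i : (i < l)%N -> 1 - t ^+ i <= (1 - t) * l%:R.
  move=> il; have -> : 1 - t ^+ i = (1 - t) * geo t i by rewrite -{1}(geoE t i); ring.
  rewrite ler_wpM2l//; apply: (@le_trans _ _ (\sum_(k < i) (1 : R))).
    by apply: ler_sum => k _; rewrite exprn_ile1.
  by rewrite sumr_const card_ord ler_nat ltnW.
have e2 j : (j < l)%N -> geo 1 j - geo t j <= (1 - t) * (l * l)%:R.
  move=> jl; rewrite /geo -sumrB.
  apply: (@le_trans _ _ (\sum_(k < j) (1 - t) * l%:R)).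
    by apply: ler_sum => k _; rewrite expr1n; apply: e1; exact: ltn_trans jl.
  rewrite sumr_const card_ord -[_ *+ _]mulr_natr -mulrA ler_wpM2l// -natrM ler_nat.
  by rewrite leq_mul// ltnW.
rewrite /geo2 -sumrB.
apply: (@le_trans _ _ (\sum_(k < l) (1 - t) * (l * l)%:R)).
  by apply: ler_sum => k _; apply: e2.
rewrite sumr_const card_ord -[_ *+ _]mulr_natr -mulrA ler_wpM2l// -natrM ler_nat.
by rewrite !expnS expn0 muln1 -mulnA.
Qed.

Definition gf s : R := fine (\int[Q]_l (s ^+ l)%:E)%E.
Definition gf1 s : R := fine (\int[Q]_l (geo s l)%:E)%E.
Definition gf2 s : R := fine (\int[Q]_l (geo2 s l)%:E)%E.

Lemma integral_half_pairs : (\int[Q]_l (geo2 1 l)%:E = (sigma2 / 2)%:E)%E.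
Proof.
under eq_integral do rewrite geo2_1 mulrC EFinM.
rewrite ge0_integralZl ?Q_pairs ?lee_fin//.
by rewrite -EFinM mulrC.
Qed.

Lemma integral_fin (h g : nat -> R) (c : R) : (forall l, 0 <= h l <= g l) ->
  (\int[Q]_l (g l)%:E = c%:E)%E ->
  (\int[Q]_l (h l)%:E = (fine (\int[Q]_l (h l)%:E))%:E)%E /\
  0 <= fine (\int[Q]_l (h l)%:E)%E <= c.
Proof.
move=> hg gc.
have h0 : (0 <= \int[Q]_l (h l)%:E)%E.
  by apply: integral_ge0 => l _; rewrite lee_fin; have /andP[] := hg l.
have hc : (\int[Q]_l (h l)%:E <= c%:E)%E.
  rewrite -gc; apply: ge0_le_integral => //.
  - by move=> l _; rewrite lee_fin; have /andP[] := hg l.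
  - by move=> l _; rewrite lee_fin; have /andP[] := hg l.
have f : (\int[Q]_l (h l)%:E)%E \is a fin_num.
  by rewrite ge0_fin_numE//; exact: le_lt_trans hc (ltry _).
by rewrite fineK//; split => //; rewrite -!lee_fin fineK// h0 hc.
Qed.

Let int1 : (\int[Q]_l (1 : R)%:E = 1%:E)%E.
Proof. by rewrite integral_cst// -[RHS]mule1; congr (_ * _)%E; exact: probability_setT. Qed.

Lemma gf_fin s : 0 <= s <= 1 ->
  (\int[Q]_l (s ^+ l)%:E = (gf s)%:E)%E /\ 0 <= gf s <= 1.
Proof.
move=> /andP[s0 s1]; apply: (integral_fin (g := fun=> 1) _ int1) => l.
by rewrite exprn_ge0//= exprn_ile1.
Qed.

Lemma geo_le s l : 0 <= s <= 1 -> 0 <= geo s l <= l%:R.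
Proof.
move=> /andP[s0 s1]; rewrite geo_ge0//= -(geo2E s l) lerDl mulr_ge0 ?geo2_ge0//.
by rewrite subr_ge0.
Qed.

Lemma gf1_fin s : 0 <= s <= 1 ->
  (\int[Q]_l (geo s l)%:E = (gf1 s)%:E)%E /\ 0 <= gf1 s <= 1.
Proof. by move=> s01; apply: (integral_fin _ Q_mean) => l; exact: geo_le. Qed.

Lemma gf2_fin s : 0 <= s <= 1 ->
  (\int[Q]_l (geo2 s l)%:E = (gf2 s)%:E)%E /\ 0 <= gf2 s <= sigma2 / 2.
Proof.
move=> /andP[s0 s1]; apply: (integral_fin _ integral_half_pairs) => l.
by rewrite geo2_ge0//= le_geo2.
Qed.

Lemma gfE s : 0 <= s <= 1 -> gf s + (1 - s) * gf1 s = 1.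
Proof.
move=> s01; have /andP[s0 s1] := s01; have u0 : 0 <= 1 - s by rewrite subr_ge0.
have [e1 _] := gf_fin s01; have [e2 _] := gf1_fin s01.
apply: EFin_inj; rewrite EFinD EFinM -e1 -e2 -ge0_integralZl//; last 1 first.
- by move=> l _; rewrite lee_fin geo_ge0.
rewrite -ge0_integralD//; last 2 first.
- by move=> l _; rewrite lee_fin exprn_ge0.
- by move=> l _; rewrite mule_ge0 ?lee_fin ?geo_ge0.
rewrite -[RHS]int1; apply: eq_integral => l _.
by rewrite -EFinM -EFinD geoE.
Qed.

Lemma gf1E s : 0 <= s <= 1 -> gf1 s + (1 - s) * gf2 s = 1.
Proof.
move=> s01; have /andP[s0 s1] := s01; have u0 : 0 <= 1 - s by rewrite subr_ge0.
have [e1 _] := gf1_fin s01; have [e2 _] := gf2_fin s01.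
apply: EFin_inj; rewrite EFinD EFinM -e1 -e2 -ge0_integralZl//; last 1 first.
- by move=> l _; rewrite lee_fin geo2_ge0.
rewrite -ge0_integralD//; last 2 first.
- by move=> l _; rewrite lee_fin geo_ge0.
- by move=> l _; rewrite mule_ge0 ?lee_fin ?geo2_ge0.
rewrite -[RHS]Q_mean; apply: eq_integral => l _.
by rewrite -EFinM -EFinD geo2E.
Qed.

Lemma le_gf1 s t : 0 <= s -> s <= t -> t <= 1 -> gf1 s <= gf1 t.
Proof.
move=> s0 st t1.
have [|e1 _] := @gf1_fin s; first by rewrite s0 (le_trans st).
have [|e2 _] := @gf1_fin t; first by rewrite (le_trans s0 st).
rewrite -lee_fin -e1 -e2; apply: ge0_le_integral => //.
- by move=> l _; rewrite lee_fin geo_ge0.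
- by move=> l _; rewrite lee_fin le_geo.
Qed.

Lemma le_gf2 s t : 0 <= s -> s <= t -> t <= 1 -> gf2 s <= gf2 t.
Proof.
move=> s0 st t1.
have [|e1 _] := @gf2_fin s; first by rewrite s0 (le_trans st).
have [|e2 _] := @gf2_fin t; first by rewrite (le_trans s0 st).
rewrite -lee_fin -e1 -e2; apply: ge0_le_integral => //.
- by move=> l _; rewrite lee_fin geo2_ge0.
- by move=> l _; rewrite lee_fin le_geo2.
Qed.

(** If the integral of [u] vanished, [u] and then [v] would vanish almost everywhere. Positivity is
    thus read off a known moment, without singling out an atom of [Q]. *)
Lemma integral_gt0 (u v : nat -> R) : (forall l, 0 <= u l) -> (forall l, 0 <= v l) ->
  (forall l, u l = 0 -> v l = 0) -> (0 < \int[Q]_l (v l)%:E)%E ->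
  (0 < \int[Q]_l (u l)%:E)%E.
Proof.
move=> u0 v0 uv v1; rewrite lt0e integral_ge0 ?andbT; last by move=> l _; rewrite lee_fin.
apply/eqP => iu0.
have /ae_eq_integral_abs : (\int[Q]_l `|(u l)%:E| = 0)%E.
  by rewrite -iu0; apply: eq_integral => l _; rewrite gee0_abs// lee_fin.
move=> /(_ measurableT) aeu.
have : (\int[Q]_l (v l)%:E = \int[Q]_l 0)%E.
  apply: ge0_ae_eq_integral => //; first by move=> l _; rewrite lee_fin.
  apply: filterS (aeu _) => // l /= h _; congr EFin; apply: uv.
  by have := h I => -[].
by rewrite integral0 => h; move: v1; rewrite h ltxx.
Qed.

Lemma gf1_0_gt0 : 0 < gf1 0.
Proof.
have [|e _] := @gf1_fin 0; first by rewrite lexx ler01.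
rewrite -lte_fin -e; apply: (@integral_gt0 _ (fun l => l%:R)) => //.
- by move=> l; exact: geo_ge0.
- case=> // l; rewrite /geo big_ord_recl /= expr0 => h.
  have : 0 < 1 + \sum_(i < l) (0 : R) ^+ (bump 0 i).
    by rewrite ltr_wpDr// sumr_ge0// => i _; rewrite exprn_ge0.
  by rewrite h ltxx.
- by rewrite Q_mean.
Qed.

Lemma gf2_0_gt0 : 0 < gf2 0.
Proof.
have [|e _] := @gf2_fin 0; first by rewrite lexx ler01.
rewrite -lte_fin -e; apply: (@integral_gt0 _ (fun l => (l * l.-1)%:R)) => //.
- by move=> l; exact: geo2_ge0.
- case=> [|[|l]] //=; rewrite ?muln0//.
  rewrite /geo2 big_ord_recl big_ord_recl /= /geo big_ord0 add0r big_ord_recl big_ord0.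
  rewrite expr0 addr0 => h.
  have : 0 < 1 + \sum_(i < l) \sum_(i0 < bump 0 (bump 0 i)) (0 : R) ^+ i0.
    rewrite ltr_wpDr// sumr_ge0// => i _; apply: sumr_ge0 => j _; exact: exprn_ge0.
  by rewrite h ltxx.
- by rewrite Q_pairs lte_fin.
Qed.

Lemma gf2_cvg (t : nat -> R) : (forall n, 0 <= t n <= 1) -> t @ \oo --> (1 : R) ->
  (fun n => gf2 (t n)) @ \oo --> sigma2 / 2.
Proof.
move=> t01 t1.
have E : (fun n => \int[Q]_l (geo2 (t n) l)%:E)%E @ \oo --> (\int[Q]_l (geo2 1 l)%:E)%E.
  have := @dominated_convergence _ nat R Q setT measurableT (fun n l => (geo2 (t n) l)%:E)
    (fun l => (geo2 1 l)%:E) (fun l => (geo2 1 l)%:E).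
  case=> //.
  - apply: aeW => l _; apply: cvg_EFin; first by near=> n.
    apply/cvgrPdist_le => e e0.
    have ct : (fun n => (1 - t n) * (l ^ 3)%:R) @ \oo --> (0 : R).
      rewrite -[X in _ --> X](mul0r ((l ^ 3)%:R)) -(subrr (1 : R)).
      by apply: cvgM; [apply: cvgB => //; exact: cvg_cst|exact: cvg_cst].
    move/cvgrPdist_le : ct => /(_ e e0); apply: filterS => n /=.
    have h := geo2_lip l (t01 n); have /andP[tn0 tn1] := t01 n.
    rewrite sub0r normrN ger0_norm; last by rewrite mulr_ge0// subr_ge0.
    by rewrite ger0_norm ?subr_ge0 ?le_geo2//; exact: le_trans.
  - apply/integrableP; split => //.
    under eq_integral do rewrite gee0_abs ?lee_fin ?geo2_ge0//.
    by rewrite integral_half_pairs ltry.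
  - apply: aeW => l n _; have /andP[tn0 tn1] := t01 n.
    by rewrite gee0_abs ?lee_fin ?geo2_ge0 ?le_geo2.
rewrite integral_half_pairs in E; move/fine_cvgP: E => [_].
by apply: cvg_trans.
Unshelve. all: by end_near. Qed.

Lemma gf_lt1 s : 0 <= s < 1 -> 0 <= gf s < 1.
Proof.
move=> /andP[s0 s1]; have s01 : 0 <= s <= 1 by rewrite s0 ltW.
have [_ /andP[-> _]] := gf_fin s01; rewrite /= -(gfE s01) ltrDl mulr_gt0 ?subr_gt0//.
by rewrite (lt_le_trans gf1_0_gt0)// le_gf1// ltW.
Qed.

Lemma iter_gf_lt1 n s : 0 <= s < 1 -> 0 <= iter n gf s < 1.
Proof. by move=> s01; elim: n => //= n; exact: gf_lt1. Qed.

(** From 1 - gf s = (1 - s) gf1 s and 1 - gf1 s = (1 - s) gf2 s. The increments of 1/(1 - s) along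
    the iteration are thus gf2/gf1, which tends to sigma2/2 as the iterates approach 1. *)
Lemma inv_gf s : 0 <= s < 1 -> (1 - gf s)^-1 = (1 - s)^-1 + gf2 s / gf1 s.
Proof.
move=> /andP[s0 s1]; have s01 : 0 <= s <= 1 by rewrite s0 ltW.
have g1 : gf1 s != 0 by rewrite gt_eqF// (lt_le_trans gf1_0_gt0)// le_gf1// ltW.
have u : 1 - s != 0 by rewrite subr_eq0 gt_eqF.
have -> : 1 - gf s = (1 - s) * gf1 s by rewrite -{1}(gfE s01); ring.
have e : (1 - s) * gf2 s = 1 - gf1 s by have := gf1E s01; lra.
have -> : gf2 s = (1 - gf1 s) / (1 - s) by rewrite -e; field.
by field; rewrite u g1.
Qed.

Lemma inv_iter_gf n s : 0 <= s < 1 -> (1 - iter n gf s)^-1 =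
  (1 - s)^-1 + \sum_(i < n) gf2 (iter i gf s) / gf1 (iter i gf s).
Proof.
move=> s01; elim: n => [|n ih]; first by rewrite big_ord0 addr0.
by rewrite big_ord_recr /= addrA -ih inv_gf//; exact: iter_gf_lt1.
Qed.

Lemma gf2_div_ge t s : 0 <= t -> t <= s -> s < 1 -> gf2 t <= gf2 s / gf1 s.
Proof.
move=> t0 ts s1; have s0 := le_trans t0 ts.
have s01 : 0 <= s <= 1 by rewrite s0 ltW.
have g1 : 0 < gf1 s by rewrite (lt_le_trans gf1_0_gt0)// le_gf1// ltW.
have [_ /andP[_ g11]] := gf1_fin s01; have [_ /andP[g2 _]] := gf2_fin s01.
rewrite ler_pdivlMr// (le_trans _ (le_gf2 t0 ts (ltW s1)))//.
by rewrite ler_piMr//; have [|_ /andP[]//] := @gf2_fin t; rewrite t0 (le_trans ts) ?ltW.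
Qed.

(** A lower bound for the i-th iterate valid for every starting point in [0, 1): each increment of
    1/(1 - s) is at least [gf2 0]. Uniformity matters because the starting point will depend on
    n. *)
Definition iter_floor i : R := 1 - (1 + i%:R * gf2 0)^-1.

Lemma iter_floor_itv i : 0 <= iter_floor i <= 1.
Proof.
have b : 1 <= 1 + i%:R * gf2 0 by rewrite lerDl mulr_ge0// ltW// gf2_0_gt0.
by rewrite /iter_floor subr_ge0 gerBl invr_ge0 (le_trans ler01 b) andbT invf_le1// (lt_le_trans ltr01 b).
Qed.

Lemma iter_floor_le i s : 0 <= s < 1 -> iter_floor i <= iter i gf s.
Proof.
move=> s01; have /andP[x0 x1] := iter_gf_lt1 i s01; have /andP[s0 s1] := s01.
have b : 0 < 1 + i%:R * gf2 0 by rewrite ltr_pwDl// mulr_ge0// ltW// gf2_0_gt0.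
rewrite /iter_floor lerBlDr -lerBlDl -[leLHS]invrK lef_pV2 ?posrE ?invr_gt0 ?subr_gt0//.
rewrite inv_iter_gf//; apply: lerD; first by rewrite invf_ge1 ?subr_gt0// gerBl.
apply: (@le_trans _ _ (\sum_(j < i) gf2 0)); first by rewrite sumr_const card_ord mulr_natl.
apply: ler_sum => j _; have /andP[y0 y1] := iter_gf_lt1 j s01; exact: gf2_div_ge.
Qed.

(** The first summand bounds the deviation of the increment from below, through gf2/gf1 >= gf2 at
    the floor; the second bounds it from above, through 1 - gf1 x = (1 - x) gf2 x. *)
Definition increment_error i : R :=
  (sigma2 / 2 - gf2 (iter_floor i)) + sigma2 / 2 * ((1 - iter_floor i) * (sigma2 / 2)) / gf1 0.

Lemma increment_errorP i s : 0 <= s < 1 ->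
  `|gf2 (iter i gf s) / gf1 (iter i gf s) - sigma2 / 2| <= increment_error i.
Proof.
move=> s01; have /andP[x0 x1] := iter_gf_lt1 i s01; set x := iter i gf s in x0 x1 *.
have tx : iter_floor i <= x by exact: iter_floor_le.
have /andP[t0 t1] := iter_floor_itv i.
have x01 : 0 <= x <= 1 by rewrite x0 ltW.
have [_ /andP[b0 bs]] := gf2_fin x01; have [_ /andP[a0 a1]] := gf1_fin x01.
have [|_ /andP[bt0 bts]] := @gf2_fin (iter_floor i); first by rewrite t0.
have a00 := gf1_0_gt0.
have aa : gf1 0 <= gf1 x by rewrite le_gf1// ltW.
have ax : 0 < gf1 x by exact: lt_le_trans aa.
have sg : 0 <= sigma2 / 2 by rewrite divr_ge0// ltW.
have lo := gf2_div_ge t0 tx x1.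
have up : gf2 x / gf1 x - sigma2 / 2 <= sigma2 / 2 * ((1 - iter_floor i) * (sigma2 / 2)) / gf1 0.
  apply: (@le_trans _ _ ((sigma2 / 2) * (1 - gf1 x) / gf1 x)).
    have -> : sigma2 / 2 * (1 - gf1 x) / gf1 x = sigma2 / 2 / gf1 x - sigma2 / 2.
      by field; rewrite gt_eqF.
    by rewrite lerD2r ler_pM2r ?invr_gt0.
  have e : 1 - gf1 x <= (1 - iter_floor i) * (sigma2 / 2).
    have -> : 1 - gf1 x = (1 - x) * gf2 x by have := gf1E x01; lra.
    have h1 : 0 <= 1 - x by lra.
    have h2 : 1 - x <= 1 - iter_floor i by lra.
    exact: ler_pM.
  apply: ler_pM => //.
  - by rewrite mulr_ge0// subr_ge0.
  - by rewrite invr_ge0.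
  - by rewrite ler_wpM2l.
  - by rewrite lef_pV2 ?posrE.
rewrite /increment_error.
have c0 : 0 <= sigma2 / 2 * ((1 - iter_floor i) * (sigma2 / 2)) / gf1 0.
  by rewrite divr_ge0 ?(ltW a00)// mulr_ge0// mulr_ge0// subr_ge0.
move: up c0; set c := sigma2 / 2 * _ / _ => up c0.
by rewrite ler_norml; apply/andP; split; lra.
Qed.

Lemma iter_floor_cvg : iter_floor @ \oo --> (1 : R).
Proof.
have b0 := gf2_0_gt0.
rewrite -[X in _ --> X]subr0; apply: cvgB; first exact: cvg_cst.
apply/cvgrPdist_le => e e0; near=> i.
rewrite sub0r normrN ger0_norm; last first.
  by rewrite invr_ge0 addr_ge0// mulr_ge0// ltW.
rewrite -[leRHS]invrK lef_pV2 ?posrE ?invr_gt0//; last first.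
  by rewrite ltr_pwDl// mulr_ge0// ltW.
rewrite (@le_trans _ _ (i%:R * gf2 0))// ?lerDr// -ler_pdivrMr//.
by near: i; exact: nbhs_infty_ger.
Unshelve. all: by end_near. Qed.

Lemma increment_error_cvg : increment_error @ \oo --> (0 : R).
Proof.
have -> : (0 : R) = (sigma2 / 2 - sigma2 / 2) + sigma2 / 2 * ((1 - 1) * (sigma2 / 2)) / gf1 0.
  by rewrite !subrr mul0r mulr0 mul0r addr0.
apply: cvgD.
  apply: cvgB; [exact: cvg_cst|exact: (gf2_cvg iter_floor_itv iter_floor_cvg)].
apply: cvgM; last exact: cvg_cst.
apply: cvgM; first exact: cvg_cst.
apply: cvgM; last exact: cvg_cst.
by apply: cvgB; [exact: cvg_cst|exact: iter_floor_cvg].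
Qed.

(** Cesaro means of the increment errors, whose independence of the starting point allows [s n] to
    vary with the number of iterations. *)
Lemma inv_iter_gf_cvg (s : nat -> R) : (forall n, 0 <= s n < 1) ->
  (fun n => ((1 - iter n gf (s n))^-1 - (1 - s n)^-1) / n%:R) @ \oo --> sigma2 / 2.
Proof.
move=> s01; have := cesaro increment_error_cvg => ce.
apply/cvgrPdist_le => e e0; move/cvgrPdist_le: ce => /(_ e e0) [N _ hN].
exists N.+1 => // n /= Nn.
have n0 : (0 < n)%N by exact: leq_trans Nn.
(* [arithmetic_mean] at [n.-1] averages the first [n] errors, hence the threshold [N.+1]. *)
have := hN n.-1; rewrite /= sub0r normrN /arithmetic_mean /= prednK// => /(_ _) h.
have {}h : `|n%:R^-1 * series increment_error n| <= e by apply: h; rewrite -ltnS prednK.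
rewrite inv_iter_gf// [_ + _ - _]addrAC subrr add0r.
apply: le_trans h; apply: (le_trans _ (ler_norm _)).
rewrite distrC.
have -> : sigma2 / 2 = (\sum_(i < n) sigma2 / 2) / n%:R.
  by rewrite sumr_const card_ord -[X in _ = X / _]mulr_natr mulfK// pnatr_eq0 -lt0n.
rewrite -mulrBl -sumrB normrM [X in _ * X]ger0_norm ?invr_ge0// mulrC.
rewrite ler_wpM2l ?invr_ge0// (le_trans (ler_norm_sum _ _ _))// /series /= big_mkord.
by apply: ler_sum => i _; exact: increment_errorP.
Qed.

End Generating_function.

(** * Kolmogorov's survival estimate and Yaglom's Laplace transform *)

Section Population.
Context (R : realType) (dim : nat) (Q : probability nat R) (d : measure_display)
  (T : measurableType d) (P : probability T R) (offspring : seq nat -> {RV P >-> nat})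
  (step : seq nat -> T -> 'rV[int]_dim).
Hypothesis brw : branching_random_walk Q offspring step.
Variable sigma2 : R.
Hypothesis Q_mean : (\int[Q]_l (l%:R)%:E = 1)%E.
Hypothesis Q_pairs : (\int[Q]_l ((l * l.-1)%:R)%:E = sigma2%:E)%E.
Hypothesis sigma2_gt0 : 0 < sigma2.
Local Notation forest := (seq (seq 'rV[int]_dim)).
Local Notation cloud n := (cloud offspring step n [::]).
Local Notation gf := (gf Q).

Let sad v : adapted (source offspring step) (strictly_below v) (single dim v).
Proof. exact: single_adapted. Qed.

Let weight (s : R) (F : forest) : \bar R := (s ^+ size (flatten F))%:E.

Lemma integral_children_pow s n v i l : 0 <= s <= 1 ->
  (forall u, \int[P]_w weight s (grow offspring step n (single dim) u w) = (iter n gf s)%:E)%E ->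
  0 <= iter n gf s ->
  (\int[P]_w weight s (children offspring step n (single dim) v i l w) = (iter n gf s ^+ l)%:E)%E.
Proof.
move=> /andP[s0 s1] ih g0.
have w0 F : (0 <= weight s F)%E by rewrite lee_fin exprn_ge0.
elim: l i => [|l ihl] i.
  by rewrite (eq_integral (fun=> 1%E)) ?integral_probability_cst ?expr0.
rewrite (integral_childrenS brw sad)//.
have wM F F' : weight s (F ++ F') = (weight s F * weight s F')%E.
  by rewrite /weight flatten_cat size_cat exprD EFinM.
under eq_integral => w _.
  under eq_integral do rewrite wM.
  rewrite ge0_integralZl//; last exact: (children_measurable brw sad).
  rewrite ihl.
  over.
rewrite ge0_integralZr//; last 2 first.
- exact: (child_measurable brw sad n i v (weight s)).
- by rewrite lee_fin exprn_ge0.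
rewrite (integral_child brw sad)//.
rewrite (eq_average (h' := fun=> (iter n gf s)%:E)) ?average_cst ?exprS ?EFinM//.
move=> e; rewrite -(ih (i :: v)); apply: eq_integral => w _.
by rewrite /weight flatten_shift size_map.
Qed.

Lemma integral_pow_grow s n v : 0 <= s <= 1 ->
  (\int[P]_w weight s (grow offspring step n (single dim) v w) = (iter n gf s)%:E)%E /\
  0 <= iter n gf s <= 1.
Proof.
move=> s01; have /andP[s0 s1] := s01.
elim: n v => [|n ih] v.
  by split => //=; rewrite (eq_integral (fun=> s%:E)) ?integral_probability_cst.
have [_ g01] := ih [::]; have [e1 e2] := gf_fin Q g01; split => //=.
rewrite (integral_growS brw sad)//; last by move=> F; rewrite lee_fin exprn_ge0.
under eq_integral => l _.
  rewrite integral_children_pow//; last 2 first.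
  - by move=> u; have [] := ih u.
  - by have /andP[] := g01.
  over.
exact: e1.
Qed.

Lemma integral_pow_cloud s n : 0 <= s <= 1 ->
  (\int[P]_w (s ^+ size (cloud n w))%:E = (iter n gf s)%:E)%E.
Proof. by move=> s01; have [] := integral_pow_grow n [::] s01. Qed.

Lemma measurable_size_fun n (h : nat -> \bar R) (D : set T) : measurable D ->
  measurable_fun D ((fun w => h (size (cloud n w))) : T -> \bar R).
Proof. exact: (grow_measurable brw sad n [::] (fun F => h (size (flatten F)))). Qed.

Let mG n : measurable (survival offspring n).
Proof. exact: (measurable_survival brw). Qed.

(** At s = 0 the weight [s ^+ size] is the indicator of extinction, since [0 ^+ 0] is 1. *)
Lemma probability_survival n : P (survival offspring n) = (1 - iter n gf 0)%:E.
Proof.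
have z01 : 0 <= (0 : R) <= 1 by rewrite lexx ler01.
have e := integral_pow_cloud n z01.
have h : P (~` survival offspring n) = (iter n gf 0)%:E.
  rewrite -e -(setIT (~` _)) -integral_indic//; last exact: measurableC.
  apply: eq_integral => w _; congr EFin; rewrite indicE expr0n; congr (_%:R).
  rewrite (survival_cloud offspring step); case: (boolP (size (cloud n w) == 0)%N) => h.
    by rewrite mem_set//= (eqP h).
  by rewrite memNset//= => h'; apply: h'; rewrite lt0n.
rewrite -(setCK (survival offspring n)) probability_setC ?h//.
exact: measurableC.
Qed.

Lemma survival_gt0 n : 0 < fine (P (survival offspring n)).
Proof.
rewrite probability_survival /= subr_gt0.
by have /andP[] := iter_gf_lt1 Q_mean n (s := 0) ltac:(by rewrite lexx ltr01).
Qed.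

Lemma integral_pow_survival s n : 0 <= s <= 1 ->
  (\int[P]_(w in survival offspring n) (s ^+ size (cloud n w))%:E =
   (iter n gf s - iter n gf 0)%:E)%E.
Proof.
move=> s01; have /andP[s0 s1] := s01.
have e := integral_pow_cloud n s01.
have mf D := @measurable_size_fun n (fun k => (s ^+ k)%:E) D.
rewrite -(setUv (survival offspring n)) ge0_integral_setU// in e; last 4 first.
- exact: measurableC.
- by apply: mf; rewrite setUv.
- by move=> w _; rewrite lee_fin exprn_ge0.
- by apply/disj_setPCl.
have e2 : (\int[P]_(w in ~` survival offspring n) (s ^+ size (cloud n w))%:E = (iter n gf 0)%:E)%E.
  rewrite (eq_integral (fun=> 1%E)).
    rewrite integral_cst ?mul1e; last exact: measurableC.
    by rewrite [LHS]probability_setC// probability_survival -EFinB; congr EFin; ring.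
  move=> w; rewrite inE (survival_cloud offspring step) /= => /negP.
  by rewrite -leqNgt leqn0 => /eqP ->; rewrite expr0.
by rewrite EFinB -e e2 addeK.
Qed.

Lemma cvg_natV : (fun n : nat => (n%:R : R)^-1) @ \oo --> (0 : R).
Proof. rewrite -cvg_shiftS; exact: cvg_harmonic. Qed.

(** One statement for two uses: s = 0 with l = 0 gives the survival probability, and s = exp(-k/n)
    with l = 1/k gives the Laplace transform. *)
Lemma survival_rate_aux (s : nat -> R) (l : R) : (forall n, 0 <= s n < 1) ->
  (fun n => (1 - s n)^-1 / n%:R) @ \oo --> l -> 0 <= l ->
  (fun n => n%:R * (1 - iter n gf (s n))) @ \oo --> (l + sigma2 / 2)^-1.
Proof.
move=> s01 sl l0.
have h := inv_iter_gf_cvg Q_mean Q_pairs sigma2_gt0 s01.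
have {}h : (fun n => (1 - iter n gf (s n))^-1 / n%:R) @ \oo --> l + sigma2 / 2.
  rewrite (_ : (fun n => _) = (fun n => (1 - s n)^-1 / n%:R +
     ((1 - iter n gf (s n))^-1 - (1 - s n)^-1) / n%:R)); first exact: cvgD.
  by apply/funext => n; rewrite -mulrDl; congr (_ / _); ring.
rewrite (_ : (fun n => _) = (fun n => ((1 - iter n gf (s n))^-1 / n%:R)^-1)).
  by apply: cvgV => //; rewrite gt_eqF// ltr_wpDl// divr_gt0.
by apply/funext => n; rewrite invf_div invrK.
Qed.

Lemma survival_rate :
  (fun n => n%:R * fine (P (survival offspring n))) @ \oo --> 2 / sigma2.
Proof.
have h := @survival_rate_aux (fun=> 0) 0 _ _ (lexx 0).
rewrite -[X in _ --> X]invf_div -(add0r (sigma2 / 2)).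
rewrite (_ : (fun n => _) = (fun n => n%:R * (1 - iter n gf 0))); last first.
  by apply/funext => n; rewrite probability_survival.
apply: h; first by move=> n; rewrite lexx ltr01.
rewrite (_ : (fun n => _) = (fun n : nat => n%:R^-1)).
  exact: cvg_natV.
by apply/funext => n; rewrite subr0 invr1 mul1r.
Qed.

(** Squeezed by x/(1 + x) <= 1 - exp(-x) <= x with x = k/n. *)
Lemma inv_one_sub_exp_cvg (k : nat) : (0 < k)%N ->
  (fun n : nat => (1 - expR (- (k%:R / n%:R)))^-1 / n%:R) @ \oo --> (k%:R^-1 : R).
Proof.
move=> k0; have kR : 0 < k%:R :> R by rewrite ltr0n.
apply: (@squeeze_cvgr _ _ _ _ (fun=> k%:R^-1) (fun n : nat => k%:R^-1 + n%:R^-1)); last 2 first.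
- exact: cvg_cst.
- rewrite -[X in _ --> X]addr0; apply: cvgD; [exact: cvg_cst|exact: cvg_natV].
near=> n; have n0 : 0 < n%:R :> R by rewrite ltr0n; near: n; exact: nbhs_infty_gt.
set x : R := k%:R / n%:R; have x0 : 0 < x by rewrite divr_gt0.
have e1 : 1 - expR (- x) <= x by rewrite lerBlDr -lerBlDl expR_ge1Dx.
have e2 : x / (1 + x) <= 1 - expR (- x).
  have -> : x / (1 + x) = 1 - (1 + x)^-1 by field; rewrite gt_eqF// addr_gt0.
  rewrite lerD2l lerN2 expRN lef_pV2 ?posrE ?expR_gt0 ?addr_gt0//.
  exact: expR_ge1Dx.
have p0 : 0 < x / (1 + x) by rewrite divr_gt0// addr_gt0.
have p1 : 0 < 1 - expR (- x) by exact: lt_le_trans e2.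
apply/andP; split.
  rewrite ler_pdivlMr// mulrC -[leLHS]invrK lef_pV2 ?posrE ?invr_gt0 ?divr_gt0//.
  by rewrite (le_trans e1)// /x invf_div.
rewrite ler_pdivrMr//.
have -> : (k%:R^-1 + n%:R^-1) * n%:R = (x / (1 + x))^-1.
  by rewrite /x; field; rewrite ?gt_eqF// addr_gt0.
by rewrite lef_pV2 ?posrE.
Unshelve. all: by end_near. Qed.

(** The conditional Laplace transform of Z_n/n at the integer [k]; integers suffice for polynomials
    in exp(-z). *)
Definition laplace_given n (k : nat) : R :=
  fine (\int[P]_(w in survival offspring n) (expR (- (k%:R / n%:R)) ^+ size (cloud n w))%:E)%E /
  fine (P (survival offspring n)).

Lemma laplace_given_cvg k :
  laplace_given ^~ k @ \oo --> ((1 + k%:R * (sigma2 / 2))^-1 : R).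
Proof.
have exp01 (x : R) : 0 <= x -> 0 <= expR (- x) <= 1.
  by move=> x0; rewrite expR_ge0 -expR0 ler_expR oppr_le0.
have x0 n : 0 <= k%:R / n%:R :> R by rewrite divr_ge0.
have E n : laplace_given n k =
    (iter n gf (expR (- (k%:R / n%:R))) - iter n gf 0) / (1 - iter n gf 0).
  by rewrite /laplace_given integral_pow_survival ?exp01// probability_survival.
have u0 n : 1 - iter n gf 0 != 0.
  by have := survival_gt0 n; rewrite probability_survival /= => /gt_eqF ->.
have [->|k0] := posnP k.
  rewrite mul0r addr0 invr1 (_ : laplace_given ^~ 0%N = fun=> 1); first exact: cvg_cst.
  apply/funext => n; rewrite /laplace_given mul0r oppr0 expR0.
  rewrite integral_pow_survival ?ler01 ?lexx// probability_survival /=.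
  have -> : iter n gf 1 = 1; last by rewrite divff.
  have := integral_pow_cloud n (s := 1); rewrite ler01 lexx => /(_ isT).
  under eq_integral do rewrite expr1n.
  by rewrite integral_probability_cst => -[].
(* At n = 0 the quotient [k%:R / n%:R] is 0 and the exponential would be 1, outside the interval [0,
   1) required of starting points. *)
pose s n : R := if n == 0%N then 0 else expR (- (k%:R / n%:R)).
have s01 n : 0 <= s n < 1.
  rewrite /s; case: eqP => [_|/eqP n0]; first by rewrite lexx ltr01.
  have nR : 0 < n%:R :> R by rewrite ltr0n lt0n.
  rewrite expR_ge0 /= -[X in _ < X]expR0 ltr_expR oppr_lt0.
  by apply: divr_gt0 => //; rewrite ltr0n.
have c1 : (fun n => (1 - s n)^-1 / n%:R) @ \oo --> (k%:R^-1 : R).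
  have := inv_one_sub_exp_cvg k0; apply: cvg_trans; apply: near_eq_cvg; near=> n.
  by rewrite /s ifF//; apply/negbTE; rewrite -lt0n; near: n; exact: nbhs_infty_gt.
have c2 := survival_rate_aux s01 c1 ltac:(by rewrite invr_ge0).
have c3 := survival_rate.
(* The conditional transform is 1 - (1 - f_n(s))/(1 - f_n(0)), f_n being the n-th iterate of [gf];
   both parts are multiplied by n to apply the two rates. *)
have c4 : (fun n => 1 - (n%:R * (1 - iter n gf (s n))) / (n%:R * fine (P (survival offspring n))))
    @ \oo --> (1 + k%:R * (sigma2 / 2))^-1.
  have kR : k%:R != 0 :> R by rewrite pnatr_eq0 -lt0n.
  have -> : (1 + k%:R * (sigma2 / 2))^-1 = 1 - (k%:R^-1 + sigma2 / 2)^-1 * (2 / sigma2)^-1.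
    have q0 : 0 < 1 + k%:R * (sigma2 / 2).
      by rewrite ltr_pwDl// mulr_ge0// divr_ge0// ltW.
    have -> : k%:R^-1 + sigma2 / 2 = (1 + k%:R * (sigma2 / 2)) / k%:R by field.
    rewrite !invf_div; field.
    by rewrite gt_eqF// ltr_pwDl// mulr_ge0// ltW.
  apply: cvgB; first exact: cvg_cst.
  apply: cvgM => //; apply: cvgV => //.
  by rewrite mulf_neq0// ?invr_eq0 gt_eqF.
apply: cvg_trans c4; apply: near_eq_cvg; near=> n.
have n0 : (0 < n)%N by near: n; exact: nbhs_infty_gt.
rewrite E /s (gtn_eqF n0) probability_survival /= -mulf_div divff ?mul1r; last first.
  by rewrite pnatr_eq0 -lt0n.
by field.
Unshelve. all: by end_near. Qed.

End Population.

Lemma cvg_sum_seq (R : realType) (I : eqType) (r : seq I) (a l : I -> R) (u : I -> nat -> R) :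
  (forall i, i \in r -> u i @ \oo --> l i) ->
  (fun n => \sum_(i <- r) a i * u i n) @ \oo --> \sum_(i <- r) a i * l i.
Proof.
elim: r => [|i r ih] h.
  rewrite big_nil (_ : (fun n => _) = fun=> 0); first exact: cvg_cst.
  by apply/funext => n; rewrite big_nil.
rewrite big_cons (_ : (fun n => _) = (fun n => a i * u i n + \sum_(j <- r) a j * u j n)).
  apply: cvgD; last by apply: ih => j jr; apply: h; rewrite inE jr orbT.
  by apply: cvgM; [exact: cvg_cst|apply: h; rewrite mem_head].
by apply/funext => n; rewrite big_cons.
Qed.

(** * Limits of the site means and the first-moment law of large numbers *)

Section Limits.
Context (R : realType) (dim : nat) (Q : probability nat R) (d : measure_display)
  (T : measurableType d) (P : probability T R) (offspring : seq nat -> {RV P >-> nat})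
  (step : seq nat -> T -> 'rV[int]_dim).
Hypothesis brw : branching_random_walk Q offspring step.
Variable sigma2 : R.
Hypothesis dim_ge3 : (3 <= dim)%N.
Hypothesis Q_mean : (\int[Q]_l (l%:R)%:E = 1)%E.
Hypothesis Q_pairs : (\int[Q]_l ((l * l.-1)%:R)%:E = sigma2%:E)%E.
Hypothesis sigma2_gt0 : 0 < sigma2.
Local Notation cloud n := (cloud offspring step n [::]).
Local Notation cmean := (cmean offspring step).
Local Notation site_mean := (site_mean offspring step).
Local Notation bound := (collision_bound dim sigma2).

Lemma cmean_itv n : 0 <= cmean n <= bound.
Proof.
rewrite -!lee_fin -(integral_coll brw dim_ge3 Q_mean Q_pairs) collision_mean_ge0.
exact: (collision_mean_bound brw dim_ge3 Q_mean Q_pairs).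
Qed.

Lemma cmean_homo : {homo cmean : n m / (n <= m)%N >-> n <= m}.
Proof.
move=> n m nm; rewrite -(subnK nm).
(* [cmean_le] comes from the coarsening bound of a site statistic; any predicate failing at 0 can
   play that part. *)
exact: (cmean_le brw dim_ge3 Q_mean Q_pairs (p := pred1 1%N)).
Qed.

Lemma cmean_cvg : cmean @ \oo --> limn cmean.
Proof.
apply: nondecreasing_is_cvgn; first exact: cmean_homo.
by exists bound => _ [n _ <-]; have /andP[] := cmean_itv n.
Qed.

Lemma cmean_le_lim n : cmean n <= limn cmean.
Proof.
apply: nondecreasing_cvgn_le; first exact: cmean_homo.
exact: (cvgP _ cmean_cvg).
Qed.

Section Site_statistics.
Variable p : pred nat.
Hypothesis p0 : ~~ p 0%N.

(* [site_mean + cmean] is nondecreasing, which is where the limit comes from. *)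
Lemma site_mean_cvg : site_mean p @ \oo --> limn (site_mean p).
Proof.
pose u n := site_mean p n + cmean n.
have hu : u @ \oo --> limn u.
  apply: nondecreasing_is_cvgn.
    move=> n m nm; have := site_mean_cauchy brw dim_ge3 Q_mean Q_pairs p0 (m - n) n.
    by rewrite subnK// ler_norml /u => /andP[]; lra.
  exists (1 + bound) => _ [n _ <-]; apply: lerD; last by have /andP[] := cmean_itv n.
  by have /andP[] := site_mean_itv brw Q_mean p0 n.
have : (fun n => u n - cmean n) @ \oo --> limn u - limn cmean.
  by apply: cvgB => //; exact: cmean_cvg.
rewrite (_ : (fun n => u n - cmean n) = site_mean p); first by move/cvgP.
by apply/funext => n; rewrite /u addrK.
Qed.

Lemma site_mean_lim_error m : `|limn (site_mean p) - site_mean p m| <= limn cmean - cmean m.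
Proof.
have c : (fun n => `|site_mean p n - site_mean p m|) @ \oo --> `|limn (site_mean p) - site_mean p m|.
  by apply: cvg_norm; apply: cvgB; [exact: site_mean_cvg|exact: cvg_cst].
rewrite -(cvg_lim (@norm_hausdorff _ _) c).
apply: limr_le; first exact: cvgP c.
near=> n; have mn : (m <= n)%N by near: n; exact: nbhs_infty_ge.
have := site_mean_cauchy brw dim_ge3 Q_mean Q_pairs p0 (n - m) m.
by rewrite subnK// => /le_trans; apply; rewrite lerD2r cmean_le_lim.
Unshelve. all: by end_near. Qed.

(** The block age [m] is fixed before [n] grows: it controls both the cross-block collisions and the
    distance of [site_mean m] to its limit, uniformly in [n], and the block variance is then a
    constant. *)
Lemma site_lln e : 0 < e -> \forall n \near \oo,
  (\int[P]_w (`|(sites p (cloud n w))%:R - limn (site_mean p) * (size (cloud n w))%:R|)%:E <= e%:E)%E.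
Proof.
move=> e0; set c := limn (site_mean p).
have [m hm] : exists m, limn cmean - cmean m <= e / 4.
  have /cvgrPdist_le /(_ (e / 4)) := cmean_cvg.
  move=> /(_ (divr_gt0 e0 (ltr0n _ 4))) [m _ h].
  by exists m; apply: le_trans (h m _) => //=; exact: ler_norm.
have [K [K0 [N1 hK]]] : exists K, 0 < K /\ exists N1, forall n, (N1 <= n)%N ->
    n%:R * fine (P (survival offspring n)) <= K.
  have /cvgrPdist_le /(_ 1 ltr01) [N1 _ h] := survival_rate brw Q_mean Q_pairs sigma2_gt0.
  exists (2 / sigma2 + 1); split; first by rewrite addr_gt0 ?divr_gt0.
  by exists N1 => n /h; rewrite distrC => /(le_trans (ler_norm _)); lra.
pose eta := e / (4 * K); have eta0 : 0 < eta by rewrite divr_gt0// mulr_gt0.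
pose V : R := 2 * (1 + m%:R * sigma2).
have V0 : 0 < V by rewrite mulr_gt0// ltr_pwDl// mulr_ge0// ltW.
near=> n.
have nm : (m <= n)%N by near: n; exact: nbhs_infty_ge.
have n0 : 0 < n%:R :> R by rewrite ltr0n; near: n; exact: nbhs_infty_gt.
have lam0 : 0 < eta * n%:R by rewrite mulr_gt0.
have dev := site_deviation brw dim_ge3 Q_mean Q_pairs p0 (n - m) m lam0.
rewrite subnK// /= in dev.
have kc : `|site_mean p m - c| <= e / 4.
  by rewrite distrC (le_trans (site_mean_lim_error m)).
have m1 := measurable_cloud brw n (fun B => (`|(sites p B)%:R - site_mean p m * (size B)%:R|)%:E).
have m2 := measurable_cloud brw n (fun B => (`|site_mean p m - c| * (size B)%:R)%:E).
have m3 := measurable_cloud brw n (fun B => (`|(sites p B)%:R - c * (size B)%:R|)%:E).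
have m4 := measurable_cloud brw n (fun B => ((size B)%:R)%:E).
apply: (@le_trans _ _ (\int[P]_w ((`|(sites p (cloud n w))%:R - site_mean p m * (size (cloud n w))%:R|)%:E +
   (`|site_mean p m - c| * (size (cloud n w))%:R)%:E))%E).
  apply: ge0_le_integral => //; try by move=> w _; rewrite -?EFinD lee_fin ?addr_ge0 ?mulr_ge0.
    exact: emeasurable_funD.
  move=> w _; rewrite -EFinD lee_fin.
  set a : R := (sites p _)%:R; set b : R := (size _)%:R.
  have -> : a - c * b = (a - site_mean p m * b) + (site_mean p m - c) * b by ring.
  by rewrite (le_trans (ler_normD _ _))// lerD2l normrM [X in _ * X]ger0_norm.
rewrite ge0_integralD//; try by move=> w _; rewrite lee_fin ?mulr_ge0.
have -> : (\int[P]_w (`|site_mean p m - c| * (size (cloud n w))%:R)%:E =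
    (`|site_mean p m - c|)%:E)%E.
  under eq_integral do rewrite EFinM.
  by rewrite ge0_integralZl// ?(integral_esize brw Q_mean n) ?mule1 ?lee_fin.
apply: (le_trans (leeD dev (lexx _))); rewrite -EFinD lee_fin.
have h1 : cmean n - cmean m <= e / 4.
  by rewrite (le_trans _ hm)// lerD2r cmean_le_lim.
have h2 : V / (eta * n%:R) <= e / 4.
  rewrite ler_pdivrMr// -ler_pdivrMl ?divr_gt0// -ler_pdivrMl//.
  by near: n; exact: nbhs_infty_ger.
have h3 : eta * n%:R * fine (P (survival offspring n)) <= e / 4.
  rewrite -mulrA; apply: (@le_trans _ _ (eta * K)).
    apply: ler_wpM2l; first exact: ltW.
    by apply: hK; near: n; exact: nbhs_infty_ge.
  rewrite /eta le_eqVlt; apply/orP; left; apply/eqP; field.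
  by rewrite gt_eqF.
rewrite -/V; lra.
Unshelve. all: by end_near. Qed.

End Site_statistics.

Definition intensity j : R := limn (site_mean (pred1 j)).
Definition occupation_intensity : R := limn (site_mean (ltn 0)).

Lemma integral_sites_sum (a : nat -> nat) J n :
  (\int[P]_w ((\sum_(1 <= j < J) a j * sites (pred1 j) (cloud n w))%N%:R)%:E =
   (\sum_(1 <= j < J) (a j)%:R * site_mean (pred1 j) n)%:E)%E.
Proof.
have h0 j w : (0 <= ((a j)%:R%:E * (esites R (pred1 j) (cloud n w))))%E.
  by rewrite mule_ge0// lee_fin.
transitivity (\int[P]_w (\sum_(1 <= j < J) ((a j)%:R%:E * esites R (pred1 j) (cloud n w))))%E.
  by apply: eq_integral => w _; rewrite natr_sum -sumEFin; apply: eq_bigr => j _; rewrite natrM EFinM.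
rewrite ge0_integral_sum//; last first.
  by move=> j; exact: (measurable_cloud brw n (fun B => (a j)%:R%:E * esites R (pred1 j) B)%E).
rewrite -sumEFin big_nat [RHS]big_nat; apply: eq_bigr => j /andP[j1 _].
have j0 : ~~ pred1 j 0%N by rewrite /= eq_sym -lt0n.
have mj := measurable_cloud brw n (esites R (pred1 j)).
rewrite ge0_integralZl//; try by move=> w _; rewrite lee_fin.
by rewrite (integral_esites brw Q_mean j0) EFinM.
Qed.

Lemma integral_size n : (\int[P]_w ((size (cloud n w))%:R)%:E = 1)%E.
Proof. exact: (integral_esize brw Q_mean n). Qed.

(** The expectation of the truncation inequalities. The tail is at most the collision bound over [J]
    uniformly in [n], which is what permits exchanging the limits in [n] and [J]. *)
Lemma sum_site_mean_bounds (a : nat -> nat) (h : seq 'rV[int]_dim -> nat) (l : R) J n : (0 < J)%N ->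
  (forall B, \sum_(1 <= j < J) a j * sites (pred1 j) B <= h B)%N ->
  (forall B, J * h B <= J * (\sum_(1 <= j < J) a j * sites (pred1 j) B) + coll B B)%N ->
  (\int[P]_w ((h (cloud n w))%:R)%:E = l%:E)%E ->
  l - bound / J%:R <= \sum_(1 <= j < J) (a j)%:R * site_mean (pred1 j) n <= l.
Proof.
move=> J0 h1 h2 il.
have m1 := measurable_cloud brw n (fun B => ((h B)%:R)%:E).
have m2 := measurable_cloud brw n (fun B => ((\sum_(1 <= j < J) a j * sites (pred1 j) B)%N%:R)%:E).
have m3 := measurable_cloud brw n (fun B => ((coll B B)%:R)%:E).
have m4 := measurable_cloud brw n (fun B => (J%:R)%:E * ((h B)%:R)%:E)%E.
have m5 := measurable_cloud brw n (fun B =>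
  (J%:R)%:E * ((\sum_(1 <= j < J) a j * sites (pred1 j) B)%N%:R)%:E)%E.
have JR : 0 < J%:R :> R by rewrite ltr0n.
set S := \sum_(1 <= j < J) (a j)%:R * _.
have hi : S <= l.
  rewrite -lee_fin -il -integral_sites_sum; apply: ge0_le_integral => //.
  by move=> w _; rewrite lee_fin ler_nat.
have lo : J%:R * l <= J%:R * S + cmean n.
  rewrite -lee_fin EFinD !EFinM -il -integral_sites_sum.
  rewrite -(integral_coll brw dim_ge3 Q_mean Q_pairs) -!ge0_integralZl//.
  rewrite -ge0_integralD//; try by move=> w _; rewrite -?EFinM lee_fin ?mulr_ge0.
  apply: ge0_le_integral => //;
    try by move=> w _; rewrite -?EFinM -?EFinD lee_fin ?addr_ge0// mulr_ge0.
    exact: emeasurable_funD.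
  by move=> w _; rewrite -!EFinM -EFinD lee_fin -!natrM -natrD ler_nat.
have /andP[_ cb] := cmean_itv n.
rewrite hi andbT lerBlDr -(ler_pM2l JR) mulrDr mulrCA divff ?gt_eqF// mulr1.
by apply: le_trans lo _; rewrite lerD2l.
Qed.

End Limits.

(** * Approximation by polynomials in an exponential *)

Section Bernstein.
Context (R : realType).
Implicit Types (phi psi : nat -> R) (t : R).

(* [bernstein N phi] evaluates at t to the mean of phi at a binomial (N, t)
   variable. *)
Fixpoint bernstein N phi : {poly R} :=
  if N is N'.+1
  then 'X * bernstein N' (fun k => phi k.+1) + (1 - 'X) * bernstein N' phi
  else (phi 0%N)%:P.

Lemma bernsteinS N phi t : (bernstein N.+1 phi).[t] =
  t * (bernstein N (fun k => phi k.+1)).[t] + (1 - t) * (bernstein N phi).[t].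
Proof. by rewrite /= !hornerE. Qed.

Lemma bernstein_cst N c t : (bernstein N (fun=> c)).[t] = c.
Proof.
elim: N => [|N ih]; first by rewrite /= hornerC.
by rewrite bernsteinS !ih; ring.
Qed.

Lemma bernsteinD N phi psi t : (bernstein N (fun k => phi k + psi k)).[t] =
  (bernstein N phi).[t] + (bernstein N psi).[t].
Proof.
elim: N phi psi => [|N ih] phi psi; first by rewrite /= !hornerE.
by rewrite !bernsteinS !ih; ring.
Qed.

Lemma bernsteinZ N c phi t : (bernstein N (fun k => c * phi k)).[t] = c * (bernstein N phi).[t].
Proof.
elim: N phi => [|N ih] phi; first by rewrite /= !hornerE.
by rewrite !bernsteinS !ih; ring.
Qed.

Lemma le_bernstein N phi psi t : 0 <= t <= 1 -> (forall k, phi k <= psi k) ->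
  (bernstein N phi).[t] <= (bernstein N psi).[t].
Proof.
move=> /andP[t0 t1]; elim: N phi psi => [|N ih] phi psi h; first by rewrite /= !hornerE.
rewrite !bernsteinS; apply: lerD; first by apply: ler_wpM2l => //; exact: ih.
by apply: ler_wpM2l; [rewrite subr_ge0|exact: ih].
Qed.

Lemma eq_bernstein N phi psi t : (forall k, phi k = psi k) ->
  (bernstein N phi).[t] = (bernstein N psi).[t].
Proof. by move=> h; congr (bernstein N _).[t]; apply/funext. Qed.

(** The second moment about -a of a binomial variable; a free shift [a] makes the induction close,
    and a = -Nt gives the variance. *)
Lemma bernstein_variance N a t :
  (bernstein N (fun k => (k%:R + a) ^+ 2)).[t] = (N%:R * t + a) ^+ 2 + N%:R * (t * (1 - t)).
Proof.
elim: N a => [|N ih] a; first by rewrite /= !hornerE; ring.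
rewrite bernsteinS ih (@eq_bernstein N (fun k => (k.+1%:R + a) ^+ 2) (fun k => (k%:R + (1 + a)) ^+ 2)).
  by rewrite ih -natr1; ring.
by move=> k; rewrite -natr1; congr (_ ^+ 2); ring.
Qed.

(** Chebyshev's inequality: near [t] the modulus of [G] applies, farther away the difference is at
    most 2M times the squared deviation over del^2. The modulus is asked at the single point [t], so
    [G] may be irregular elsewhere. *)
Lemma bernstein_approx N (G : R -> R) M e del t : (0 < N)%N -> 0 <= t <= 1 -> 0 < del ->
  0 <= e -> (forall s, `|G s| <= M) ->
  (forall s, `|s - t| < del -> `|G s - G t| <= e) ->
  `|(bernstein N (fun k => G (k%:R / N%:R))).[t] - G t| <= e + 2 * M / del ^+ 2 / N%:R.
Proof.
move=> N0 /andP[t0 t1] del0 e0 GM Gt.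
have M0 : 0 <= M by exact: le_trans (GM 0).
have NR : 0 < N%:R :> R by rewrite ltr0n.
pose psi k := e + 2 * M / del ^+ 2 / N%:R ^+ 2 * (k%:R + - (N%:R * t)) ^+ 2.
have key k : `|G (k%:R / N%:R) - G t| <= psi k.
  have q0 : 0 <= 2 * M / del ^+ 2 / N%:R ^+ 2 * (k%:R + - (N%:R * t)) ^+ 2.
    by rewrite mulr_ge0 ?sqr_ge0// !divr_ge0 ?exprn_ge0 ?mulr_ge0// ltW.
  have [h|h] := ltP `|k%:R / N%:R - t| del; first by rewrite (le_trans (Gt _ h))// /psi lerDl.
  apply: (@le_trans _ _ (2 * M)).
    by rewrite (le_trans (ler_normB _ _))// mulr2n mulrDl !mul1r lerD.
  rewrite /psi (le_trans _ (ler_wpDl e0 (lexx _)))//.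
  have -> : 2 * M / del ^+ 2 / N%:R ^+ 2 * (k%:R + - (N%:R * t)) ^+ 2 =
    2 * M * ((k%:R / N%:R - t) ^+ 2 / del ^+ 2) by field; rewrite !gt_eqF.
  apply: ler_peMr; first by rewrite mulr_ge0.
  rewrite ler_pdivlMr ?exprn_gt0// mul1r -[leRHS]ger0_norm ?sqr_ge0// normrX.
  by apply: lerXn2r; rewrite ?nnegrE ?(ltW del0).
have t01 : 0 <= t <= 1 by rewrite t0.
have S : (bernstein N psi).[t] <= e + 2 * M / del ^+ 2 / N%:R.
  rewrite /psi (bernsteinD N (fun=> e)) bernstein_cst bernsteinZ bernstein_variance.
  rewrite lerD2l subrr expr0n add0r.
  have -> : 2 * M / del ^+ 2 / N%:R ^+ 2 * (N%:R * (t * (1 - t))) =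
    2 * M / del ^+ 2 / N%:R * (t * (1 - t)) by field; rewrite !gt_eqF.
  apply: ler_piMr.
    by rewrite !divr_ge0 ?exprn_ge0 ?mulr_ge0// ltW.
  by rewrite mulr_ile1// ?subr_ge0// gerBl.
apply: le_trans S; rewrite ler_norml; apply/andP; split.
  rewrite lerNl opprB lerBlDr -(bernstein_cst N (G t) t) -bernsteinD.
  by apply: le_bernstein => // k; have := key k; rewrite ler_norml => /andP[]; lra.
rewrite lerBlDr -(bernstein_cst N (G t) t) -bernsteinD.
by apply: le_bernstein => // k; have := key k; rewrite ler_norml => /andP[]; lra.
Qed.

Lemma bernstein_bound N phi M t : 0 <= t <= 1 -> (forall k, `|phi k| <= M) ->
  `|(bernstein N phi).[t]| <= M.
Proof.
move=> t01 h; rewrite ler_norml -{1}(bernstein_cst N (- M) t) -{2}(bernstein_cst N M t).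
by rewrite !le_bernstein// => k; have := h k; rewrite ler_norml => /andP[].
Qed.

End Bernstein.

Section Uniform.
Context (R : realType).

(** Compactness of the segment turns a threshold that is locally uniform into a uniform one. *)
Lemma segment_uniform (a b : R) (P : nat -> R -> Prop) :
  (forall x, a <= x <= b -> \forall y \near x & N \near \oo, P N y) ->
  \forall N \near \oo, forall x, a <= x <= b -> P N x.
Proof.
move=> h; have := (compact_near_coveringP `[a, b]%classic).1 (@segment_compact R a b).
move=> /(_ nat \oo P _); case.
  by move=> x /=; rewrite in_itv /=; exact: h.
by move=> N _ hN; exists N => // n /hN H x x01; apply: H; rewrite /= in_itv.
Qed.

(** Weierstrass approximation in the variable t = exp(-z). [G] need not be continuous at t = 0,
    which is z at infinity, but [exp(-K), 1] avoids this point and boundedness of [G] suffices off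
    it. The bound of the polynomial by [M] on all of [0, 1] controls z > K later. *)
Lemma exp_polynomial_approx (g : R -> R) (M K e : R) : continuous g ->
  (forall x, `|g x| <= M) -> 0 < e ->
  exists p : {poly R}, (forall t, 0 <= t <= 1 -> `|p.[t]| <= M) /\
    (forall z, 0 <= z <= K -> `|p.[expR (- z)] - g z| <= e).
Proof.
move=> cg gM e0; pose G t := g (- ln t).
have GM t : `|G t| <= M by exact: gM.
have [N1 _ h1] : \forall N \near \oo, forall t, expR (- K) <= t <= 1 ->
    forall s, `|s - t| < N.+1%:R^-1 -> `|G s - G t| <= e / 2.
  apply: (segment_uniform (P := fun N t => forall s, `|s - t| < N.+1%:R^-1 -> `|G s - G t| <= e / 2)).
  move=> t /andP[tK _]; have t0 : 0 < t by rewrite (lt_le_trans _ tK)// expR_gt0.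
  have cG : {for t, continuous G}.
    apply: continuous_comp; last exact: cg.
    by apply: continuousN; exact: continuous_ln.
  have e4 : 0 < e / 4 by rewrite divr_gt0.
  move/cvgrPdist_le: cG => /(_ _ e4) [/= del del0 hd].
  exists (ball t (del / 2), [set N | N.+1%:R^-1 < del / 2]).
    split => /=; first by apply: nbhsx_ballx; rewrite divr_gt0.
    near=> N; near: N; exact: (near_infty_natSinv_lt (PosNum (divr_gt0 del0 (ltr0n _ 2)))).
  move=> [y N] /= [ty Nd] s sy.
  have hy : `|G t - G y| <= e / 4.
    by apply: hd; apply: le_ball ty; rewrite ler_pdivrMr// ler_pMr// ler1n.
  have hs : `|G t - G s| <= e / 4.
    apply: hd; rewrite /ball /= in ty *.
    rewrite (_ : t - s = (t - y) - (s - y)); last by ring.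
    rewrite (le_lt_trans (ler_normB _ _))// (splitr del) ltrD//.
    exact: lt_trans sy Nd.
  rewrite (_ : G s - G y = (G t - G y) - (G t - G s)); last by ring.
  by rewrite (le_trans (ler_normB _ _))//; lra.
have M0 : 0 <= M by exact: le_trans (gM 0).
pose del : R := N1.+1%:R^-1.
have del0 : 0 < del by rewrite invr_gt0.
have [N2 hN2] : exists N2 : nat, 2 * M / del ^+ 2 / (e / 2) <= N2%:R.
  exists (Num.bound (2 * M / del ^+ 2 / (e / 2))).
  by apply/ltW/archi_boundP; rewrite !divr_ge0 ?exprn_ge0 ?mulr_ge0// ltW.
exists (bernstein N2.+1 (fun k => G (k%:R / N2.+1%:R))); split.
  by move=> t t01; apply: bernstein_bound => // k; exact: GM.
move=> z /andP[z0 zK].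
have t1 : expR (- z) <= 1 by rewrite -expR0 ler_expR oppr_le0.
have -> : g z = G (expR (- z)) by rewrite /G expRK opprK.
have t01 : 0 <= expR (- z) <= 1 by rewrite expR_ge0.
apply: (le_trans (bernstein_approx (M := M) (e := e / 2) (del := del) _ t01 del0 _ GM _)) => //.
- by rewrite divr_ge0// ltW.
- by apply: h1 => /=; [|rewrite t1 andbT ler_expR lerN2].
rewrite [leRHS](splitr e) lerD2l ler_pdivrMr//.
rewrite -ler_pdivrMl ?divr_gt0// mulrC.
by rewrite (le_trans hN2)// ler_nat.
Unshelve. all: by end_near. Qed.

End Uniform.

(** * Weak convergence *)

Section Density.
Local Open Scope ereal_scope.
Context (R : realType) (d : measure_display) (T : measurableType d)
  (mu nu : {measure set T -> \bar R}) (g : T -> R).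
Import HBNNSimple.

(** Both sides are monotone limits along simple functions, for which the identity is linearity and
    the hypothesis on sets. *)
Lemma ge0_integral_density (f : T -> \bar R) : measurable_fun setT g ->
  (forall x, (0 <= g x)%R) -> (forall A, measurable A -> nu A = \int[mu]_(x in A) (g x)%:E) ->
  measurable_fun setT f -> (forall x, 0 <= f x) ->
  \int[nu]_x f x = \int[mu]_x (f x * (g x)%:E).
Proof.
move=> mg g0 nuE mf f0; pose h := nnsfun_approx measurableT mf.
have mgE : measurable_fun setT (fun x => (g x)%:E) by exact/measurable_EFinP.
have hf x : (EFin \o h n) x @[n --> \oo] --> f x by exact: cvg_nnsfun_approx.
have hE n x : (h n x)%:E = \sum_(y \in range (h n)) (y * \1_(h n @^-1` [set y]) x)%:E.
  by rewrite fsumEFin// -fimfunE.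
have mi n r : measurable_fun setT (fun x => (r * \1_(h n @^-1` [set r]) x)%:E).
  by apply: (measurable_comp measurableT) => //; exact: measurable_funM.
transitivity (limn (fun n => \int[nu]_x (h n x)%:E)).
  rewrite -monotone_convergence//.
  - by apply: eq_integral => x _; apply/esym/cvg_lim => //; exact: hf.
  - by move=> n; exact/measurable_EFinP/measurable_funP.
  - by move=> n x _; rewrite lee_fin.
  - by move=> x _ m n mn; rewrite lee_fin; exact/lefP/nd_nnsfun_approx.
transitivity (limn (fun n => \int[mu]_x ((h n x)%:E * (g x)%:E))); last first.
  rewrite -monotone_convergence//.
  - apply: eq_integral => x _; apply/cvg_lim => //.
    by apply: cvgeZr => //; exact: hf.
  - move=> n; apply: emeasurable_funM => //.
    exact/measurable_EFinP/measurable_funP.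
  - by move=> n x _; rewrite mule_ge0 ?lee_fin.
  - move=> x _ m n mn; rewrite lee_wpmul2r ?lee_fin//.
    exact/lefP/nd_nnsfun_approx.
congr (limn _); apply/funext => n.
under eq_integral do rewrite hE.
rewrite ge0_integral_fsum//; last by move=> y x _; exact: nnfun_muleindic_ge0.
transitivity (\int[mu]_x (\sum_(y \in range (h n)) ((y * \1_(h n @^-1` [set y]) x)%:E * (g x)%:E))); last first.
  apply: eq_integral => x _; rewrite hE ge0_mule_fsuml// => y.
  exact: nnfun_muleindic_ge0.
rewrite ge0_integral_fsum//; last 2 first.
- by move=> y; exact: emeasurable_funM.
- by move=> y x _; rewrite mule_ge0 ?lee_fin// -?lee_fin nnfun_muleindic_ge0.
apply: eq_fsbigr => r; rewrite inE => -[x0 _ rE].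
have mr : measurable (h n @^-1` [set r]) by exact: measurable_sfunP.
have r0 : (0 <= r)%R by rewrite -rE.
under eq_integral do rewrite EFinM.
under [RHS]eq_integral do rewrite EFinM -muleA.
have m1 : measurable_fun setT (fun x => (\1_(h n @^-1` [set r]) x)%:E : \bar R).
  by apply/measurable_EFinP.
rewrite !ge0_integralZl//; try by move=> x _; rewrite ?mule_ge0 ?lee_fin.
  congr (_ * _); rewrite integral_indic// setIT nuE// integral_mkcond.
  apply: eq_integral => x _; rewrite epatch_indic muleC//.
exact: emeasurable_funM.
Qed.

End Density.

Section Exponential.
Context (R : realType) (d : measure_display) (T : measurableType d) (P : probability T R).
Variables (Y : {RV P >-> R}) (rate : R).
Hypothesis rate0 : 0 < rate.
Hypothesis Y_exp : exponentially_distributed Y rate.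

(** Tilting the exponential density by exp(-kx) gives, up to the factor rate/(rate + k), the
    exponential density of rate + k. The maximum with 0 alters [Y] on a null event only and keeps
    the integrand bounded by 1. *)
Lemma exponential_laplace k :
  (\int[P]_w (expR (- (k%:R * Num.max 0 (Y w))))%:E = (rate / (rate + k%:R))%:E)%E.
Proof.
have rk : 0 < rate + k%:R by rewrite ltr_pwDl.
pose phi : T -> measurableTypeR R := Y.
have mphi : measurable_fun setT phi by exact: (measurable_funP Y).
have mE : measurable_fun setT (fun x : measurableTypeR R => (expR (- (k%:R * Num.max 0 x)))%:E).
  apply/measurable_EFinP; apply: measurableT_comp => //.
  apply: measurableT_comp => //; apply: measurable_funM => //.
  exact: measurable_maxr.
transitivity (\int[pushforward P phi]_x (expR (- (k%:R * Num.max 0 x)))%:E)%E.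
  by rewrite (ge0_integral_pushforward mphi P measurableT mE)// preimage_setT.
rewrite (@ge0_integral_density R _ _ lebesgue_measure _ (exponential_pdf rate))//.
- have -> : (fun x => (expR (- (k%:R * Num.max 0 x)))%:E * (exponential_pdf rate x)%:E)%E =
    (fun x => (rate / (rate + k%:R))%:E * (exponential_pdf (rate + k%:R) x)%:E)%E.
    apply/funext => x; rewrite -!EFinM; congr EFin.
    have [x0|x0] := leP 0 x; last by rewrite !lt0_exponential_pdf// !mulr0.
    rewrite !exponential_pdfE// mulrCA -expRD mulrA divfK ?gt_eqF//.
    by congr (_ * expR _); ring.
  rewrite ge0_integralZl//.
  + by rewrite integral_exponential_pdf// mule1.
  + by apply/measurable_EFinP; exact: measurable_exponential_pdf.
  + by move=> x _; rewrite lee_fin exponential_pdf_ge0// ltW.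
  + by rewrite lee_fin divr_ge0// ltW.
- exact: measurable_exponential_pdf.
- by move=> x; rewrite exponential_pdf_ge0// ltW.
Qed.

Lemma exponential_tail K : 0 < K ->
  P [set w | ~~ (0 <= Y w <= K)] = (expR (- rate * K))%:E.
Proof.
move=> K0.
have mI : measurable (Y @^-1` `[0, K]%classic).
  by rewrite -(setTI (_ @^-1` _)); exact: (measurable_funP Y).
have -> : [set w | ~~ (0 <= Y w <= K)] = ~` (Y @^-1` `[0, K]%classic).
  by apply/seteqP; split => w /=; rewrite in_itv /= => /negP.
rewrite probability_setC//.
have := Y_exp (measurable_itv `[0, K]); rewrite /distribution /pushforward => ->.
rewrite exponential_prob_itv0c//.
by rewrite -EFinB; congr EFin; ring.
Qed.

End Exponential.

Section Bounded.
Context (R : realType) (d : measure_display) (T : measurableType d) (P : probability T R).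
Variables (G : set T) (mG : measurable G).
Implicit Types f g : T -> R.

Lemma integrable_bounded M f : measurable_fun setT f -> (forall w, `|f w| <= M) ->
  P.-integrable G (EFin \o f).
Proof.
move=> mf fM; apply: measurable_bounded_integrable => //.
- by rewrite (le_lt_trans (probability_le1 P mG))// ltry.
- exact: measurable_funTS.
exists M; split; first exact: num_real.
by move=> x Mx w _ /=; rewrite (le_trans (fM w))// ltW.
Qed.

(** The error has two parts: [e] is paid on [G] only, whereas [D] is controlled by its unconditional
    mean. After division by P(G) the second is harmless as soon as [l] is small compared with
    P(G). *)
Lemma Rintegral_close (M e l : R) f g (D : T -> R) : measurable_fun setT f -> measurable_fun setT g ->
  measurable_fun setT D -> (forall w, `|f w| <= M) -> (forall w, `|g w| <= M) ->
  0 <= e -> (forall w, 0 <= D w) -> (\int[P]_w (D w)%:E <= l%:E)%E ->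
  (forall w, G w -> `|f w - g w| <= e + D w) ->
  `|\int[P]_(w in G) f w - \int[P]_(w in G) g w| <= e * fine (P G) + l.
Proof.
move=> mf mg mD fM gM e0 D0 Dl fg.
have iF := integrable_bounded mf fM; have iG := integrable_bounded mg gM.
rewrite -RintegralB//.
have mB : measurable_fun setT (fun w => f w - g w) by exact: measurable_funB.
have iB : P.-integrable G (EFin \o (fun w => f w - g w)).
  apply: (@integrable_bounded (M + M)) => // w.
  by rewrite (le_trans (ler_normB _ _))// lerD.
apply: (le_trans (le_normr_Rintegral mG iB)).
have PG : P G = (fine (P G))%:E by rewrite fineK// fin_num_measure.
have mDE : measurable_fun setT (EFin \o D) by exact/measurable_EFinP.
have h : (\int[P]_(w in G) (`|f w - g w|)%:E <= (e * fine (P G) + l)%:E)%E.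
  apply: (@le_trans _ _ (\int[P]_(w in G) (e%:E + (D w)%:E))%E).
    apply: ge0_le_integral => //; try by move=> w Gw; rewrite lee_fin ?fg ?addr_ge0.
      by apply: measurable_funTS; apply/measurable_EFinP; exact: measurableT_comp.
    by apply: measurable_funTS; exact: emeasurable_funD.
  rewrite ge0_integralD//; try (by move=> w _; rewrite lee_fin); last exact: measurable_funTS.
  rewrite integral_cst// EFinD EFinM -PG leeD2l//.
  apply: le_trans Dl; apply: ge0_subset_integral => //.
  by move=> w _; rewrite lee_fin.
rewrite -lee_fin (le_trans _ h)// /Rintegral fineK//.
rewrite ge0_fin_numE; last by apply: integral_ge0 => w _; rewrite lee_fin.
by rewrite (le_lt_trans h)// ltry.
Qed.

Lemma Rintegral_poly (Z : T -> R) (p : {poly R}) : measurable_fun setT Z -> (forall w, 0 <= Z w) ->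
  \int[P]_(w in G) p.[expR (- Z w)] =
  \sum_(i < size p) p`_i * \int[P]_(w in G) (expR (- Z w) ^+ i).
Proof.
move=> mZ Z0.
have mE i : measurable_fun setT (fun w => expR (- Z w) ^+ i).
  by apply: measurable_funX; apply: measurableT_comp => //; exact: measurableT_comp.
have bE i w : `|expR (- Z w) ^+ i| <= 1.
  by rewrite normrX exprn_ile1// ger0_norm ?expR_ge0// -expR0 ler_expR oppr_le0.
under eq_Rintegral do rewrite horner_coef.
elim: (size p) => [|n ih].
  under eq_Rintegral do rewrite big_ord0.
  by rewrite big_ord0 Rintegral_cst// mul0r.
under eq_Rintegral do rewrite big_ord_recr /=.
have iE := integrable_bounded (mE n) (bE n).
have mS : measurable_fun setT (fun w => \sum_(i < n) p`_i * expR (- Z w) ^+ i).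
  by apply: measurable_sum => i; exact: measurable_funM.
rewrite RintegralD//.
- by rewrite ih big_ord_recr /= RintegralZl.
- apply: (@integrable_bounded (\sum_(i < n) `|p`_i|)) => // w.
  apply: (le_trans (ler_norm_sum _ _ _)); apply: ler_sum => i _.
  by rewrite normrM ler_piMr.
- apply: (@integrable_bounded (`|p`_n|)); first exact: measurable_funM.
  by move=> w; rewrite normrM ler_piMr.
Qed.

End Bounded.

(** * Continuity in the product topology near a ray *)

Section Product_topology.
Context (R : realType).

(** Continuity in the product topology involves finitely many coordinates near each point, and
    compactness of the piece of the ray makes their number uniform. A single [N] serves both as
    number of coordinates and as inverse precision. *)
Lemma uniform_on_ray (f : (R * {ptws nat -> R} * R)%type -> R) (a : nat -> R) (c K e : R) :
  continuous f -> 0 < e ->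
  exists N, forall z, 0 <= z <= K -> forall (b : nat -> R) t,
    (forall i, (i < N)%N -> `|b i - a i * z| <= N.+1%:R^-1) -> `|t - c * z| <= N.+1%:R^-1 ->
    `|f (z, b, t) - f (z, (fun i => a i * z), c * z)| <= e.
Proof.
move=> cf e0.
pose H z : (R * {ptws nat -> R} * R)%type := (z, (fun i => a i * z), c * z).
pose near_ray N z (b : nat -> R) t :=
  (forall i, (i < N)%N -> `|b i - a i * z| <= N.+1%:R^-1) /\ `|t - c * z| <= N.+1%:R^-1.
suff [N _ h] : \forall N \near \oo, forall z, 0 <= z <= K -> forall b t, near_ray N z b t ->
    `|f (z, b, t) - f (H z)| <= e.
  by exists N => z zK b t hb ht; apply: (h N (leqnn N)).
apply: (segment_uniform (P := fun N z => forall b t, near_ray N z b t -> `|f (z, b, t) - f (H z)| <= e)).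
move=> z _.
(* The filter of points close to the ray above [y], as [y] tends to [z] and [N] to infinity; it
   converges to [H z], so [f] can be passed to the limit along it. *)
pose F : set_system (R * {ptws nat -> R} * R)%type := [set A |
  \forall y \near z & N \near \oo, forall b t, near_ray N y b t -> A (y, b, t)].
pose W : set_system (R * nat) := filter_prod (nbhs z) \oo.
have FF : Filter F.
  split; first exact: (@filterS _ W _ _ _ _ filterT).
    move=> A B FA FB; apply: (@filterS _ W _ _ _ _ (@filterI _ W _ _ _ FA FB)) => p [hA hB] b t h.
    by split; [exact: hA|exact: hB].
  by move=> A B AB; apply: (@filterS _ W) => p hA b t h; exact/AB/hA.
have dist (k del : R) : 0 < del -> \forall y \near z & N \near \oo,
    forall s, `|s - k * y| <= N.+1%:R^-1 -> `|k * z - s| <= del.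
  move=> del0; have d2 : 0 < del / 2 by rewrite divr_gt0.
  have /cvgrPdist_le /(_ _ d2) h1 : (fun y => k * y) @ z --> k * z by apply: cvgM => //; exact: cvg_cst.
  exists ([set y | `|k * z - k * y| <= del / 2], [set N | N.+1%:R^-1 < del / 2]).
    by split => //=; exact: (near_infty_natSinv_lt (PosNum d2)).
  move=> [y N] /= [hy hN] s hs; rewrite (_ : k * z - s = (k * z - k * y) - (s - k * y)); last by ring.
  rewrite (le_trans (ler_normB _ _))// [leRHS]splitr lerD//.
  by rewrite (le_trans hs)// ltW.
have F1 : y.1.1 @[y --> F] --> z.
  move=> A hA; have hW : W (fst @^-1` A) by exact: cvg_fst hA.
  by apply: (@filterS _ W _ _ _ _ hW) => p Ap b t _.
have F2 : y.1.2 @[y --> F] --> ((fun i => a i * z) : {ptws nat -> R}).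
  apply/pointwise_cvgP => i; apply/cvgrPdist_le => del del0.
  have hi : \forall y \near z & N \near \oo, (i < N)%N.
    by apply: cvg_snd; exact: nbhs_infty_gt.
  apply: (@filterS _ W _ _ _ _ (@filterI _ W _ _ _ hi (dist (a i) del del0))) => -[y N] /= [iN h] b t [hb _].
  by apply: h; exact: hb.
have F3 : y.2 @[y --> F] --> c * z.
  apply/cvgrPdist_le => del del0.
  by apply: (@filterS _ W _ _ _ _ (dist c del del0)) => -[y N] /= h b t [_ ht]; exact: h.
have FH : F --> H z.
  move=> A [[A1 A2] [/= [[B1 B2] [/= hB1 hB2] hB] hA2] hA].
  apply: (@filterS _ F _ _ _ _ (@filterI _ F _ _ _ (@filterI _ F _ _ _ (F1 _ hB1) (F2 _ hB2)) (F3 _ hA2))).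
  by move=> [[y b] t] [[h1 h2] h3]; apply: hA; split => //; exact: hB.
have e2 : 0 < e / 2 by rewrite divr_gt0.
have : f @ F --> f (H z) by apply: cvg_trans (cf (H z)); exact: cvg_app.
move/cvgrPdist_le => /(_ _ e2); apply: (@filterS _ W) => -[y N] /= h b t hb.
have h1 := h b t hb.
have h2 : `|f (H z) - f (H y)| <= e / 2.
  apply: h; split; last by rewrite subrr normr0 invr_ge0.
  by move=> i _; rewrite subrr normr0 invr_ge0.
(* The comparison goes through [H z]: the point [H y] lies itself in every such neighbourhood, with
   zero error. *)
rewrite (_ : f (y, b, t) - f (H y) = (f (H z) - f (H y)) - (f (H z) - f (y, b, t))); last by ring.
by rewrite (le_trans (ler_normB _ _))// [leRHS]splitr lerD.
Qed.

End Product_topology.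

Section Exponential_approximation.
Context (R : realType) (d : measure_display) (T : measurableType d) (P : probability T R).
Variables (Y : {RV P >-> R}) (rate : R).
Hypothesis rate0 : 0 < rate.
Hypothesis Y_exp : exponentially_distributed Y rate.

Lemma exponential_polynomial (p : {poly R}) :
  \int[P]_w p.[expR (- Num.max 0 (Y w))] = \sum_(i < size p) p`_i * (rate / (rate + i%:R)).
Proof.
have mY : measurable_fun setT (fun w => Num.max 0 (Y w)) by exact: measurable_maxr.
rewrite (Rintegral_poly P measurableT _ mY); last by move=> w; rewrite le_max lexx.
apply: eq_bigr => i _; congr (_ * _).
rewrite /Rintegral -[RHS]/(fine (rate / (rate + i%:R))%:E) -(exponential_laplace rate0 Y_exp).
by congr fine; apply: eq_integral => w _; rewrite -expRM_natl mulrN.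
Qed.

Lemma exponential_close (g : R -> R) (p : {poly R}) M K e : continuous g ->
  (forall x, `|g x| <= M) -> (forall t, 0 <= t <= 1 -> `|p.[t]| <= M) -> 0 < K -> 0 <= e ->
  (forall z, 0 <= z <= K -> `|p.[expR (- z)] - g z| <= e) ->
  `|\int[P]_w p.[expR (- Num.max 0 (Y w))] - \int[P]_w g (Y w)| <= e + 2 * M * expR (- rate * K).
Proof.
move=> cg gM pM K0 e0 pg.
have M0 : 0 <= M by exact: le_trans (gM 0).
pose B := [set w | ~~ (0 <= Y w <= K)].
have mB : measurable B.
  have mI : measurable (Y @^-1` `[0, K]%classic).
    by rewrite -(setTI (_ @^-1` _)); exact: (measurable_funP Y).
  rewrite (_ : B = ~` (Y @^-1` `[0, K]%classic)); first exact: measurableC.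
  by apply/seteqP; split => w /=; rewrite in_itv /= => /negP.
have PT : fine (P setT) = 1 by rewrite probability_setT.
have mp : measurable_fun setT (fun w => p.[expR (- Num.max 0 (Y w))]).
  have mY : measurable_fun setT (fun w => Num.max 0 (Y w)) by exact: measurable_maxr.
  have : measurable_fun setT (fun t : R => p.[t]).
    by apply: continuous_measurable_fun; exact: continuous_horner.
  move=> /measurableT_comp; apply; apply: measurableT_comp => //.
  exact: measurableT_comp.
have mg : measurable_fun setT (fun w => g (Y w)).
  by apply: measurableT_comp => //; exact: continuous_measurable_fun.
have mD : measurable_fun setT (fun w => 2 * M * \1_B w).
  by apply: measurable_funM => //; exact: measurable_indic.
have -> : e = e * fine (P setT) by rewrite PT mulr1.
have e01 w : 0 <= expR (- Num.max 0 (Y w)) <= 1.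
  by rewrite expR_ge0 -expR0 ler_expR oppr_le0 le_max lexx.
apply: (Rintegral_close measurableT mp mg mD _ _ e0) => //.
- by move=> w; apply: pM.

- by move=> w; rewrite !mulr_ge0.
- under eq_integral do rewrite EFinM.
  rewrite ge0_integralZl//; [|by apply/measurable_EFinP|by rewrite lee_fin mulr_ge0].
  rewrite integral_indic// setIT (EFinM (2 * M)) lee_wpmul2l ?lee_fin ?mulr_ge0//.
  by rewrite le_eqVlt; apply/orP; left; apply/eqP; exact: exponential_tail.
move=> w _; rewrite indicE.
have [/andP[Y0 YK]|h] := boolP (0 <= Y w <= K).
  by rewrite max_r// (le_trans (pg _ _)) ?Y0// lerDl !mulr_ge0.
rewrite mem_set// mulr1 (le_trans (ler_normB _ _))//.
by rewrite -[leLHS]add0r lerD// mulr2n mulrDl mul1r lerD// pM.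
Qed.

End Exponential_approximation.

(** * Convergence of conditional means of test functions *)

Section Weak_convergence.
Context (R : realType) (dim : nat) (Q : probability nat R) (d : measure_display)
  (T : measurableType d) (P : probability T R) (offspring : seq nat -> {RV P >-> nat})
  (step : seq nat -> T -> 'rV[int]_dim).
Hypothesis brw : branching_random_walk Q offspring step.
Variable sigma2 : R.
Hypothesis dim_ge3 : (3 <= dim)%N.
Hypothesis Q_mean : (\int[Q]_l (l%:R)%:E = 1)%E.
Hypothesis Q_pairs : (\int[Q]_l ((l * l.-1)%:R)%:E = sigma2%:E)%E.
Hypothesis sigma2_gt0 : 0 < sigma2.
Local Notation cloud n := (cloud offspring step n [::]).
Local Notation site_mean := (site_mean offspring step).
Local Notation survival := (survival offspring).
Local Notation q n := (fine (P (survival n))).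
Local Notation Z n w := ((size (cloud n w))%:R / n%:R : R).
Local Notation dev p n w :=
  `|(sites p (cloud n w))%:R - limn (site_mean p) * (size (cloud n w))%:R : R|.

Variable r : R.
Hypothesis rE : r = 2 / sigma2.

Let r0 : 0 < r. Proof. by rewrite rE divr_gt0. Qed.

Lemma measurable_cloud_real n (h : seq 'rV[int]_dim -> R) :
  measurable_fun setT (fun w => h (cloud n w)).
Proof. by apply/measurable_EFinP; exact: (measurable_cloud brw n (fun B => (h B)%:E)). Qed.

Lemma survival_rate_lower : \forall n \near \oo, r / 2 <= n%:R * q n.
Proof.
have /cvgrPdist_le /(_ (r / 2)) := survival_rate brw Q_mean Q_pairs sigma2_gt0.
have r2 : 0 < r / 2 by rewrite divr_gt0.
move=> /(_ r2); apply: filterS => n; rewrite -rE => /(le_trans (ler_norm _)); lra.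
Qed.

Lemma integral_scaled_size K n : 0 <= K ->
  (\int[P]_w (K * Z n w)%:E = (K / n%:R)%:E)%E.
Proof.
move=> K0.
transitivity (\int[P]_w ((K / n%:R)%:E * ((size (cloud n w))%:R)%:E))%E.
  by apply: eq_integral => w _; rewrite -EFinM; congr EFin; rewrite mulrA mulrAC.
have m4 := measurable_cloud brw n (fun B => ((size B)%:R)%:E).
rewrite ge0_integralZl//; last by rewrite lee_fin divr_ge0.
by rewrite (integral_size brw Q_mean) mule1.
Qed.

Lemma polynomial_given (p : {poly R}) :
  (fun n => (\int[P]_(w in survival n) p.[expR (- Z n w)]) / q n) @ \oo -->
  \sum_(i < size p) p`_i * (r / (r + i%:R)).
Proof.
have -> : (fun n => (\int[P]_(w in survival n) p.[expR (- Z n w)]) / q n) =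
    (fun n => \sum_(i < size p) p`_i * laplace_given offspring step n i).
  apply/funext => n.
  rewrite (Rintegral_poly P (measurable_survival brw n)); last 2 first.
  - exact: (@measurable_cloud_real n (fun B => (size B)%:R / n%:R)).
  - by move=> w; rewrite divr_ge0.
  rewrite mulr_suml; apply: eq_bigr => i _; rewrite -mulrA; congr (_ * (fine _ / _)).
  apply: eq_integral => w _; congr EFin; rewrite -!expRM_natl; congr expR.
  by rewrite !mulrN mulrCA.
rewrite (_ : \sum_(i < _) _ = \sum_(i < size p) p`_i * (1 + i%:R * (sigma2 / 2))^-1).
  apply: (@cvg_sum_seq R 'I_(size p) _ (fun i => p`_i) (fun i => (1 + i%:R * (sigma2 / 2))^-1)
    (fun i n => laplace_given offspring step n i)) => i _.
  exact: (laplace_given_cvg brw Q_mean Q_pairs sigma2_gt0).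
apply: eq_bigr => i _; congr (_ * _); rewrite rE.
have h : 0 < 2 + i%:R * sigma2 by rewrite ltr_pwDl// mulr_ge0// ltW.
by field; rewrite !gt_eqF//= mulrC.
Qed.


(** Polynomials in exp(-z) approximate [g] on [0, K]. Tightness comes from the unconditional mean of
    Z_n/n being 1/n: by Markov's inequality the part beyond K costs 2M/(K n) before division by the
    survival probability. *)
Lemma size_given_cvg (d' : measure_display) (T' : measurableType d') (P' : probability T' R)
    (Y : {RV P' >-> R}) (g : R -> R) M : exponentially_distributed Y r ->
  continuous g -> (forall x, `|g x| <= M) ->
  (fun n => (\int[P]_(w in survival n) g (Z n w)) / q n) @ \oo --> \int[P']_w g (Y w).
Proof.
move=> Y_exp cg gM; apply/cvgrPdist_le => e e0.
have M0 : 0 <= M by exact: le_trans (gM 0).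
have e8 : 0 < e / 8 by rewrite divr_gt0.
(* Chosen so that 2M/K <= (e/8)(r/2), r/2 being the eventual lower bound of n P(G_n); the same K
   handles the exponential tail through exp(-x) <= 1/x. *)
pose K := 32 * M / (r * e) + 1.
have K0 : 0 < K.
  by rewrite ltr_wpDl// (divr_ge0 _ (ltW (mulr_gt0 r0 e0)))// mulr_ge0.
have MK : 2 * M / K <= e / 8 * (r / 2).
  rewrite ler_pdivrMr//.
  have -> : e / 8 * (r / 2) * K = 2 * M + e * r / 16 by rewrite /K; field; rewrite !gt_eqF.
  by rewrite lerDl divr_ge0// mulr_ge0// ltW.
have [p [pM pg]] := @exp_polynomial_approx R g M K _ cg gM e8.
have hY := exponential_close Y_exp cg gM pM K0 (ltW e8) pg.
have tail : 2 * M * expR (- r * K) <= e / 8.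
  have rK : 0 < r * K by rewrite mulr_gt0.
  apply: (@le_trans _ _ (2 * M / (r * K))).
    rewrite ler_wpM2l ?mulr_ge0// mulNr expRN lef_pV2 ?posrE ?expR_gt0//.
    by rewrite (le_trans _ (expR_ge1Dx _))// lerDr.
  rewrite ler_pdivrMr//; move: MK; rewrite ler_pdivrMr// => /le_trans; apply.
  rewrite -[leLHS]mulrA ler_wpM2l ?(ltW e8)// ler_wpM2r ?(ltW K0)//.
  by rewrite ler_pdivrMr// ler_peMr ?(ltW r0)// ler1n.
have hp : \forall n \near \oo, `|\int[P']_w p.[expR (- Num.max 0 (Y w))] -
    (\int[P]_(w in survival n) p.[expR (- Z n w)]) / q n| <= e / 8.
  rewrite (exponential_polynomial r0 Y_exp).
  by have /cvgrPdist_le /(_ _ e8) := @polynomial_given p.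
near=> n.
have n0 : (0 < n)%N by near: n; exact: nbhs_infty_gt.
have nR : 0 < n%:R :> R by rewrite ltr0n.
have q0 : 0 < q n := survival_gt0 brw Q_mean n.
have nq : r / 2 <= n%:R * q n by near: n; exact: survival_rate_lower.
have hpn : `|\int[P']_w p.[expR (- Num.max 0 (Y w))] -
    (\int[P]_(w in survival n) p.[expR (- Z n w)]) / q n| <= e / 8 by near: n; exact: hp.
have Z0 w : 0 <= Z n w by rewrite divr_ge0.
have D0 : 0 <= 2 * M / K by rewrite divr_ge0 ?mulr_ge0// ltW.
have hn : `|\int[P]_(w in survival n) p.[expR (- Z n w)] - \int[P]_(w in survival n) g (Z n w)| <=
    e / 8 * q n + 2 * M / K / n%:R.
  have mS := measurable_survival brw n.
  have m1 := measurable_cloud_real n (fun B => p.[expR (- ((size B)%:R / n%:R))]).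
  have m2 := measurable_cloud_real n (fun B => g ((size B)%:R / n%:R)).
  have m3 := measurable_cloud_real n (fun B => 2 * M / K * ((size B)%:R / n%:R)).
  have p1 w : `|p.[expR (- Z n w)]| <= M.
    by apply: pM; rewrite expR_ge0/= -[leRHS]expR0 ler_expR oppr_le0 Z0.
  apply: (Rintegral_close mS m1 m2 m3 p1 _ (ltW e8)).
  - by move=> w; exact: gM.
  - by move=> w; rewrite mulr_ge0.
  - by rewrite integral_scaled_size.
  move=> w _; have [ZK|ZK] := leP (Z n w) K.
    by rewrite (le_trans (pg _ _)) ?Z0// lerDl mulr_ge0.
  rewrite (le_trans (ler_normB _ _))// ler_wpDl ?(ltW e8)//.
  apply: (@le_trans _ _ (2 * M)); first by rewrite mulr2n mulrDl mul1r lerD.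
  by rewrite -mulrA ler_peMr ?mulr_ge0// mulrC ler_pdivlMr// mul1r ltW.
have hq : `|(\int[P]_(w in survival n) p.[expR (- Z n w)]) / q n -
    (\int[P]_(w in survival n) g (Z n w)) / q n| <= e / 8 + e / 8.
  rewrite -mulrBl normrM normfV (gtr0_norm q0) ler_pdivrMr// (le_trans hn)// [leRHS]mulrDl lerD2l.
  rewrite ler_pdivrMr// -[leRHS]mulrA [q n * _]mulrC (le_trans MK)// ler_wpM2l// ltW//.
move: hY hpn hq; set x1 := \int[P']_w g _; set x2 := \int[P']_w _.
set x3 := _ / q n; set x4 := _ / q n => hY hpn hq.
rewrite (_ : x1 - x4 = - (x2 - x1) + (x2 - x3) + (x3 - x4)); last by ring.
rewrite (le_trans (ler_normD _ _))// (le_trans (lerD (ler_normD _ _) (lexx _)))// normrN.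
by move: hY hpn hq tail e0; lra.
Unshelve. all: by end_near. Qed.

Lemma sites_lln_sum N e : 0 < e -> \forall n \near \oo,
  (\int[P]_w (\sum_(i < N) dev (pred1 i.+1) n w)%:E <= e%:E)%E.
Proof.
elim: N e => [|N ih] e e0.
  apply: nearW => n; under eq_integral do rewrite big_ord0.
  by rewrite integral0 lee_fin ltW.
have e2 : 0 < e / 2 by rewrite divr_gt0.
have h := site_lln brw dim_ge3 Q_mean Q_pairs sigma2_gt0 (isT : ~~ pred1 N.+1 0%N) e2.
near=> n; under eq_integral do rewrite big_ord_recr /= EFinD.
have m1 := measurable_cloud_real n (fun B => \sum_(i < N)
  `|(sites (pred1 i.+1) B)%:R - limn (site_mean (pred1 i.+1)) * (size B)%:R|).
have m2 := measurable_cloud_real n (fun B =>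
  `|(sites (pred1 N.+1) B)%:R - limn (site_mean (pred1 N.+1)) * (size B)%:R|).
rewrite ge0_integralD//; try by [apply/measurable_EFinP|move=> w _; rewrite lee_fin ?sumr_ge0].
rewrite (splitr e) EFinD; apply: leeD; near: n; [exact: ih|exact: h].
Unshelve. all: by end_near. Qed.

Local Notation a := (fun i : nat => intensity offspring step i.+1).
Local Notation c := (occupation_intensity offspring step).
Local Notation stats n w := ((Z n w, (fun i : nat => (sites (pred1 i.+1) (cloud n w))%:R / n%:R),
  (sites (ltn 0) (cloud n w))%:R / n%:R) : (R * {ptws nat -> R} * R)%type).
Local Notation H z := ((z, (fun i : nat => a i * z), c * z) : (R * {ptws nat -> R} * R)%type).

(** Two exceptional events are removed by Markov's inequality: Z_n/n beyond [K], and a total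
    deviation from the ray above n/(N + 1). Elsewhere [uniform_on_ray] applies. *)
Lemma ray_close (f : (R * {ptws nat -> R} * R)%type -> R) M e : continuous f ->
  (forall x, `|f x| <= M) -> 0 < e -> \forall n \near \oo,
  `|\int[P]_(w in survival n) f (stats n w) - \int[P]_(w in survival n) f (H (Z n w))| <= e * q n.
Proof.
move=> cf fM e0.
have M0 : 0 <= M by exact: le_trans (fM (H 0)).
have e2 : 0 < e / 2 by rewrite divr_gt0.
pose K := 16 * M / (r * e) + 1.
have K0 : 0 < K.
  by rewrite ltr_wpDl// (divr_ge0 _ (ltW (mulr_gt0 r0 e0)))// mulr_ge0.
have MK : 2 * M / K <= e / 4 * (r / 2).
  rewrite ler_pdivrMr//.
  have -> : e / 4 * (r / 2) * K = 2 * M + e * r / 8 by rewrite /K; field; rewrite !gt_eqF.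
  by rewrite lerDl divr_ge0// mulr_ge0// ltW.
have [N hN] := uniform_on_ray a c K cf e2.
(* When S/n exceeds 1/(N + 1), the trivial bound 2M is at most C S/n. The next constant [e1] gives C
   e1 <= (e/4)(r/2), with C + 1 in its denominator since [C] may vanish. *)
pose C := 2 * M * N.+1%:R; have C0 : 0 <= C by rewrite !mulr_ge0.
pose e1 := e * r / (8 * (C + 1)).
have C1 : 0 < C + 1 by rewrite ltr_wpDl.
have e10 : 0 < e1 by rewrite (divr_gt0 (mulr_gt0 e0 r0))// mulr_gt0.
have e12 : 0 < e1 / 2 by rewrite divr_gt0.
have lln0 := site_lln brw dim_ge3 Q_mean Q_pairs sigma2_gt0 (isT : ~~ ltn 0 0%N) e12.
have llnN := sites_lln_sum N e12.
near=> n.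
have n0 : (0 < n)%N by near: n; exact: nbhs_infty_gt.
have nq : r / 2 <= n%:R * q n by near: n; exact: survival_rate_lower.
have nR : 0 < n%:R :> R by rewrite ltr0n.
have q0 : 0 < q n := survival_gt0 brw Q_mean n.
pose S w := dev (ltn 0) n w + \sum_(i < N) dev (pred1 i.+1) n w.
have S0 w : 0 <= S w by rewrite addr_ge0 ?sumr_ge0.
have mS : measurable_fun setT S.
  exact: (@measurable_cloud_real n (fun B => `|(sites (ltn 0) B)%:R - limn (site_mean (ltn 0)) * (size B)%:R| +
   \sum_(i < N) `|(sites (pred1 i.+1) B)%:R - limn (site_mean (pred1 i.+1)) * (size B)%:R|)).
have iS : (\int[P]_w (S w)%:E <= e1%:E)%E.
  under eq_integral do rewrite EFinD.
  have m1 := measurable_cloud_real n (fun B =>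
    `|(sites (ltn 0) B)%:R - limn (site_mean (ltn 0)) * (size B)%:R|).
  have m2 := measurable_cloud_real n (fun B => \sum_(i < N)
    `|(sites (pred1 i.+1) B)%:R - limn (site_mean (pred1 i.+1)) * (size B)%:R|).
  rewrite ge0_integralD//; try by [apply/measurable_EFinP|move=> w _; rewrite lee_fin ?sumr_ge0].
  by rewrite (splitr e1) EFinD; apply: leeD; near: n; [exact: lln0|exact: llnN].
have D0 : 0 <= 2 * M / K by rewrite divr_ge0 ?mulr_ge0// ltW.
have D1 : 0 <= C / n%:R by rewrite divr_ge0.
pose D w := 2 * M / K * Z n w + C / n%:R * S w.
have mD : measurable_fun setT D.
  apply: measurable_funD; last exact: measurable_funM.
  exact: (@measurable_cloud_real n (fun B => 2 * M / K * ((size B)%:R / n%:R))).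
have iD : (\int[P]_w (D w)%:E <= (2 * M / K / n%:R + C / n%:R * e1)%:E)%E.
  have m1 := measurable_cloud_real n (fun B => 2 * M / K * ((size B)%:R / n%:R)).
  under eq_integral do rewrite EFinD.
  rewrite ge0_integralD//; try by [apply/measurable_EFinP; exact: measurable_funM|
    apply/measurable_EFinP|move=> w _; rewrite lee_fin mulr_ge0// divr_ge0].
  rewrite integral_scaled_size// EFinD leeD2l//.
  under eq_integral do rewrite EFinM.
  rewrite ge0_integralZl//; try by [apply/measurable_EFinP|move=> w _; rewrite lee_fin].
  by rewrite (EFinM (C / n%:R)) lee_wpmul2l// lee_fin.
have mf1 := measurable_cloud_real n (fun B => f (((size B)%:R / n%:R,
  (fun i : nat => (sites (pred1 i.+1) B)%:R / n%:R), (sites (ltn 0) B)%:R / n%:R))).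
have mf2 := measurable_cloud_real n (fun B => f (H ((size B)%:R / n%:R))).
apply: (le_trans (Rintegral_close (measurable_survival brw n) mf1 mf2 mD (fun w => fM _)
  (fun w => fM _) (ltW e2) _ iD _)).
- by move=> w; rewrite /D addr_ge0// mulr_ge0// divr_ge0.
- move=> w _.
  have big2 : `|f (stats n w) - f (H (Z n w))| <= 2 * M.
    by rewrite (le_trans (ler_normB _ _))// mulr2n mulrDl mul1r lerD.
  have Z0 : 0 <= Z n w by rewrite divr_ge0.
  have [ZK|ZK] := leP (Z n w) K; last first.
    rewrite (le_trans big2)// ler_wpDl ?(ltW e2)// /D ler_wpDr ?mulr_ge0//.
    by rewrite -mulrA ler_peMr ?mulr_ge0// mulrC ler_pdivlMr// mul1r ltW.
  have [Sn|Sn] := leP (S w / n%:R) (N.+1%:R^-1); last first.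
    rewrite (le_trans big2)// ler_wpDl ?(ltW e2)// /D ler_wpDl ?(mulr_ge0 D0 Z0)//.
    have -> : C / n%:R * S w = 2 * M * (N.+1%:R * (S w / n%:R)).
      by rewrite /C; field; rewrite gt_eqF.
    by rewrite ler_peMr ?mulr_ge0// -ler_pdivrMl// mulr1 ltW.
  have devn p : dev p n w <= S w ->
      `|(sites p (cloud n w))%:R / n%:R - limn (site_mean p) * Z n w| <= N.+1%:R^-1.
    move=> pS; apply: le_trans Sn; rewrite mulrA -mulrBl normrM [X in _ * X]ger0_norm ?invr_ge0//.
    by rewrite ler_wpM2r ?invr_ge0.
  apply: (@le_trans _ _ (e / 2)); last by rewrite lerDl addr_ge0 ?(mulr_ge0 D0 Z0) ?(mulr_ge0 D1 (S0 w)).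
  apply: hN; first by rewrite Z0.
    move=> i iN; apply: devn; rewrite /S (bigD1 (Ordinal iN))//= addrCA lerDl addr_ge0//.
    exact: sumr_ge0.
  by apply: devn; rewrite /S lerDl sumr_ge0.
apply: (@le_trans _ _ (e / 2 * q n + e / 2 * q n)); last by rewrite -mulrDl -splitr.
rewrite lerD2l.
have h1 : 2 * M / K / n%:R <= e / 4 * q n.
  rewrite ler_pdivrMr// -[leRHS]mulrA [q n * _]mulrC (le_trans MK)// ler_wpM2l//.
  by rewrite divr_ge0// ltW.
have h2 : C / n%:R * e1 <= e / 4 * q n.
  rewrite mulrAC ler_pdivrMr//.
  apply: (@le_trans _ _ (e / 4 * (r / 2))); last first.
    by rewrite -[leRHS]mulrA [q n * _]mulrC ler_wpM2l// divr_ge0// ltW.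
  rewrite /e1 (_ : C * _ = e / 4 * (r / 2) * (C / (C + 1))); last first.
    by field; rewrite gt_eqF// ltr_wpDl.
  by rewrite ler_piMr ?mulr_ge0 ?divr_ge0 ?(ltW r0) ?(ltW e0)// ler_pdivrMr ?ltr_wpDl// mul1r lerDl.
by move: h1 h2; lra.
Unshelve. all: by end_near. Qed.

End Weak_convergence.

(** * The intensities and the joint limit *)

Section Occupation.
Context (R : realType) (dim : nat) (Q : probability nat R) (d : measure_display)
  (T : measurableType d) (P : probability T R) (offspring : seq nat -> {RV P >-> nat})
  (step : seq nat -> T -> 'rV[int]_dim).
Hypothesis brw : branching_random_walk Q offspring step.
Variable sigma2 : R.
Hypothesis dim_ge3 : (3 <= dim)%N.
Hypothesis Q_mean : (\int[Q]_l (l%:R)%:E = 1)%E.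
Hypothesis Q_pairs : (\int[Q]_l ((l * l.-1)%:R)%:E = sigma2%:E)%E.
Hypothesis sigma2_gt0 : 0 < sigma2.
Local Notation cloud n := (cloud offspring step n [::]).
Local Notation site_mean := (site_mean offspring step).
Local Notation bound := (collision_bound dim sigma2).
Local Notation intensity := (intensity offspring step).
Local Notation occupation_intensity := (occupation_intensity offspring step).

(** Letting n tend to infinity at fixed [J] squeezes the partial sum between l - bound/J and l; then
    J tends to infinity. *)
Lemma sum_intensity (a : nat -> nat) (h : seq 'rV[int]_dim -> nat) (u : nat -> R) (l : R) :
  (forall J B, \sum_(1 <= j < J) a j * sites (pred1 j) B <= h B /\
    J * h B <= J * (\sum_(1 <= j < J) a j * sites (pred1 j) B) + coll B B)%N ->
  (forall n, (\int[P]_w ((h (cloud n w))%:R)%:E = (u n)%:E)%E) -> u @ \oo --> l ->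
  (fun J => \sum_(1 <= j < J) (a j)%:R * intensity j) @ \oo --> l.
Proof.
move=> H ih ul.
have S J : (fun n => \sum_(1 <= j < J) (a j)%:R * site_mean (pred1 j) n) @ \oo -->
    \sum_(1 <= j < J) (a j)%:R * intensity j.
  apply: (@cvg_sum_seq R nat (index_iota 1 J) (fun j => (a j)%:R) intensity (fun j => site_mean (pred1 j))).
  move=> j; rewrite mem_index_iota => /andP[j0 _].
  by apply: (site_mean_cvg brw dim_ge3 Q_mean Q_pairs); rewrite /= eq_sym -lt0n.
have B J n : (0 < J)%N ->
    u n - bound / J%:R <= \sum_(1 <= j < J) (a j)%:R * site_mean (pred1 j) n <= u n.
  move=> J0; apply: (sum_site_mean_bounds brw dim_ge3 Q_mean Q_pairs J0 _ _ (ih n)) => s.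
    exact: (H J s).1.
  exact: (H J s).2.
have L J : (0 < J)%N -> l - bound / J%:R <= \sum_(1 <= j < J) (a j)%:R * intensity j <= l.
  move=> J0; apply/andP; split.
    apply: (ler_cvg_to (cvgB ul (cvg_cst _)) (S J)).
    by apply: nearW => n; have /andP[] := B J n J0.
  apply: (ler_cvg_to (S J) ul).
  by apply: nearW => n; have /andP[] := B J n J0.
have N : \forall J \near \oo, l - bound * J%:R^-1 <= \sum_(1 <= j < J) (a j)%:R * intensity j <= l.
  by near=> J; apply: L; near: J; exact: nbhs_infty_gt.
apply: (squeeze_cvgr N _ (cvg_cst l)).
rewrite -[X in _ --> X](subr0 l) -[X in l - X](mulr0 bound).
apply: cvgB; first exact: cvg_cst.
by apply: cvgM; [exact: cvg_cst|exact: cvg_natV].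
Unshelve. all: by end_near. Qed.

Lemma sum_mul_intensity :
  (fun J => \sum_(1 <= j < J) j%:R * intensity j) @ \oo --> (1 : R).
Proof.
apply: (sum_intensity (a := id) (h := size) (u := fun=> 1)).
- exact: size_sites.
- by move=> n; exact: (integral_size brw Q_mean n).
- exact: cvg_cst.
Qed.

Lemma sum_intensity_occupation :
  (fun J => \sum_(1 <= j < J) intensity j) @ \oo --> occupation_intensity.
Proof.
rewrite (_ : (fun J => _) = (fun J => \sum_(1 <= j < J) 1%:R * intensity j)); last first.
  by apply/funext => J; apply: eq_bigr => j _; rewrite mul1r.
apply: (@sum_intensity (fun=> 1%N) (sites (ltn 0)) (site_mean (ltn 0))).
- by move=> J B; under eq_bigr do rewrite mul1n; exact: occupied_sites_split.
- by move=> n; exact: (integral_esites brw Q_mean (isT : ~~ ltn 0 0%N)).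
- exact: (site_mean_cvg brw dim_ge3 Q_mean Q_pairs (isT : ~~ ltn 0 0%N)).
Qed.

Lemma continuous_ray (a : nat -> R) (c : R) :
  continuous (fun z : R => ((z, (fun i => a i * z), c * z) : (R * {ptws nat -> R} * R)%type)).
Proof.
move=> z.
have F2 : (fun y i => a i * y) @ z --> ((fun i => a i * z) : {ptws nat -> R}).
  apply/pointwise_cvgP => i.
  have : (fun y => a i * y) @ z --> a i * z by apply: cvgM => //; exact: cvg_cst.
  exact.
have F3 : (fun y => c * y) @ z --> c * z by apply: cvgM => //; exact: cvg_cst.
move=> A [[A1 A2] [/= [[B1 B2] [/= hB1 hB2] hB] hA2] hA].
apply: (@filterS _ (nbhs z) _ _ _ _ (filterI (filterI hB1 (F2 _ hB2)) (F3 _ hA2))).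
by move=> y [[h1 h2] h3]; apply: hA; split => //; exact: hB.
Qed.

Lemma multiplicity_sites_cloud n j w :
  multiplicity_sites offspring step n j w = sites (pred1 j) (cloud n w).
Proof. by rewrite /multiplicity_sites positions_cloud. Qed.

Lemma occupied_sites_cloud n w : occupied_sites offspring step n w = sites (ltn 0) (cloud n w).
Proof.
rewrite /occupied_sites positions_cloud -count_predT; apply: eq_in_count => x.
by rewrite mem_undup -has_pred1 has_count => xB; exact/esym.
Qed.

(** The statistics are first replaced by the point of the ray above Z_n/n; composing [f] with the
    continuous ray leaves a bounded continuous function of one real variable. *)
Lemma occupation_given_cvg (d' : measure_display) (T' : measurableType d') (P' : probability T' R)
    (Y : {RV P' >-> R}) : exponentially_distributed Y (2 / sigma2) ->
  cvg_in_law_given (E := (R * {ptws nat -> R} * R)%type) P (survival offspring)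
    (fun n w => ((population offspring n w)%:R / n%:R,
      (fun i : nat => (multiplicity_sites offspring step n i.+1 w)%:R / n%:R),
      (occupied_sites offspring step n w)%:R / n%:R))
    P' (fun w => (Y w, (fun i : nat => intensity i.+1 * Y w), occupation_intensity * Y w)).
Proof.
move=> Y_exp.
rewrite [X in cvg_in_law_given _ _ X](_ : _ = (fun n w => ((size (cloud n w))%:R / n%:R,
    (fun i : nat => (sites (pred1 i.+1) (cloud n w))%:R / n%:R),
    (sites (ltn 0) (cloud n w))%:R / n%:R) : (R * {ptws nat -> R} * R)%type)); last first.
  apply/funext => n; apply/funext => w; rewrite (population_cloud offspring step) occupied_sites_cloud.
  by congr (_, _, _); apply/funext => i; rewrite multiplicity_sites_cloud.
move=> f cf [M fM].
pose H z : (R * {ptws nat -> R} * R)%type :=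
  (z, (fun i : nat => intensity i.+1 * z), occupation_intensity * z).
pose Z n w := (size (cloud n w))%:R / n%:R : R.
have c1 := size_given_cvg brw Q_mean Q_pairs sigma2_gt0 erefl Y_exp
  (fun x => continuous_comp (@continuous_ray (fun i => intensity i.+1) occupation_intensity x) (cf _))
  (fun x => fM (H x)).
apply/cvgrPdist_le => e e0; have e2 : 0 < e / 2 by rewrite divr_gt0.
have c2 := ray_close brw dim_ge3 Q_mean Q_pairs sigma2_gt0 erefl cf fM e2.
move/cvgrPdist_le => /(_ _ e2) in c1.
near=> n.
have q0 : 0 < fine (P (survival offspring n)) := survival_gt0 brw Q_mean n.
have h1 : `|\int[P']_w f (H (Y w)) -
    (\int[P]_(w in survival offspring n) f (H (Z n w))) / fine (P (survival offspring n))| <= e / 2.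
  by near: n; exact: c1.
have h2 : `|\int[P]_(w in survival offspring n) f (Z n w,
      (fun i : nat => (sites (pred1 i.+1) (cloud n w))%:R / n%:R),
      (sites (ltn 0) (cloud n w))%:R / n%:R) -
    \int[P]_(w in survival offspring n) f (H (Z n w))| <= e / 2 * fine (P (survival offspring n)).
  by near: n; exact: c2.
rewrite -ler_pdivrMr// -[X in _ / X]gtr0_norm// -normrV ?unitfE ?gt_eqF// -normrM mulrBl in h2.
rewrite [leRHS]splitr; apply: le_trans (lerD h1 h2).
set x := \int[P']_w _; set y := _ / _; set z := _ / _.
by rewrite (_ : x - y = (x - z) - (y - z)); [exact: ler_normB|ring].
Unshelve. all: by end_near. Qed.

End Occupation.

(** * Moments of the offspring law and conclusion *)

Section Moments.
Context (R : realType) (Q : probability nat R) (sigma2 : R).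
Hypothesis Q_mean : ('E_Q[fun l : nat => l%:R] = 1)%E.
Hypothesis Q_variance : ('V_Q[fun l : nat => l%:R] = sigma2%:E)%E.

Lemma integral_id : (\int[Q]_l (l%:R)%:E = 1)%E.
Proof. by rewrite -Q_mean unlock. Qed.

(** From l(l - 1) + 1 = (l - 1)^2 + l: with mean 1, the second factorial moment equals the
    variance. *)
Lemma integral_pairs : (\int[Q]_l ((l * l.-1)%:R)%:E = sigma2%:E)%E.
Proof.
have v : (\int[Q]_l ((l%:R - 1) ^+ 2)%:E = sigma2%:E)%E.
  rewrite -Q_variance /variance unlock Q_mean /= unlock.
  by apply: eq_integral => l _; rewrite /= expr2.
have : (\int[Q]_l ((l * l.-1)%:R)%:E + \int[Q]_l 1%:E =
    \int[Q]_l ((l%:R - 1) ^+ 2)%:E + \int[Q]_l (l%:R)%:E)%E.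
  rewrite -!ge0_integralD//; try by move=> l _; rewrite lee_fin ?sqr_ge0.
  apply: eq_integral => -[|l] _ /=; rewrite -!EFinD; congr EFin.
    by rewrite mul0n; ring.
  by rewrite natrM -natr1; ring.
rewrite v integral_id (integral_probability_cst Q 1%E).
by move: (\int[Q]_l _)%E => [x| |]//; rewrite -!EFinD => -[/addIr ->].
Qed.

End Moments.

Theorem theorem5 (R : realType) (dim : nat) (Q : probability nat R) (sigma2 : R)
    (dim_ge3 : (3 <= dim)%N)
    (Q_mean : ('E_Q[fun l : nat => l%:R] = 1)%E)
    (Q_variance : ('V_Q[fun l : nat => l%:R] = sigma2%:E)%E)
    (sigma2_gt0 : 0 < sigma2) :
  exists kappa : nat -> R,
    (fun n => \sum_(1 <= j < n) j%:R * kappa j) @ \oo --> (1 : R) /\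
    forall (d : measure_display) (T : measurableType d) (P : probability T R)
      (offspring : seq nat -> {RV P >-> nat})
      (step : seq nat -> T -> 'rV[int]_dim)
      (d' : measure_display) (T' : measurableType d') (P' : probability T' R)
      (Y : {RV P' >-> R}),
    branching_random_walk Q offspring step ->
    exponentially_distributed Y (2 / sigma2) ->
    cvg_in_law_given (E := (R * {ptws nat -> R} * R)%type) P
      (survival offspring)
      (fun n w =>
        ((population offspring n w)%:R / n%:R,
         (fun i : nat => (multiplicity_sites offspring step n i.+1 w)%:R / n%:R),
         (occupied_sites offspring step n w)%:R / n%:R))
      P'
      (fun w =>
        (Y w,
         (fun i : nat => kappa i.+1 * Y w),
         limn (fun n => \sum_(1 <= j < n) kappa j) * Y w)).
Proof.
have m1 := integral_id Q_mean; have m2 := integral_pairs Q_mean Q_variance.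
(* [kappa] is chosen before the walk, so it is read off some realization if there is one. Otherwise
   the convergence is vacuous, and unit mass at j = 1 satisfies the normalization. *)
have [[d0 [T0 [P0 [offspring0 [step0 brw0]]]]]|nobrw] := pselect (exists d (T : measurableType d)
  (P : probability T R) (offspring : seq nat -> {RV P >-> nat})
  (step : seq nat -> T -> 'rV[int]_dim), branching_random_walk Q offspring step); last first.
  exists (fun j => (j == 1%N)%:R); split.
    apply: (@cvg_trans _ ((fun=> 1 : R) @ \oo)); last exact: cvg_cst.
    apply: near_eq_cvg; near=> n.
    rewrite (bigD1_seq 1%N) ?iota_uniq ?mem_index_iota//=; last first.
      by near: n; exact: nbhs_infty_gt.
    by rewrite mulr1 big1 ?addr0// => j /negbTE ->; rewrite mulr0.
  move=> d T P offspring step d' T' P' Y brw; exfalso; apply: nobrw.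
  by exists d, T, P, offspring, step.
exists (intensity offspring0 step0); split.
  exact: (sum_mul_intensity brw0 dim_ge3 m1 m2).
move=> d T P offspring step d' T' P' Y brw Y_exp.
(* Site means are values of [grow_mean], a functional of [Q] and the dimension, hence agree for any
   two realizations. *)
have -> : intensity offspring0 step0 = intensity offspring step.
  apply/funext => j; congr (limn _); apply/funext => n; congr fine.
  have h0 (s : seq 'rV[int]_dim) : (0 <= esites R (pred1 j) s)%E by rewrite lee_fin.
  transitivity (\int[P0]_w esites R (pred1 j) (cloud offspring0 step0 n [::] w))%E => //.
  by rewrite (integral_cloud_mean brw0 n [::] h0); exact/esym/(integral_cloud_mean brw n [::] h0).
have L := cvg_lim (@norm_hausdorff _ _) (sum_intensity_occupation brw dim_ge3 m1 m2).
rewrite L; exact: (occupation_given_cvg brw dim_ge3 m1 m2 sigma2_gt0 Y_exp).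
Unshelve. all: by end_near. Qed.
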